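(* Let $P$ be a set of $n$ points in the plane $\mathbb{R}^2$ such that $D(P)\le n/5$. Then, for any line $\ell$ in the plane, $$|P\cap \ell| = O^*\left(n^{43/52}\right).$$
   Context: For a finite set $P\subset\mathbb{R}^2$, $D(P)$ denotes the number of distinct (Euclidean) distances determined by pairs of points from $P$. The notation $O^*(\cdot)$ hides polylogarithmic factors: the conclusion means that there exist absolute constants $C,c>0$ such that for every $n\ge 2$, every such set $P$ of $n$ points and every line $\ell$, $|P\cap\ell|\le C\, n^{43/52}(\log n)^{c}$. *)

(* Defs.v *)
From HB Require Import structures.
From mathcomp Require Import all_boot all_order all_algebra.
From mathcomp Require Import finmap.
From mathcomp Require Import all_classical all_reals all_analysis.

Set Implicit Arguments.
Unset Strict Implicit.
Unset Printing Implicit Defensive.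

Import Order.TTheory GRing.Theory Num.Theory.

Local Open Scope fset_scope.
Local Open Scope classical_set_scope.
Local Open Scope ring_scope.

(* The norm that the library puts on [R * R] is the sup norm, hence this
   explicit Euclidean distance. *)
Definition eucl_dist (R : realType) (p q : R * R) : R :=
  Num.sqrt ((p.1 - q.1) ^+ 2 + (p.2 - q.2) ^+ 2).

(* The pairs are pairs of distinct points: 0 is not counted as a distance. *)
Definition num_distances (R : realType) (P : {fset R * R}) : nat :=
  #|` [fset eucl_dist p q | p in P, q in P & p != q] |.

Definition is_line (R : realType) (l : set (R * R)) : Prop :=
  exists a b c : R, (a, b) != (0, 0) /\
    l = [set p : R * R | a * p.1 + b * p.2 = c].

(* Main.v *)
Require Import Defs.
From HB Require Import structures.
From mathcomp Require Import all_boot all_order all_algebra.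
From mathcomp Require Import zify ring lra.

(** Coordinates.  After a similarity the line is the first axis.  One of the
    two closed half planes that it bounds contains at least half of the points,
    and there a point [q] is determined by its abscissa [x q] and by the square
    [h q] of its height.  If [al a] is the abscissa of a point [a] of the line,
    then the numbers [(al a - x q) ^+ 2 + h q] are squared distances, so that
    they take at most n/5 + 1 values; the differences [al a - al a'] are, up to
    sign, square roots of such values.  Points with the same [h] form a row,
    points with the same [x] a column.  For m points on the line, the bound
    obtained is m^11 <= 10^60 n^9 L^20 where L is about log n ([tame]), and
    9/11 < 43/52.  The proof counts incidences, pairs (a, q) with
    [x q < al a]; by reflecting the line they are at least a quarter of all
    pairs.

    Squeezing.  Let f be increasing on a finite set S, with values in a finite
    set E of reals.  The intervals between the values at consecutive elements
    of S are disjoint, so that at most |E|/(G+1) of them contain more than G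
    elements of E, and the others lie among the |E| G pairs of elements of E at
    distance at most G.  Hence S has almost as many pairs of consecutive
    elements which are near for one or two such functions as it has elements
    ([squeeze]).  Every upper bound below counts such near pairs, and rests on
    a geometric reason for which few data determine a configuration.

    Short rows.  Suppose first that the rows with at most m^2/(10^6 L^2 n)
    points carry a tenth of the incidences; a dyadic argument makes all columns
    comparable in size.  A large column is impossible ([column_bound]): over a
    column both [al a - al c] and [(al a - x) ^+ 2 + h b] increase with [a],
    and the values of these at two neighbours determine [c] and [b].  For small
    columns, count the quadruples made of two steps (pairs of neighbours on the
    line) and of two points in different rows which see the ends of these steps
    at the same distances ([double_hits]).  There are many by the
    Cauchy-Schwarz inequality ([short_steps_collisions]).  There are few
    because, for given steps, the abscissae of the two points lie on a line of
    positive slope, where two consecutive positions determine the steps: the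
    steps give parallel chords of one branch of a hyperbola, and such chords
    are nested ([chords_nested], [double_hits_unique]).

    Long rows.  Otherwise nearly all incidences lie on long rows, and here the
    constant 5 enters: half of n, times about half of m, is more than n/5 times
    m, so that among the coincidences of squared distances a positive
    proportion is between different rows ([long_hits_lower]).  Fix one row that
    has its share of them.  For [p] in this row and [q] in another one, the
    coincidences are points of the product grid on the arc of hyperbola
    [(s - x p) ^+ 2 - (t - x q) ^+ 2 = c], where [c] depends on the row of [q]
    only.  Squeeze along each arc, and then squeeze again in the pencil of the
    arcs through two given neighbours, which is linearly ordered
    ([pencil_mono]).  The resulting pairs of arcs ([tangencies]) meet at two
    points and so determine these.  A row of arcs consists of translates of
    one arc, and two translates cross at most once; hence between two rows the
    graph of these pairs contains no square ([no_lens_square]), and a count of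
    cherries bounds its size ([sqr_sum_tangencies]). *)

Set Implicit Arguments.
Unset Strict Implicit.
Unset Printing Implicit Defensive.

Import Order.TTheory GRing.Theory Num.Theory.

Local Open Scope ring_scope.

(** * Counting in finite sets *)

Lemma leq_sum_subset (T : finType) (A B : {set T}) (w : T -> nat) :
  A \subset B -> (\sum_(t in A) w t <= \sum_(t in B) w t)%N.
Proof.
move=> AB; rewrite [X in (_ <= X)%N](bigID (mem A)) /= -[leqLHS]addn0.
apply: leq_add => //; apply/eq_leq/eq_bigl => t.
by apply/idP/andP => [tA|[]//]; rewrite (subsetP AB).
Qed.

Lemma leq_sum_setU (T : finType) (A B : {set T}) (w : T -> nat) :
  (\sum_(t in A :|: B) w t <= \sum_(t in A) w t + \sum_(t in B) w t)%N.
Proof.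
rewrite [X in (X <= _)%N](bigID (mem A)) /=; apply: leq_add.
  apply/eq_leq/eq_bigl => t; rewrite inE; case: (t \in A) => //=.
  by rewrite andbF.
apply: leq_trans (_ : (\sum_(t in B :\: A) w t <= _)%N).
  by apply/eq_leq/eq_bigl => t; rewrite !inE; case: (t \in A); rewrite ?andbF ?andbT.
by apply: leq_sum_subset; apply: subsetDl.
Qed.

Lemma card_fibers (T K : finType) (S : {set T}) (f : T -> K) (c : nat) :
  (forall k, (#|[set s in S | f s == k]| <= c)%N) -> (#|S| <= #|f @: S| * c)%N.
Proof.
move=> fibc; rewrite -sum1_card (partition_big_imset f) /= -sum_nat_const.
apply: leq_sum => k _; apply: leq_trans (fibc k).
by rewrite -sum1_card; apply/eq_leq/eq_bigl => s; rewrite inE.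
Qed.

Lemma sqr_sum_le (K : finType) (S : {set K}) (d : K -> nat) :
  ((\sum_(k in S) d k) ^ 2 <= #|S| * \sum_(k in S) d k ^ 2)%N.
Proof.
rewrite -(leq_pmul2l (isT : (0 < 2)%N)).
have -> : ((\sum_(k in S) d k) ^ 2 =
    \sum_(k in S) \sum_(l in S) d k * d l)%N.
  rewrite expnS expn1 big_distrl /=; apply: eq_bigr => k _.
  by rewrite big_distrr.
have -> : (2 * (#|S| * \sum_(k in S) d k ^ 2) =
    \sum_(k in S) \sum_(l in S) (d k ^ 2 + d l ^ 2))%N.
  under [RHS]eq_bigr => k _ do rewrite big_split /= sum_nat_const.
  by rewrite big_split /= sum_nat_const -big_distrr /= mul2n addnn.
rewrite big_distrr /=; apply: leq_sum => k _.
rewrite big_distrr /=; apply: leq_sum => l _.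
by rewrite (nat_Cauchy (d k) (d l)).
Qed.

Definition collisions (T K : finType) (S : {set T}) (f : T -> K) :
    {set T * T} :=
  [set p | [&& p.1 \in S, p.2 \in S & f p.1 == f p.2]].

(** The Cauchy-Schwarz inequality: few values force many coincidences. *)
Lemma sqr_card_le_collisions (T K : finType) (S : {set T}) (f : T -> K)
    (V : {set K}) : {in S, forall s, f s \in V} ->
  (#|S| ^ 2 <= #|V| * #|collisions S f|)%N.
Proof.
move=> fV; pose d k := #|[set s in S | f s == k]|.
have -> : #|S| = (\sum_(k in V) d k)%N.
  rewrite -sum1_card (partition_big f (mem V)) //=; apply: eq_bigr => k _.
  by rewrite /d -sum1_card; apply: eq_bigl => s; rewrite inE.
apply: leq_trans (sqr_sum_le V d) _; rewrite leq_mul2l; apply/orP; right.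
rewrite -[X in (_ <= X)%N]sum1_card.
rewrite (partition_big (fun p => f p.1) (mem V)) /=; last first.
  by move=> p; rewrite inE => /andP[/fV].
apply: leq_sum => k _; rewrite sum1dep_card.
have -> : (d k ^ 2 = #|setX [set s in S | f s == k] [set s in S | f s == k]|)%N.
  by rewrite cardsX.
apply/subset_leq_card/subsetP => -[s t]; rewrite !inE /=.
by case/andP=> /andP[-> /eqP ->] /andP[-> /eqP ->]; rewrite !eqxx.
Qed.

Lemma leq_card_in_to (T V : finType) (S : {set T}) (W : {set V}) (f : T -> V) :
  {in S &, injective f} -> {in S, forall s, f s \in W} -> (#|S| <= #|W|)%N.
Proof.
move=> fI fW; rewrite -(card_in_imset fI); apply/subset_leq_card/subsetP.
by move=> _ /imsetP[s sS ->]; apply: fW.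
Qed.

Lemma card_dep_pairs (I J : finType) (S : I -> {set J}) :
  #|[set p : I * J | p.2 \in S p.1]| = (\sum_i #|S i|)%N.
Proof.
rewrite -sum1dep_card (eq_bigl (fun p : I * J => xpredT p.1 && (p.2 \in S p.1))) //.
rewrite -(pair_big_dep xpredT (fun i j => j \in S i) (fun _ _ => 1%N)) /=.
by apply: eq_bigr => i _; rewrite sum1_card.
Qed.

(** Distinct classes of [c] are disjoint. *)
Lemma card_rows (T : finType) (K : eqType) (c : T -> K) (rho : nat)
    (V : {set {set T}}) (N : {set T}) :
  {in V, forall r, exists2 q, r = [set q' | c q' == c q] & r \subset N} ->
  (forall q, (rho <= #|[set q' | c q' == c q]|)%N) ->
  (#|V| * rho <= #|N|)%N.
Proof.
move=> VN rhoP.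
have /eqP sumV : trivIset V.
  apply/trivIsetP => r r' /VN[q rq _] /VN[q' rq' _] neq.
  rewrite -setI_eq0; apply: contraR neq => /set0Pn[t].
  by rewrite rq rq' !inE => /andP[/eqP <- /eqP <-].
apply: (@leq_trans (\sum_(r in V) #|r|)).
  by rewrite -sum_nat_const; apply: leq_sum => r /VN[q -> _].
rewrite sumV; apply: subset_leq_card; apply/bigcupsP => r /VN[q _ rN].
exact: rN.
Qed.

Lemma heavy_class (T : finType) (S : {set T}) (L : nat) (f : T -> 'I_L)
    (w : T -> nat) : (0 < \sum_(t in S) w t)%N ->
  exists2 s, s \in S &
    (\sum_(t in S) w t <= L * \sum_(t in S | f t == f s) w t)%N.
Proof.
move=> S0; have [s0 s0S] : exists s, s \in S.
  by apply/existsP; apply: contraTT S0; rewrite negb_exists => /forallP none;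
     rewrite big_pred0 // => t; apply/negbTE.
pose v s := (\sum_(t in S | f t == f s) w t)%N.
case: (@arg_maxnP _ s0 (mem S) v s0S) => s /= sS smax; exists s => //.
rewrite (partition_big f predT) //= -[L in (L * _)%N]card_ord -sum_nat_const.
apply: leq_sum => j _.
case: (pickP [pred t | (t \in S) && (f t == j)]) => [t /andP[tS /eqP <-]|none].
  exact: smax.
by rewrite big_pred0 // => t; have := none t.
Qed.

Lemma heavy_fiber (T : finType) (K : eqType) (S : {set T}) (f : T -> K)
    (w : T -> nat) (a b : nat) :
  (0 < #|S|)%N -> (a * #|S| <= b * \sum_(t in S) w t)%N ->
  exists2 s, s \in S & (a * #|[set t in S | f t == f s]| <=
    b * \sum_(t in S | f t == f s) w t)%N.
Proof.
move=> S0 ab; pose F s := [set t in S | f t == f s].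
have FE s t : s \in S -> t \in S -> (F t == F s) = (f t == f s).
  move=> sS tS; apply/eqP/eqP => [FF|ff]; last by rewrite /F ff.
  have : t \in F s by rewrite -FF inE tS eqxx.
  by rewrite inE tS => /eqP.
have [/exists_inP[s sS le]|none] :=
    boolP [exists s in S, a * #|F s| <= b * \sum_(t in S | F t == F s) w t]%N.
  exists s => //; congr (_ <= b * _)%N: le; apply: eq_bigl => t.
  by case tS : (t \in S); rewrite //= FE.
exfalso; move: ab; rewrite leqNgt => /negP; apply.
rewrite negb_exists_in in none.
rewrite -sum1_card !(partition_big_imset F) /= !big_distrr /=.
have [s sS] : exists s, s \in S by apply/set0Pn; rewrite -card_gt0.
rewrite (bigD1 (F s)) ?imset_f //= [X in (_ < X)%N](bigD1 (F s)) ?imset_f //=.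
rewrite -addSn; apply: leq_add.
  have := forall_inP none s sS; rewrite -ltnNge; congr (_ < a * _)%N.
  rewrite -sum1_card; apply: eq_bigl => t; rewrite in_set.
  by case tS : (t \in S); rewrite //= FE.
apply: leq_sum => _ /andP[/imsetP[u uS ->] _].
have := forall_inP none u uS; rewrite -ltnNge => /ltnW; congr (_ <= a * _)%N.
rewrite -sum1_card; apply: eq_bigl => t; rewrite in_set.
by case tS : (t \in S); rewrite //= FE.
Qed.

Lemma card_sig_set (T : finType) (S : {set T}) (p : pred T) :
  #|[set t : {t | t \in S} | p (val t)]| = #|[set t in S | p t]|.
Proof.
rewrite -(card_imset _ val_inj); apply: eq_card => t; apply/imsetP/setIdP.
  by case=> u + ->; rewrite inE => pu; split=> //; apply: valP.
by case=> tS pt; exists (Sub t tS); rewrite // inE.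
Qed.

(** * Consecutive elements and gaps *)

(** Locked because rewriting with the membership lemmas would otherwise unfold
    it inside the larger sets that are built from it. *)
HB.lock Definition consecutive (R : realDomainType) (I : finType)
    (S : {set I}) (k : I -> R) : {set I * I} :=
  [set st | [&& st.1 \in S, st.2 \in S, k st.1 < k st.2 &
             [forall r in S, ~~ (k st.1 < k r < k st.2)]]].

Section Squeeze.
Variables (R : realDomainType).

(** The right end is counted and the left end is not, so that the gaps of a
    sequence add up, and so that [s] and [t] are at distance at most [G] when
    [t] is among the [G] elements that follow [s]. *)
Definition gap (E : finType) (e : E -> R) (s t : R) : nat :=
  #|[set r | s < e r <= t]|.

Lemma consecutiveP (I : finType) (S : {set I}) (k : I -> R) s t :
  reflect [/\ s \in S, t \in S, k s < k t &
            forall r, r \in S -> k s < k r -> k t <= k r]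
    ((s, t) \in consecutive S k).
Proof.
rewrite consecutive.unlock inE /=; apply: (iffP and4P) => -[sS tS lt_st H]; split=> //.
  move=> r rS lt_sr; rewrite leNgt; apply/negP => lt_rt.
  by have /forall_inP/(_ r rS) := H; rewrite lt_sr lt_rt.
apply/forall_inP => r rS; apply/negP => /andP[lt_sr lt_rt].
by have := H r rS lt_sr; rewrite leNgt lt_rt.
Qed.

(** Only the greatest element of [S] fails to start a pair; [W] pays for it. *)
Lemma sum_consecutive (I : finType) (S : {set I}) (k : I -> R)
    (w : I -> nat) (W : nat) :
  {in S &, injective k} -> {in S, forall s, (w s <= W)%N} ->
  (\sum_(s in S) w s <= \sum_(st in consecutive S k) w st.1 + W)%N.
Proof.
move=> kI wW; pose T := [set st.1 | st in consecutive S k].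
rewrite (bigID (mem T)) /=; apply: leq_add.
  rewrite [X in (_ <= X)%N](partition_big_imset fst) /=.
  apply: (@leq_trans (\sum_(s in T) w s)).
    rewrite [X in (_ <= X)%N](bigID (mem S)) /= -[leqLHS]addn0.
    by apply: leq_add => //; apply/eq_leq/eq_bigl => s; rewrite andbC.
  apply: leq_sum => s /imsetP[[s' t] st ->] /=.
  by rewrite (bigD1 (s', t)) /= ?st ?eqxx // leq_addr.
have noT s t : s \in S -> s \notin T -> t \in S -> k s < k t -> False.
  move=> sS sT tS lt_st; move/negP: sT; apply.
  have Pt : (t \in S) && (k s < k t) by rewrite tS.
  case: (@arg_minP _ _ _ t (fun r => (r \in S) && (k s < k r)) k Pt).
  move=> r /andP[rS lt_sr] rmin.
  apply/imsetP; exists (s, r) => //; apply/consecutiveP; split=> // u uS lt_su.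
  by apply: rmin; rewrite uS.
case: (pickP [pred s in S | s \notin T]) => [s /andP[/= sS sT] | none]; last first.
  by rewrite big_pred0 //= => s; have := none s.
rewrite (big_pred1 s) => [|t]; first exact: wW.
apply/idP/eqP => [/andP[tS tT] | ->]; last by rewrite sS.
case: (ltgtP (k s) (k t)) => [lt|lt|/kI->//].
- by case: (noT s t).
- by case: (noT t s).
Qed.

Section Gap.
Variables (I E : finType) (S : {set I}) (k f : I -> R) (e : E -> R).
Hypothesis kI : {in S &, injective k}.
Hypothesis f_incr : {in S &, forall s t, k s < k t -> f s < f t}.

(** The half-open intervals counted by the gaps are disjoint. *)
Lemma sum_gap_consecutive :
  (\sum_(st in consecutive S k) gap e (f st.1) (f st.2) <= #|E|)%N.
Proof.
under eq_bigr do rewrite /gap -sum1dep_card.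
rewrite (exchange_big_dep predT) //= -sum1_card; apply: leq_sum => r _.
have aux a b c d : (a, b) \in consecutive S k -> (c, d) \in consecutive S k ->
    f c < e r -> e r <= f b -> k c <= k a.
  case/consecutiveP=> aS bS _ ab /consecutiveP[cS dS _ _] cr rb.
  rewrite leNgt; apply/negP => lt_ac; have := ab c cS lt_ac.
  have {cr rb} := lt_le_trans cr rb.
  rewrite le_eqVlt => fcb /orP[/eqP/(kI bS cS) bc|/(f_incr bS cS) fbc].
    by rewrite bc ltxx in fcb.
  by have := lt_trans fcb fbc; rewrite ltxx.
rewrite sum1dep_card; apply/card_le1_eqP => -[s t] [s' t'].
rewrite -!topredE /= => /setIdP[st /andP[/= sr rt]] /setIdP[st' /andP[/= sr' rt']].
have [sS tS lt_st stP] := consecutiveP _ _ _ _ st.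
have [s'S t'S lt_st' stP'] := consecutiveP _ _ _ _ st'.
have ss' : s = s'.
  by apply: kI => //; apply/le_anti; rewrite (aux _ _ _ _ st' st) ?(aux _ _ _ _ st st').
move: lt_st' stP'; rewrite -ss' => lt_st' stP'.
by congr pair; apply: kI => //; apply/le_anti; rewrite stP ?stP'.
Qed.

Lemma card_wide_consecutive (G : nat) :
  (#|[set st in consecutive S k | ~~ (gap e (f st.1) (f st.2) <= G)]|
     <= #|E| %/ G.+1)%N.
Proof.
rewrite leq_divRL //; apply: leq_trans sum_gap_consecutive.
set W := [set _ in _ | _]; rewrite -sum_nat_const.
apply: (@leq_trans (\sum_(st in W) gap e (f st.1) (f st.2))).
  by apply: leq_sum => st /setIdP[_]; rewrite -ltnNge.
by apply: leq_sum_subset; apply/subsetP => st /setIdP[].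
Qed.
End Gap.

(** A weight summed over [S] is almost a weight summed over the pairs of
    consecutive elements which are near for both [f1] and [f2]: each function
    has few wide gaps, and one more element is the greatest one. *)
Lemma squeeze (I E1 E2 : finType) (S : {set I}) (k f1 f2 : I -> R)
    (e1 : E1 -> R) (e2 : E2 -> R) (w : I -> nat) (W G1 G2 : nat) :
  {in S &, injective k} ->
  {in S &, forall s t, k s < k t -> f1 s < f1 t} ->
  {in S &, forall s t, k s < k t -> f2 s < f2 t} ->
  {in S, forall s, (w s <= W)%N} ->
  (\sum_(s in S) w s <=
   \sum_(st in [set st in consecutive S k |
        (gap e1 (f1 st.1) (f1 st.2) <= G1) &&
        (gap e2 (f2 st.1) (f2 st.2) <= G2)]) w st.1
   + W * (1 + #|E1| %/ G1.+1 + #|E2| %/ G2.+1))%N.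
Proof.
move=> kI f1i f2i wW; apply: leq_trans (sum_consecutive kI wW) _.
rewrite !mulnDr muln1 -(addnA W) [X in (X <= _)%N]addnC addnCA leq_add2l.
have b1 := @card_wide_consecutive _ _ _ _ _ e1 kI f1i G1.
have b2 := @card_wide_consecutive _ _ _ _ _ e2 kI f2i G2.
set B1 := [set _ in _ | _] in b1; set B2 := [set _ in _ | _] in b2.
set good := [set st in _ | _].
have CS : consecutive S k \subset good :|: (B1 :|: B2).
  apply/subsetP => st stC; apply/setUP.
  case g1: (gap e1 (f1 st.1) (f1 st.2) <= G1)%N; last first.
    by right; apply/setUP; left; apply/setIdP; rewrite g1.
  case g2: (gap e2 (f2 st.1) (f2 st.2) <= G2)%N.
    by left; apply/setIdP; rewrite g1 g2.
  by right; apply/setUP; right; apply/setIdP; rewrite g2.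
have wst st : st \in consecutive S k -> (w st.1 <= W)%N.
  by case: st => s t /consecutiveP[sS _ _ _] /=; apply: wW.
apply: (@leq_trans (\sum_(st in good :|: (B1 :|: B2)) w st.1)).
  exact: leq_sum_subset.
apply: leq_trans (leq_sum_setU _ _ _) _; rewrite leq_add2l.
apply: leq_trans (leq_sum_setU _ _ _) _; apply: leq_add.
- apply: leq_trans (_ : (\sum_(st in B1) W <= _)%N).
    by apply: leq_sum => st /setIdP[/wst].
  by rewrite sum_nat_const mulnC leq_mul2l b1 orbT.
- apply: leq_trans (_ : (\sum_(st in B2) W <= _)%N).
    by apply: leq_sum => st /setIdP[/wst].
  by rewrite sum_nat_const mulnC leq_mul2l b2 orbT.
Qed.

(** The greatest such [t] has all the others in its gap. *)
Lemma card_near_right (E : finType) (e : E -> R) (r : R) (G : nat) :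
  (#|[set t | (r < e t)%R && (gap e r (e t) <= G)]| <= G)%N.
Proof.
case: (pickP [pred t | (r < e t) && (gap e r (e t) <= G)%N]) => [t0 Pt0|none].
  case: (@arg_maxP _ _ _ t0 (fun t => (r < e t) && (gap e r (e t) <= G)%N) e Pt0).
  move=> t /andP[rt tG] tmax; apply: leq_trans tG.
  apply/subset_leq_card/subsetP => u; rewrite !inE => /andP[-> uG] /=.
  apply: contraT; rewrite -ltNge => tu.
  have /tmax : (r < e u) && (gap e r (e u) <= G)%N by rewrite (lt_trans rt).
  by move=> /(lt_le_trans tu); rewrite ltxx.
by rewrite eq_card0 // => t; rewrite inE; apply: none.
Qed.

Lemma card_near_left (E : finType) (e : E -> R) (t : E) (G : nat) :
  injective e ->
  (#|[set s | (e s < e t)%R && (gap e (e s) (e t) <= G)]| <= G)%N.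
Proof.
move=> eI; pose P := [pred s | (e s < e t) && (gap e (e s) (e t) <= G)%N].
case: (pickP P) => [s0 Ps0|none]; last first.
  by rewrite eq_card0 // => s; rewrite inE; apply: none.
case: (@arg_minP _ _ _ s0 P e Ps0) => s /andP[st sG] smin.
apply: leq_trans (sG).
have sN : s \in [set s | P s] by rewrite inE /= st.
rewrite (cardsD1 s) sN.
have tN : t \notin [set s | P s] :\ s by rewrite !inE ltxx /= andbF.
have := cardsU1 t ([set s | P s] :\ s); rewrite tN => <-.
apply/subset_leq_card/subsetP => u.
rewrite !inE => /predU1P[->|]; first by rewrite st lexx.
case/andP=> us /andP[ut uG]; rewrite (ltW ut) andbT lt_neqAle eq_sym.
by rewrite (inj_eq eI) us smin // inE /= ut.
Qed.

Definition near_pairs (E : finType) (e : E -> R) (G : nat) : {set E * E} :=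
  [set p | (e p.1 < e p.2) && (gap e (e p.1) (e p.2) <= G)%N].

Lemma card_near_pairs (E : finType) (e : E -> R) (G : nat) :
  (#|near_pairs e G| <= #|E| * G)%N.
Proof.
apply: leq_trans (card_fibers (f := fst) (c := G) _) _.
  move=> s; apply: leq_trans (card_near_right e (e s) G).
  apply: (@leq_card_in_to _ _ _ _ snd).
    move=> [a b] [a' b']; rewrite !inE /= => /andP[_ /eqP->] /andP[_ /eqP->].
    by move=> ->.
  by move=> [a b]; rewrite !inE /= => /andP[ab /eqP <-].
by rewrite leq_mul2r max_card orbT.
Qed.
End Squeeze.
Arguments gap {R E} e (s t)%_ring_scope.

(** * Chords of a hyperbola *)

Section Hyperbola.
Variable R : realFieldType.
Implicit Types u v g c C d k : R.

(** In terms of the midpoint of a chord of slope [k], the two equations of the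
    ends become the equation of the line of midpoints and one equation between
    the position of the midpoint and the length of the chord. *)
Lemma chord_level u v g k c : 0 < g ->
  u ^+ 2 - v ^+ 2 = c -> (u + g) ^+ 2 - (v + k * g) ^+ 2 = c ->
  2 * u + g = k * (2 * v + k * g) /\
  (k ^+ 2 - 1) * ((2 * v + k * g) ^+ 2 - g ^+ 2) = 4 * c.
Proof.
move=> g0 e1 e2.
have l : 2 * u + g = k * (2 * v + k * g).
  by apply: (mulfI (lt0r_neq0 g0)); nra.
split=> //; rewrite -e1.
have -> : u = (k * (2 * v + k * g) - g) / 2 by rewrite -l; field.
by field.
Qed.

(** By [chord_level], the position [m] of the midpoint and the length [g]
    satisfy an equation [m ^+ 2 - g ^+ 2 = constant], so that a longer chord
    has its midpoint further away, but by less than the growth in length. *)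
Lemma chords_nested k u v g U V G c : 0 < k -> c != 0 ->
  0 < u -> 0 < v -> 0 < g -> 0 < U -> 0 < V -> 0 < G ->
  u ^+ 2 - v ^+ 2 = c -> (u + g) ^+ 2 - (v + k * g) ^+ 2 = c ->
  U ^+ 2 - V ^+ 2 = c -> (U + G) ^+ 2 - (V + k * G) ^+ 2 = c ->
  g < G -> U < u /\ u + g < U + G.
Proof.
move=> k0 c0 u0 v0 g0 U0 V0 G0 e1 e2 e3 e4 gG.
pose m := 2 * v + k * g; pose M := 2 * V + k * G.
have [l1 f1] := chord_level g0 e1 e2; rewrite -/m in f1.
have [l2 f2] := chord_level G0 e3 e4; rewrite -/M in f2.
have k1 : k ^+ 2 - 1 != 0.
  apply: contra_neq c0 => k1; move: f1; rewrite k1 mul0r; lra.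
have f3 : m ^+ 2 - g ^+ 2 = M ^+ 2 - G ^+ 2 by apply: (mulfI k1); rewrite f1 f2.
have mg : k * g < m by rewrite /m; lra.
have MG : k * G < M by rewrite /M; lra.
have m0 : 0 < m by rewrite /m; nra.
have M0 : 0 < M by rewrite /M; nra.
have mM : m < M by nra.
have key : k * (M - m) < G - g.
  have gG0 : 0 < g + G by lra.
  rewrite -(ltr_pM2r gG0).
  have -> : (G - g) * (g + G) = (M - m) * (m + M) by nra.
  rewrite -mulrA [k * _]mulrC -mulrA ltr_pM2l; nra.
have h1 : 2 * u = k * m - g by rewrite /m -l1; ring.
have h2 : 2 * U = k * M - G by rewrite /M -l2; ring.
have kmM : k * m < k * M by rewrite ltr_pM2l.
split; lra.
Qed.

Lemma chord_unique k u v U V g c : 0 < k -> c != 0 ->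
  0 < u -> 0 < v -> 0 < g -> 0 < U -> 0 < V ->
  u ^+ 2 - v ^+ 2 = c -> (u + g) ^+ 2 - (v + k * g) ^+ 2 = c ->
  U ^+ 2 - V ^+ 2 = c -> (U + g) ^+ 2 - (V + k * g) ^+ 2 = c ->
  U = u.
Proof.
move=> k0 c0 u0 v0 g0 U0 V0 e1 e2 e3 e4.
pose m := 2 * v + k * g; pose M := 2 * V + k * g.
have [l1 f1] := chord_level g0 e1 e2; rewrite -/m in f1.
have [l2 f2] := chord_level g0 e3 e4; rewrite -/M in f2.
have k1 : k ^+ 2 - 1 != 0.
  apply: contra_neq c0 => k1; move: f1; rewrite k1 mul0r; lra.
have f3 : m ^+ 2 - g ^+ 2 = M ^+ 2 - g ^+ 2 by apply: (mulfI k1); rewrite f1 f2.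
have m0 : 0 < m by rewrite /m; nra.
have M0 : 0 < M by rewrite /M; nra.
have mM : m = M by case: (ltgtP m M) => // ?; nra.
have : 2 * u + g = 2 * U + g by rewrite l1 l2 -/m -/M mM.
by lra.
Qed.

(** Arcs with centres at [- (u, v)] which share a chord: the slope of the chord
    determines the line of midpoints, on which the centres lie up to a
    translation, and by [chord_level] the distance to the centre determines
    the constant. *)
Lemma pencil_mono u v U V g g' c d :
  0 < g -> 0 < g' -> 0 < u -> 0 < v -> 0 < U -> 0 < V -> c != 0 ->
  u ^+ 2 - v ^+ 2 = c -> (u + g) ^+ 2 - (v + g') ^+ 2 = c ->
  U ^+ 2 - V ^+ 2 = d -> (U + g) ^+ 2 - (V + g') ^+ 2 = d ->
  U < u -> [/\ V < v, `|d| < `|c| & 0 < c * d].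
Proof.
move=> g0 g0' u0 v0 U0 V0 c0 e1 e2 e3 e4 Uu.
(* [k] is the slope of the common chord *)
pose k := g' / g.
have k0 : 0 < k by exact: divr_gt0.
have gk : g' = k * g by rewrite /k divfK // gt_eqF.
rewrite gk in e2 e4.
have [l1 f1] := chord_level g0 e1 e2.
have [l2 f2] := chord_level g0 e3 e4.
set m := 2 * v + k * g in l1 f1; set M := 2 * V + k * g in l2 f2.
have kMm : k * M < k * m by rewrite -l1 -l2; lra.
have Mm : M < m by rewrite ltr_pM2l in kMm.
have kg0 : 0 < k * g by exact: mulr_gt0.
have M0 : 0 < M by rewrite /M; lra.
have Mg : g < M.
  have h1 : g < k * M by rewrite -l2; lra.
  have h2 : k * g < M by rewrite /M; lra.
  have [k1|k1] := lerP 1 k.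
    have : 1 * g <= k * g by rewrite ler_pM2r.
    by lra.
  have : k * M < 1 * M by rewrite ltr_pM2r.
  by lra.
have a1 : 0 < M ^+ 2 - g ^+ 2.
  by rewrite subr_gt0 !expr2; apply: ltr_pM => //; lra.
have a2 : M ^+ 2 - g ^+ 2 < m ^+ 2 - g ^+ 2.
  by rewrite ltrD2r !expr2; apply: ltr_pM => //; lra.
set s := k ^+ 2 - 1 in f1 f2; set a := M ^+ 2 - g ^+ 2 in a1 a2 f2.
set b := m ^+ 2 - g ^+ 2 in a2 f1.
have s0 : s != 0 by apply: contra_neq c0 => s0; move: f1; rewrite s0 mul0r; lra.
have ss : 0 < s ^+ 2 by rewrite exprn_even_gt0.
split.
- by move: Mm; rewrite /M /m; lra.
- have : `|4 * d| < `|4 * c|.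
    have b0 : 0 < b by lra.
    by rewrite -f1 -f2 !normrM ltr_pM2l ?normr_gt0 // !gtr0_norm.
  by rewrite !normrM ltr_pM2l ?normr_gt0 ?pnatr_eq0.
- have : 0 < (4 * c) * (4 * d).
    rewrite -f1 -f2; have -> : s * b * (s * a) = s ^+ 2 * (b * a) by ring.
    by apply: mulr_gt0 => //; apply: mulr_gt0; lra.
  lra.
Qed.

(** Along the line the equation of the hyperbola is quadratic in [u]; it can
    degenerate only on an asymptote, where [c] would vanish. *)
Lemma arc_line_le2 u0 v0 u1 v1 u2 v2 c d1 d2 k : c != 0 -> 0 < d1 -> 0 < d2 ->
  u0 ^+ 2 - v0 ^+ 2 = c -> u1 ^+ 2 - v1 ^+ 2 = c -> u2 ^+ 2 - v2 ^+ 2 = c ->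
  d1 * u0 - d2 * v0 = k -> d1 * u1 - d2 * v1 = k -> d1 * u2 - d2 * v2 = k ->
  u0 != u1 -> u0 != u2 -> u1 = u2.
Proof.
move=> c0 d10 d20 a0 a1 a2 b0 b1 b2 n1 n2.
have q u v : u ^+ 2 - v ^+ 2 = c -> d1 * u - d2 * v = k ->
    (d2 ^+ 2 - d1 ^+ 2) * u ^+ 2 + 2 * d1 * k * u - k ^+ 2 - c * d2 ^+ 2 = 0.
  by move=> <- <-; ring.
have {a0 b0} q0 := q _ _ a0 b0; have {a1 b1} q1 := q _ _ a1 b1.
have {a2 b2} q2 := q _ _ a2 b2.
set D := d2 ^+ 2 - d1 ^+ 2 in q0 q1 q2; clearbody D.
have f1 : D * (u0 + u1) + 2 * d1 * k = 0.
  have : (u0 - u1) * (D * (u0 + u1) + 2 * d1 * k) = 0 by nra.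
  by move/eqP; rewrite mulf_eq0 subr_eq0 (negPf n1) /= => /eqP.
have f2 : D * (u0 + u2) + 2 * d1 * k = 0.
  have : (u0 - u2) * (D * (u0 + u2) + 2 * d1 * k) = 0 by nra.
  by move/eqP; rewrite mulf_eq0 subr_eq0 (negPf n2) /= => /eqP.
have : D * (u1 - u2) = 0 by lra.
move/eqP; rewrite mulf_eq0 subr_eq0 => /orP[/eqP D0|/eqP //].
move: f1; rewrite D0 mul0r add0r => k0.
have {}k0 : k = 0.
  by move/eqP: k0; rewrite !mulf_eq0 (gt_eqF d10) pnatr_eq0 /= => /eqP.
move: q0; rewrite D0 k0 mulr0 !mul0r expr0n /= addr0 subr0 sub0r => /eqP.
by rewrite oppr_eq0 mulf_eq0 (negPf c0) expf_eq0 /= gt_eqF.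
Qed.

(** The slope [v / u] of the ray increases along an arc towards the asymptote. *)
Lemma arc_ratio c u v U V : 0 < c -> 0 < u -> 0 < v -> 0 < U -> 0 < V ->
  u ^+ 2 - v ^+ 2 = c -> U ^+ 2 - V ^+ 2 = c -> u <= U -> U * v <= u * V.
Proof.
move=> c0 u0 v0 U0 V0 e1 e2 uU.
have h1 : 0 < U * v by exact: mulr_gt0.
have h2 : 0 < u * V by exact: mulr_gt0.
have h3 : (u * V) ^+ 2 - (U * v) ^+ 2 = c * (U ^+ 2 - u ^+ 2).
  rewrite !exprMn; have -> : v ^+ 2 = u ^+ 2 - c by lra.
  have -> : V ^+ 2 = U ^+ 2 - c by lra.
  ring.
have h4 : u ^+ 2 <= U ^+ 2 by nra.
have h5 : 0 <= c * (U ^+ 2 - u ^+ 2) by apply: mulr_ge0; lra.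
rewrite leNgt; apply/negP => h; nra.
Qed.

(** The arc is the graph of a concave function: outside of a chord it lies on
    the side of its line that is opposite to the arc cut off by the chord. *)
Lemma arc_chord c u0 v0 u1 v1 u v d1 d2 : 0 < c ->
  0 < u0 -> 0 < v0 -> 0 < u1 -> 0 < v1 -> 0 < u -> 0 < v ->
  u0 ^+ 2 - v0 ^+ 2 = c -> u1 ^+ 2 - v1 ^+ 2 = c -> u ^+ 2 - v ^+ 2 = c ->
  0 < d1 -> 0 < d2 -> u0 < u1 ->
  d1 * u0 - d2 * v0 = d1 * u1 - d2 * v1 ->
  (u <= u0) || (u1 <= u) -> d1 * u0 - d2 * v0 <= d1 * u - d2 * v.
Proof.
move=> c0 u00 v00 u10 v10 ug vg e0 e1 e d10 d20 u01 ed.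
have s1 : (v1 - v0) * (v1 + v0) = (u1 - u0) * (u1 + u0) by nra.
have v01 : v0 < v1 by nra.
have d12 : d1 * (u1 - u0) = d2 * (v1 - v0) by lra.
have slope : d1 * (v1 + v0) = d2 * (u1 + u0).
  have h : (u1 - u0) != 0 by lra.
  apply: (mulIf h); rewrite mulrAC d12; nra.
have s2 : (v0 - v) * (v0 + v) = (u0 - u) * (u0 + u) by nra.
case/orP => [uu0 | u1u].
- suff : d1 * (u0 - u) <= d2 * (v0 - v) by lra.
  have r1 := arc_ratio c0 u00 v00 u10 v10 e0 e1 (ltW u01).
  have r2 := arc_ratio c0 ug vg u00 v00 e e0 uu0.
  have r3 := arc_ratio c0 ug vg u10 v10 e e1 (le_trans uu0 (ltW u01)).
  have p1 : 0 < (v1 + v0) by lra.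
  have p2 : 0 < (v0 + v) by lra.
  rewrite -(ler_pM2r p1) -(ler_pM2r p2).
  have -> : d1 * (u0 - u) * (v1 + v0) * (v0 + v) =
    d2 * (u0 - u) * ((u1 + u0) * (v0 + v)).
    transitivity (d1 * (v1 + v0) * ((u0 - u) * (v0 + v))); first by ring.
    by rewrite slope; ring.
  have -> : d2 * (v0 - v) * (v1 + v0) * (v0 + v) =
    d2 * (u0 - u) * ((u0 + u) * (v1 + v0)).
    transitivity (d2 * (v1 + v0) * ((v0 - v) * (v0 + v))); first by ring.
    by rewrite s2; ring.
  apply: ler_wpM2l; first by apply: mulr_ge0; lra.
  lra.
- suff : d2 * (v - v1) <= d1 * (u - u1) by lra.
  have s4 : (v1 - v) * (v1 + v) = (u1 - u) * (u1 + u) by nra.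
  have r1 := arc_ratio c0 u00 v00 u10 v10 e0 e1 (ltW u01).
  have r2 := arc_ratio c0 u10 v10 ug vg e1 e u1u.
  have r3 := arc_ratio c0 u00 v00 ug vg e0 e (le_trans (ltW u01) u1u).
  have p1 : 0 < (v1 + v0) by lra.
  have p2 : 0 < (v1 + v) by lra.
  rewrite -(ler_pM2r p1) -(ler_pM2r p2).
  have -> : d1 * (u - u1) * (v1 + v0) * (v1 + v) =
    d2 * (u - u1) * ((u1 + u0) * (v1 + v)).
    transitivity (d1 * (v1 + v0) * ((u - u1) * (v1 + v))); first by ring.
    by rewrite slope; ring.
  have -> : d2 * (v - v1) * (v1 + v0) * (v1 + v) =
    d2 * (u - u1) * ((u1 + u) * (v1 + v0)).
    transitivity (- (d2 * (v1 + v0) * ((v1 - v) * (v1 + v)))); first by ring.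
    by rewrite s4; ring.
  apply: ler_wpM2l; first by apply: mulr_ge0; lra.
  lra.
Qed.

(** The function [sqrt (u ^+ 2 - C)] is concave, and the abscissae [i1], [i2]
    lie between [o1] and [o2] and have the same sum; so the arc has a strictly
    larger sum of ordinates at the inner abscissae.  But the inner points are
    on or above the arc, the outer ones on or below it, with equal sums.  The
    argument is carried out on squares, without roots: [s] and [t] are the
    products of the ordinates. *)
Lemma majorize C i1 j1 i2 j2 o1 p1 o2 p2 : 0 < C ->
  0 < i1 -> 0 < j1 -> 0 < i2 -> 0 < j2 ->
  0 < o1 -> 0 < p1 -> 0 < o2 -> 0 < p2 ->
  i1 ^+ 2 - j1 ^+ 2 <= C -> i2 ^+ 2 - j2 ^+ 2 <= C ->
  C <= o1 ^+ 2 - p1 ^+ 2 -> C <= o2 ^+ 2 - p2 ^+ 2 ->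
  i1 + i2 = o1 + o2 -> j1 + j2 = p1 + p2 -> o1 < i1 -> o1 < i2 -> False.
Proof.
move=> C0 hi1 hj1 hi2 hj2 ho1 hp1 ho2 hp2 I1 I2 O1 O2 ei ej lt1 lt2.
(* [E] measures how far the inner pair is inside the outer one *)
pose E := i1 * i2 - o1 * o2.
have o2E : o2 = i1 + i2 - o1 by lra.
have E0 : 0 < E.
  have -> : E = (i1 - o1) * (i2 - o1) by rewrite /E o2E; ring.
  by apply: mulr_gt0; lra.
pose t := p1 * p2; pose s := j1 * j2.
have t0 : 0 < t by exact: mulr_gt0.
have s0 : 0 < s by exact: mulr_gt0.
have st : s <= t + E.
  have : (j1 + j2) ^+ 2 = (p1 + p2) ^+ 2 by rewrite ej.
  have : (i1 + i2) ^+ 2 = (o1 + o2) ^+ 2 by rewrite ei.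
  by rewrite /s /t /E; nra.
pose b := o1 * o2 - C.
have o1C : C < o1 ^+ 2 by nra.
have o2C : C < o2 ^+ 2 by nra.
have b0 : 0 < b by rewrite /b; nra.
have sE : (b + E) ^+ 2 - s ^+ 2 <= C * (i1 - i2) ^+ 2.
  have : (i1 ^+ 2 - C) * (i2 ^+ 2 - C) <= s ^+ 2.
    rewrite /s exprMn; apply: ler_pM; nra.
  by rewrite /b /E; nra.
have tE : C * (o2 - o1) ^+ 2 <= b ^+ 2 - t ^+ 2.
  have : t ^+ 2 <= (o1 ^+ 2 - C) * (o2 ^+ 2 - C).
    rewrite /t exprMn; apply: ler_pM; nra.
  by rewrite /b; nra.
have lt12 : (i1 - i2) ^+ 2 < (o2 - o1) ^+ 2.
  have -> : (o2 - o1) ^+ 2 = (i1 - i2) ^+ 2 + 4 * E by rewrite /E o2E; ring.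
  lra.
have fin : C * (i1 - i2) ^+ 2 < C * (o2 - o1) ^+ 2 by rewrite ltr_pM2l.
have C12 : 0 <= C * (i1 - i2) ^+ 2 by apply: mulr_ge0; [lra | exact: sqr_ge0].
have tb : t < b.
  rewrite ltNge; apply/negP => bt.
  have : b * b <= t * t by apply: ler_pM; lra.
  by move: tE; rewrite !expr2; lra.
have ss : s * s <= (t + E) * (t + E) by apply: ler_pM; lra.
have bE : t * E < b * E by rewrite ltr_pM2r.
by move: sE tE; rewrite !expr2; lra.
Qed.
End Hyperbola.

(** * Two translates of a hyperbola *)

Section Translates.
Variable R : realFieldType.
Implicit Types x y s t C : R.

(** Take a point on each of two translates of an arc, on or below the other
    one.  The translate whose point comes first is the one translated further:
    otherwise the positions relative to the two centres contradict
    [majorize]. *)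
Lemma translates_below C x1 y1 x2 y2 s t s' t' : 0 < C ->
  x1 < s -> y1 < t -> x2 < s -> y2 < t ->
  x1 < s' -> y1 < t' -> x2 < s' -> y2 < t' ->
  (s - x1) ^+ 2 - (t - y1) ^+ 2 = C -> C <= (s - x2) ^+ 2 - (t - y2) ^+ 2 ->
  (s' - x2) ^+ 2 - (t' - y2) ^+ 2 = C ->
  C <= (s' - x1) ^+ 2 - (t' - y1) ^+ 2 ->
  s < s' -> (x1, y1) != (x2, y2) -> x2 < x1.
Proof.
move=> C0 h1 h2 h3 h4 h5 h6 h7 h8 e1 b1 e2 b2 ss ne.
rewrite ltNge; apply/negP; rewrite le_eqVlt => /orP[/eqP ex|lx].
  case/eqP: ne; congr pair => //; subst x2; apply/le_anti/andP; split; nra.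
apply: (@majorize R C (s - x1) (t - y1) (s' - x2) (t' - y2)
                      (s - x2) (t - y2) (s' - x1) (t' - y1)); lra.
Qed.

(** The counterpart of [translates_below] for points on or above the other
    translate: the inner and the outer pair exchange their roles. *)
Lemma translates_above C x1 y1 x2 y2 s t s' t' : 0 < C ->
  x1 < s -> y1 < t -> y2 < t -> x2 < s' -> y2 < t' -> y1 < t' ->
  (s - x1) ^+ 2 - (t - y1) ^+ 2 = C -> (s - x2) ^+ 2 - (t - y2) ^+ 2 <= C ->
  (s' - x2) ^+ 2 - (t' - y2) ^+ 2 = C ->
  (s' - x1) ^+ 2 - (t' - y1) ^+ 2 <= C ->
  s < s' -> (x1, y1) != (x2, y2) -> x1 < x2.
Proof.
move=> C0 h1 h2 h3 h4 h5 h6 e1 b1 e2 b2 ss ne.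
rewrite ltNge; apply/negP; rewrite le_eqVlt => /orP[/eqP ex|lx].
  case/eqP: ne; congr pair => //; subst x2; apply/le_anti/andP; split; nra.
apply: (@majorize R C (s - x2) (t - y2) (s' - x1) (t' - y1)
                      (s - x1) (t - y1) (s' - x2) (t' - y2)); lra.
Qed.

Lemma arc_incr C x y s t s' t' : x < s -> y < t -> x < s' -> y < t' ->
  (s - x) ^+ 2 - (t - y) ^+ 2 = C -> (s' - x) ^+ 2 - (t' - y) ^+ 2 = C ->
  s <= s' -> t <= t'.
Proof. by move=> *; nra. Qed.

(** The lenses in one of the possible orders along the arcs with centres
    [(x i, y i)]: the two on the first of these arcs precede the two on the
    second.  Comparing the arcs with centres [(X j, Y j)] at two pairs of lenses
    by [translates_above] gives [X true < X false] and the converse; when a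
    centre is too high for this comparison, the arcs being increasing gives the
    contradiction directly. *)
Lemma no_lens_square_core (C c : R) (x y X Y : bool -> R)
    (s t : bool -> bool -> bool -> R) : 0 < C -> 0 < c ->
  (forall i j, x i < X j) -> (forall i j, y i < Y j) ->
  (forall i j e, X j < s i j e) -> (forall i j e, Y j < t i j e) ->
  (forall i j, s i j false < s i j true) ->
  (forall i j e, (s i j e - x i) ^+ 2 - (t i j e - y i) ^+ 2 = C) ->
  (forall i j e, (s i j e - X j) ^+ 2 - (t i j e - Y j) ^+ 2 = c) ->
  (forall i j i' e, C <= (s i j e - x i') ^+ 2 - (t i j e - y i') ^+ 2) ->
  (forall i j j' e, (s i j e - X j') ^+ 2 - (t i j e - Y j') ^+ 2 <= c) ->
  (X false, Y false) != (X true, Y true) ->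
  (forall j j' e e', s false j e <= s true j' e') ->
  s false false false <= s false true false -> False.
Proof.
move=> C0 c0 xX yY Xs Yt lt_e onh onH F1 F2 neX before le1.
have s12 := lt_e false true.
have s21 := before true false true false.
have xs i j e i' : x i' < s i j e by apply: lt_trans (xX _ j) (Xs _ _ _).
have yt i j e i' : y i' < t i j e by apply: lt_trans (yY _ j) (Yt _ _ _).
have t12 : t false false false <= t false true false.
  exact: (arc_incr (xs _ _ _ _) (yt _ _ _ _) (xs _ _ _ _) (yt _ _ _ _)
    (onh _ _ _) (onh _ _ _) le1).
have t12s : t false true false <= t false true true.
  exact: (arc_incr (xs _ _ _ _) (yt _ _ _ _) (xs _ _ _ _) (yt _ _ _ _)
    (onh _ _ _) (onh _ _ _) (ltW s12)).
have Y1 := Yt false false false.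
have [hY|hY] := lerP (t true false false) (Y true).
  have := F1 false true true false; rewrite -(onh true false false).
  have a1 := xs false true false true; have a2 := yt true false false true.
  have a3 := Yt false true false.
  have : (s false true false - x true) ^+ 2 < (s true false false - x true) ^+ 2.
    rewrite !expr2; apply: ltr_pM; lra.
  have : (t true false false - y true) ^+ 2 <= (t false true false - y true) ^+ 2.
    rewrite !expr2; apply: ler_pM; lra.
  lra.
have XX : X true < X false.
  apply: (translates_above c0 (Xs false true false) (Yt false true false) _
    (Xs true false false) (Yt true false false) hY (onH _ _ _) (F2 _ _ _ _)
    (onH _ _ _) (F2 _ _ _ _)); [lra | lra | by rewrite eq_sym].
have [hY1|hY1] := lerP (t false false false) (Y true); last first.
  have : X false < X true; last by lra.
  apply: (translates_above c0 (Xs false false false) (Yt false false false) hY1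
    (Xs false true true) (Yt false true true) _ (onH _ _ _) (F2 _ _ _ _)
    (onH _ _ _) (F2 _ _ _ _)) => //; lra.
have := F2 true false true false; rewrite -(onH true false false).
have a1 := Xs true false false.
have : (s true false false - X false) ^+ 2 < (s true false false - X true) ^+ 2.
  rewrite !expr2; apply: ltr_pM; lra.
have : (t true false false - Y true) ^+ 2 <= (t true false false - Y false) ^+ 2.
  rewrite !expr2; apply: ler_pM; lra.
lra.
Qed.

(** Two families of two arcs, indexed by booleans; the arcs [i] and [j] of
    either family meet at the ends [(s i j e, t i j e)] of a lens.  By [outh]
    and [outH] the lenses do not overlap along any arc, so that by [arc_chord]
    the ends of all lenses lie on one side of every arc.  Hence
    [translates_below] orders the lenses along the first family, and
    [no_lens_square_core] applies after renaming the arcs. *)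
Lemma no_lens_square (C c : R) (x y X Y : bool -> R)
    (s t : bool -> bool -> bool -> R) : 0 < C -> 0 < c ->
  (forall i j, x i < X j) -> (forall i j, y i < Y j) ->
  (forall i j e, X j < s i j e) -> (forall i j e, Y j < t i j e) ->
  (forall i j, s i j false < s i j true) ->
  (forall i j e, (s i j e - x i) ^+ 2 - (t i j e - y i) ^+ 2 = C) ->
  (forall i j e, (s i j e - X j) ^+ 2 - (t i j e - Y j) ^+ 2 = c) ->
  (forall i j j' e, (s i j e <= s i j' false) || (s i j' true <= s i j e)) ->
  (forall i j i' e, (s i j e <= s i' j false) || (s i' j true <= s i j e)) ->
  (x false, y false) != (x true, y true) ->
  (X false, Y false) != (X true, Y true) -> False.
Proof.
move=> C0 c0 xX yY Xs Yt lt_e onh onH outh outH nex neX.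
have xs i j e i' : x i' < s i j e by apply: lt_trans (xX _ j) (Xs _ _ _).
have yt i j e i' : y i' < t i j e by apply: lt_trans (yY _ j) (Yt _ _ _).
have F1 i j i' e : C <= (s i j e - x i') ^+ 2 - (t i j e - y i') ^+ 2.
  have := @arc_chord R c (s i' j false - X j) (t i' j false - Y j)
    (s i' j true - X j) (t i' j true - Y j) (s i j e - X j) (t i j e - Y j)
    (X j - x i') (Y j - y i') c0.
  rewrite !subr_gt0 !Xs !Yt !xX !yY !onH !lerD2r outH ltrD2r lt_e.
  move=> /(_ erefl erefl erefl erefl erefl erefl erefl erefl erefl erefl erefl erefl).
  have e0 := onh i' j false; have e1 := onh i' j true.
  have E0 := onH i' j false; have E1 := onH i' j true; have Ee := onH i j e.
  move=> H; have {}H := H ltac:(nra) isT.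
  nra.
have F2 i j j' e : (s i j e - X j') ^+ 2 - (t i j e - Y j') ^+ 2 <= c.
  have := @arc_chord R C (s i j' false - x i) (t i j' false - y i)
    (s i j' true - x i) (t i j' true - y i) (s i j e - x i) (t i j e - y i)
    (X j' - x i) (Y j' - y i) C0.
  rewrite !subr_gt0 !xs !yt !xX !yY !onh !lerD2r outh ltrD2r lt_e.
  move=> /(_ erefl erefl erefl erefl erefl erefl erefl erefl erefl erefl erefl erefl).
  have e0 := onh i j' false; have e1 := onh i j' true; have ee := onh i j e.
  have E0 := onH i j' false; have E1 := onH i j' true.
  move=> H; have {}H := H ltac:(nra) isT.
  nra.
have sep b : x (~~ b) <= x b -> forall j j' e e', s b j e <= s (~~ b) j' e'.
  move=> lex j j' e e'; rewrite leNgt; apply/negP => lts.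
  have : x b < x (~~ b); last by lra.
  apply: (translates_below C0 (xs (~~ b) j' e' (~~ b)) (yt _ _ _ _) (xs _ _ _ _)
    (yt _ _ _ _) (xs b j e (~~ b)) (yt _ _ _ _) (xs _ _ _ _) (yt _ _ _ _)
    (onh _ _ _) (F1 _ _ _ _) (onh _ _ _) (F1 _ _ _ _) lts).
  by case: (b) => //=; rewrite eq_sym.
have core a b : x (~~ a) <= x a -> s a b false <= s a (~~ b) false -> False.
  move=> lex les.
  apply: (@no_lens_square_core C c (fun i => x (a (+) i)) (fun i => y (a (+) i))
    (fun j => X (b (+) j)) (fun j => Y (b (+) j))
    (fun i j e => s (a (+) i) (b (+) j) e) (fun i j e => t (a (+) i) (b (+) j) e))
    => //; rewrite ?addbF ?addbT //.
  - by case: (b) => //=; rewrite eq_sym.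
  - by move=> j j' e e'; apply: sep.
have [le01|lt10] := lerP (x true) (x false).
- have [?|?] := lerP (s false false false) (s false true false).
    exact: (core false false).
  by apply: (core false true) => //; apply: ltW.
- have [?|?] := lerP (s true false false) (s true true false).
    by apply: (core true false) => //; apply: ltW.
  by apply: (core true true) => //; apply: ltW.
Qed.
End Translates.

(** * Points in a column *)

Section Near.
Variable R : realFieldType.

(** Squeeze with the maps [al a - al c] into [E] and [(al a - x) ^+ 2 + h b]
    into [D].  From the four values at two neighbours one recovers first the
    length of the step, then [al a - x], and with it [a], [c] and [b]. *)
Lemma column_bound (A B D E : finType) (al : A -> R) (h : B -> R)
    (de : D -> R) (ep : E -> R) (x : R) (dd : A -> B -> D) (ee : A -> A -> E)
    (G1 G2 : nat) :
  injective al -> injective h ->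
  (forall a b, de (dd a b) = (al a - x) ^+ 2 + h b) ->
  (forall a a', ep (ee a a') = al a - al a') ->
  (#|[set a | (x < al a)%R]| * (#|A| * #|B|) <=
   #|E| * G1 * (#|D| * G2) +
   #|A| * #|B| * (1 + #|E| %/ G1.+1 + #|D| %/ G2.+1))%N.
Proof.
move=> alI hI ddE eeE; set S := [set a | _].
pose good (cb : A * B) := [set st in consecutive S al |
  (gap ep (al st.1 - al cb.1) (al st.2 - al cb.1) <= G1)%N &&
  (gap de ((al st.1 - x) ^+ 2 + h cb.2) ((al st.2 - x) ^+ 2 + h cb.2) <= G2)%N].
have sq cb : (#|S| <= #|good cb| + (1 + #|E| %/ G1.+1 + #|D| %/ G2.+1))%N.
  have := @squeeze R A E D S al (fun a => al a - al cb.1)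
    (fun a => (al a - x) ^+ 2 + h cb.2) ep de (fun=> 1%N) 1 G1 G2.
  rewrite !sum1_card mul1n; apply => //.
  - by move=> s t _ _; apply: alI.
  - by move=> s t _ _; rewrite ltrD2r.
  - move=> s t; rewrite !inE => xs xt st; rewrite ltrD2r !expr2.
    by apply: ltr_pM; lra.
have cardAB : #|{: A * B}| = (#|A| * #|B|)%N by rewrite card_prod.
apply: (@leq_trans (\sum_(cb : A * B) #|good cb| +
   #|A| * #|B| * (1 + #|E| %/ G1.+1 + #|D| %/ G2.+1))%N).
  rewrite mulnC -cardAB -!sum_nat_const -big_split /=.
  by apply: leq_sum => cb _; apply: sq.
rewrite leq_add2r -card_dep_pairs.
apply: (@leq_trans #|setX (near_pairs ep G1) (near_pairs de G2)|); last first.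
  by rewrite cardsX leq_mul // card_near_pairs.
pose F (p : (A * B) * (A * A)) :=
  ((ee p.2.1 p.1.1, ee p.2.2 p.1.1), (dd p.2.1 p.1.2, dd p.2.2 p.1.2)).
apply: (@leq_card_in_to _ _ _ _ F).
  move=> [[c b] [s t]] [[c' b'] [s' t']]; rewrite !inE /=.
  case/andP=> /consecutiveP[_ _ st _] _ /andP[/consecutiveP[_ _ st' _] _].
  case=> e1 e2 e3 e4.
  move: (congr1 ep e1) (congr1 ep e2); rewrite !eeE => {}e1 {}e2.
  move: (congr1 de e3) (congr1 de e4); rewrite !ddE => {}e3 {}e4.
  have es : al s = al s'.
    have g0 : 0 < al t - al s by lra.
    have gg : al t' = al t - al s + al s' by lra.
    have : (al t - al s) * (al s - al s') = 0.
      by move: e3 e4; rewrite gg => e3 e4; nra.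
    by move/eqP; rewrite mulf_eq0 gt_eqF //= subr_eq0 => /eqP.
  have ec : al c = al c' by lra.
  have et : al t = al t' by lra.
  have eh : h b = h b' by move: e3; rewrite es; lra.
  by rewrite (alI _ _ es) (alI _ _ et) (alI _ _ ec) (hI _ _ eh).
move=> [[c b] [s t]]; rewrite !inE /= !eeE !ddE.
case/andP=> /consecutiveP[sS tS st _] /andP[-> ->].
move: sS tS; rewrite !inE => sS tS.
rewrite ltrD2r st /= andbT ltrD2r !expr2.
by apply: ltr_pM; lra.
Qed.
End Near.

(** * Double hits on short rows *)

Section ShortRows.
Variables (R : realFieldType) (A Q : finType).
Variables (al : A -> R) (x h : Q -> R).
Hypothesis alI : injective al.
Hypothesis xhI : forall q q', x q = x q' -> h q = h q' -> q = q'.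

Definition sqdist (q : Q) (a : A) : R := (al a - x q) ^+ 2 + h q.
Definition steps : {set A * A} := consecutive [set: A] al.

(** For a double hit [(q, r)] the points [(al e.1, al f.1)] and
    [(al e.2, al f.2)] are the ends of a chord of the hyperbola
    [(s - x q) ^+ 2 - (t - x r) ^+ 2 = h r - h q]. *)
Definition double_hits (ef : (A * A) * (A * A)) : {set Q * Q} :=
  [set qq | [&& ef.1 \in steps, ef.2 \in steps,
     x qq.1 < al ef.1.1, x qq.2 < al ef.2.1, h qq.1 != h qq.2,
     sqdist qq.1 ef.1.1 == sqdist qq.2 ef.2.1 &
     sqdist qq.1 ef.1.2 == sqdist qq.2 ef.2.2]].

Lemma double_hitsP e f q r :
  reflect [/\ e \in steps /\ f \in steps, x q < al e.1 /\ x r < al f.1,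
     h q != h r, sqdist q e.1 = sqdist r f.1 & sqdist q e.2 = sqdist r f.2]
    ((q, r) \in double_hits (e, f)).
Proof.
rewrite inE /=; apply: (iffP and5P) => [[-> -> -> ->]|].
  by case/and3P => ? /eqP ? /eqP ?.
by case=> [[-> ->] [-> ->] -> -> ->]; rewrite !eqxx.
Qed.

Lemma card_steps : (#|steps| <= #|A|)%N.
Proof.
rewrite -cardsT; apply: (@leq_card_in_to _ _ _ _ fst) => //.
move=> [a b] [a' b'] /consecutiveP[_ _ ab abP] /consecutiveP[_ _ ab' abP'] /= ea.
move: ab' abP'; rewrite -ea => ab' abP'; congr pair; apply: alI; apply/le_anti.
by rewrite abP ?abP'.
Qed.

Section Lower.
Variables (D : finType) (de : D -> R) (dd : A -> Q -> D).
Hypothesis ddE : forall a q, de (dd a q) = sqdist q a.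

Definition short_steps (G : nat) : {set (A * A) * Q} :=
  [set eq | [&& eq.1 \in steps, x eq.2 < al eq.1.1 &
     (gap de (sqdist eq.2 eq.1.1) (sqdist eq.2 eq.1.2) <= G)%N]].

Lemma sqdist_incr q a b : x q < al a -> al a < al b -> sqdist q a < sqdist q b.
Proof. by move=> xa ab; rewrite ltrD2r !expr2; apply: ltr_pM; lra. Qed.

(** The squeezing of a single map: the second target is empty. *)
Lemma card_short_steps (G : nat) :
  (\sum_q #|[set a | (x q < al a)%R]| <=
   #|short_steps G| + #|Q| * (1 + #|D| %/ G.+1))%N.
Proof.
pose S q := [set a | x q < al a].
pose good q := [set st in consecutive (S q) al |
  (gap de (sqdist q st.1) (sqdist q st.2) <= G)%N].
apply: (@leq_trans (\sum_q #|good q| + \sum_(q : Q) (1 + #|D| %/ G.+1))%N).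
  rewrite -big_split /=; apply: leq_sum => q _.
  have := @squeeze R A D void (S q) al (sqdist q) al de (of_void R)
     (fun=> 1%N) 1 G 0.
  rewrite !sum1_card card_void div0n addn0 mul1n => H.
  apply: leq_trans (H _ _ _ _) _ => //.
  - by move=> s t _ _; apply: alI.
  - by move=> s t; rewrite !inE => xs _; apply: sqdist_incr.
  - rewrite leq_add2r; apply/subset_leq_card/subsetP => st /setIdP[stC].
    by case/andP=> sg _; apply/setIdP.
rewrite sum_nat_const leq_add2r -card_dep_pairs.
apply: (@leq_card_in_to _ _ _ _ (fun p : Q * (A * A) => (p.2, p.1))).
  by move=> [? ?] [? ?] _ _ [-> ->].
move=> [q [s t]]; rewrite inE /= => /setIdP[/consecutiveP[sS tS st stP] sg].
rewrite inE /= sg andbT; move: sS; rewrite inE => xs; rewrite xs andbT.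
apply/consecutiveP; split=> // r _ sr; apply: stP => //.
by rewrite inE (lt_trans xs).
Qed.

(** The map to the pair of squared distances has few values, since the two
    distances are near.  A coincidence inside one row is determined by one of
    the two incidences and the other point, whence the term in [rho]. *)
Lemma short_steps_collisions (G rho : nat) :
  (forall y, (#|[set q | h q == y]| <= rho)%N) ->
  (#|short_steps G| ^ 2 <= #|D| * G *
     (\sum_ef #|double_hits ef| + #|short_steps G| * rho))%N.
Proof.
move=> rowP; pose P (p : (A * A) * Q) := (dd p.1.1 p.2, dd p.1.2 p.2).
have PV : {in short_steps G, forall p, P p \in near_pairs de G}.
  move=> [[s t] q]; rewrite inE /= => /and3P[/consecutiveP[_ _ st _] xs sg].
  by rewrite inE /= !ddE sg sqdist_incr.
apply: leq_trans (sqr_card_le_collisions PV) _.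
apply: leq_mul; first exact: card_near_pairs.
pose same := [set pp in collisions (short_steps G) P | h pp.1.2 == h pp.2.2].
rewrite -(cardsID same); rewrite addnC; apply: leq_add.
  rewrite -card_dep_pairs.
  apply: (@leq_card_in_to _ _ _ _
    (fun pp : ((A * A) * Q) * ((A * A) * Q) =>
       ((pp.1.1, pp.2.1), (pp.1.2, pp.2.2)))).
    by move=> [[? ?] [? ?]] [[? ?] [? ?]] _ _ [-> -> -> ->].
  move=> [[e q] [f r]] /setDP[pC pN]; rewrite inE; apply/double_hitsP => /=.
  have : h q != h r.
    by apply: contra pN => hh; apply/setIdP.
  move: pC; rewrite inE => /and3P[/=]; rewrite !inE /=.
  move=> /and3P[eS xe _] /and3P[fS xf _] /eqP[].
  by move=> /(congr1 de) + /(congr1 de); rewrite !ddE.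
apply: (@leq_trans #|same|); first by apply: subset_leq_card; exact: subsetIr.
apply: leq_trans (card_fibers (f := fst) (c := rho) _) _; last first.
  rewrite leq_mul2r; apply/orP; right; apply: subset_leq_card.
  apply/subsetP => _ /imsetP[[p p'] /setIdP[pC _] ->].
  by move: pC; rewrite inE => /and3P[].
move=> [e q]; apply: leq_trans (rowP (h q)).
apply: (@leq_card_in_to _ _ _ _ (fun pp => pp.2.2)); last first.
  move=> [[e' q'] [f r]] /setIdP[/setIdP[_ /= hh] /eqP[_ eq]].
  by rewrite inE -(eqP hh) eq.
have aux p f r : ((p, (f, r)) \in same) -> p = (e, q) ->
    al f.1 = al e.1 - x q + x r /\ al f.2 = al e.2 - x q + x r.
  move=> + ep; rewrite {}ep; case: e f => [e1 e2] [f1 f2] /setIdP[+ /= /eqP hh].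
  rewrite inE => /and3P[/=]; rewrite !inE /=.
  move=> /and3P[/consecutiveP[_ _ se _] xe _].
  move=> /and3P[/consecutiveP[_ _ sf _] xf _] /eqP[].
  move=> /(congr1 de) + /(congr1 de); rewrite !ddE /sqdist hh.
  by move=> /addIr h1 /addIr h2; split; nra.
move=> [p [f r]] [p' [f' r']] /setIdP[s1 /eqP /= ep] /setIdP[s2 /eqP /= ep'] /= er.
rewrite ep ep'; move: s1 s2; rewrite -er => s1 s2.
have [a1 a2] := aux _ _ _ s1 ep; have [b1 b2] := aux _ _ _ s2 ep'.
congr (_, (_, _)); case: f f' {s1 s2} a1 a2 b1 b2 => [f1 f2] [f1' f2'] /=.
move=> a1 a2 b1 b2; congr pair; apply: alI; lra.
Qed.
End Lower.
End ShortRows.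

Section Upper.
Variables (R : realFieldType) (A Q X : finType).
Variables (al : A -> R) (x h : Q -> R) (col : Q -> X) (xi : X -> R).
Hypothesis alI : injective al.
Hypothesis xhI : forall q q', x q = x q' -> h q = h q' -> q = q'.
Hypothesis xiE : forall q, xi (col q) = x q.
Hypothesis xiI : injective xi.
Variable W : nat.
Hypothesis colW : forall c, (#|[set q | col q == c]| <= W)%N.

Notation steps := (steps al).
Notation double_hits := (double_hits al x h).

Let cols (qq : Q * Q) := (col qq.1, col qq.2).

(** The difference of the two equations of a double hit: the abscissae of the
    two points satisfy a linear equation with positive slope. *)
Lemma double_hits_line e f q r : (q, r) \in double_hits (e, f) ->
  (al e.2 - al e.1) * (al e.2 + al e.1 - 2 * x q) =
  (al f.2 - al f.1) * (al f.2 + al f.1 - 2 * x r).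
Proof. by case/double_hitsP => _ _ _; rewrite /sqdist => h1 h2; nra. Qed.

Lemma double_hits_lines e f q r q' r' : (q, r) \in double_hits (e, f) ->
  (q', r') \in double_hits (e, f) ->
  (al e.2 - al e.1) * (x q' - x q) = (al f.2 - al f.1) * (x r' - x r).
Proof. by move=> /double_hits_line + /double_hits_line; nra. Qed.

Lemma steps_gt0 e : e \in steps -> 0 < al e.2 - al e.1.
Proof. by case: e => a b /consecutiveP[_ _ ab _]; rewrite subr_gt0. Qed.

Lemma double_hits_steps e f qr : qr \in double_hits (e, f) ->
  0 < al e.2 - al e.1 /\ 0 < al f.2 - al f.1.
Proof. by case: qr => q r /double_hitsP[[/steps_gt0 ? /steps_gt0 ?]]. Qed.

Lemma mem_cols e f (w : X * X) : w \in cols @: double_hits (e, f) ->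
  exists2 qr, qr \in double_hits (e, f) & xi w.1 = x qr.1 /\ xi w.2 = x qr.2.
Proof. by case/imsetP => -[q r] qr ->; exists (q, r); rewrite //= !xiE. Qed.

(** The two column pairs determine the slope of the line through them, and so
    the ratio [k] of the lengths of the steps.  The points [(al e.1, al f.1)]
    and [(al e.2, al f.2)] are then the ends of a chord of slope [k] of the
    hyperbola of [q] and [r].  Of two such chords that differ in length the
    shorter is inside the longer by [chords_nested], which puts an end of a
    step inside another step; chords of the same length are equal. *)
Lemma double_hits_unique e f e' f' q r c d :
  (q, r) \in double_hits (e, f) -> (q, r) \in double_hits (e', f') ->
  (c, d) \in cols @: double_hits (e, f) ->
  (c, d) \in cols @: double_hits (e', f') ->
  x q < xi c -> (e, f) = (e', f').
Proof.
move=> qr qr' /mem_cols[[q1 r1] /= m [ec ed]] /mem_cols[[q2 r2] /= m' [ec' ed']] lt.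
have l := double_hits_lines qr m; have l' := double_hits_lines qr' m'.
move: l l'; rewrite /= -ec -ed -ec' -ed' => l l'.
have [e0 f0] := double_hits_steps qr; have [e0' f0'] := double_hits_steps qr'.
have d0 : 0 < xi c - x q by lra.
have d0' : 0 < xi d - x r.
  by rewrite -(pmulr_rgt0 _ f0) -l; apply: mulr_gt0.
pose k := (xi c - x q) / (xi d - x r).
have k0 : 0 < k by apply: divr_gt0.
have kd : k * (xi d - x r) = xi c - x q by rewrite /k divfK // gt_eqF.
have fk : al f.2 - al f.1 = k * (al e.2 - al e.1).
  by apply: (mulIf (lt0r_neq0 d0')); rewrite -l -kd; ring.
have fk' : al f'.2 - al f'.1 = k * (al e'.2 - al e'.1).
  by apply: (mulIf (lt0r_neq0 d0')); rewrite -l' -kd; ring.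
have /double_hitsP[[eS fS] [xe xf] hne E1 E2] := qr.
have /double_hitsP[[eS' fS'] [xe' xf'] _ E1' E2'] := qr'.
move: E1 E2 E1' E2'; rewrite /sqdist => E1 E2 E1' E2'.
pose g := al e.2 - al e.1; pose g' := al e'.2 - al e'.1.
have c0 : h r - h q != 0 by rewrite subr_eq0 eq_sym.
have P1 : (al e.1 - x q) ^+ 2 - (al f.1 - x r) ^+ 2 = h r - h q by lra.
have P2 : (al e.1 - x q + g) ^+ 2 - (al f.1 - x r + k * g) ^+ 2 = h r - h q.
  by rewrite /g -fk !addrA; move: E2; rewrite /=; lra.
have P3 : (al e'.1 - x q) ^+ 2 - (al f'.1 - x r) ^+ 2 = h r - h q by lra.
have P4 : (al e'.1 - x q + g') ^+ 2 - (al f'.1 - x r + k * g') ^+ 2 = h r - h q.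
  by rewrite /g' -fk'; move: E2'; rewrite /=; lra.
have [u0 v0 u0' v0'] : [/\ 0 < al e.1 - x q, 0 < al f.1 - x r,
   0 < al e'.1 - x q & 0 < al f'.1 - x r] by split; lra.
have sep s s' : s \in steps -> s' \in steps ->
    al s'.1 < al s.1 -> al s.1 < al s'.2 -> False.
  case: s s' => [s1 s2] [s1' s2'] _ /consecutiveP[_ _ _ +] /= lt1 lt2.
  by move=> /(_ s1 (in_setT _) lt1); rewrite leNgt lt2.
have ee' : g = g'.
  case: (ltgtP g g') => // gg.
  - have [n1 n2] := chords_nested k0 c0 u0 v0 e0 u0' v0' e0' P1 P2 P3 P4 gg.
    by case: (sep e e') => //; rewrite /g /g' in n1 n2 gg; lra.
  - have [n1 n2] := chords_nested k0 c0 u0' v0' e0' u0 v0 e0 P3 P4 P1 P2 gg.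
    by case: (sep e' e) => //; rewrite /g /g' in n1 n2 gg; lra.
rewrite -ee' in P4.
have uu := chord_unique k0 c0 u0 v0 e0 u0' v0' P1 P2 P3 P4.
have e1 : al e.1 = al e'.1 by lra.
have e2 : al e.2 = al e'.2 by rewrite /g /g' in ee'; lra.
have f1 : al f.1 = al f'.1.
  have vv : (al f.1 - x r) ^+ 2 = (al f'.1 - x r) ^+ 2 by move: P1 P3; rewrite uu; lra.
  nra.
have f2 : al f.2 = al f'.2 by move: fk fk'; rewrite -/g -/g' -ee' f1; lra.
case: e f e' f' {qr qr' m m' l l' e0 f0 e0' f0' eS fS eS' fS' xe xf xe' xf' E1 E2 E1' E2' fk fk' P1 P2 P3 P4 u0 v0 u0' v0' ee' uu g g'} e1 e2 f1 f2 => [? ?] [? ?] [? ?] [? ?] /=.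
by move=> /alI -> /alI -> /alI -> /alI ->.
Qed.

Let weight ef w := #|[set qq in double_hits ef | cols qq == w]|.

Lemma card_double_hits_weight ef :
  #|double_hits ef| = (\sum_(w in cols @: double_hits ef) weight ef w)%N.
Proof.
rewrite -sum1_card (partition_big_imset cols) /=; apply: eq_bigr => w _.
by rewrite sum1dep_card.
Qed.

(** Inside given columns the height of one point of a double hit determines
    that of the other. *)
Lemma weight_le ef w : (weight ef w <= W)%N.
Proof.
apply: leq_trans (colW w.1).
apply: (@leq_card_in_to _ _ _ _ fst); last first.
  by case: w => c d [q r] /setIdP[_ /eqP[<- _]]; rewrite inE.
case: ef w => e f [c d] [q r] [q' r'] /setIdP[m /eqP[_ er]] /setIdP[m' /eqP[_ er']].
move=> /= qq; move: m'; rewrite -qq => m'; congr pair.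
have xr : x r = x r' by rewrite -!xiE er er'.
apply: xhI => //.
move: m m' => /double_hitsP[_ _ _ + _] /double_hitsP[_ _ _ + _].
by rewrite /sqdist xr; lra.
Qed.

(** Squeeze along the line of column pairs of each pair of steps.  A pair of
    points has at most [G ^ 2] near column pairs to its right, and with one of
    these it determines the steps. *)
Lemma sum_double_hits (G : nat) :
  (\sum_ef #|double_hits ef| <=
   #|Q| ^ 2 * G ^ 2 + #|A| ^ 2 * (W * (1 + #|X| %/ G.+1 + #|X| %/ G.+1)))%N.
Proof.
pose S ef := cols @: double_hits ef.
pose good ef := [set st in consecutive (S ef) (fun w => xi w.1) |
  (gap xi (xi st.1.1) (xi st.2.1) <= G)%N &&
  (gap xi (xi st.1.2) (xi st.2.2) <= G)%N].
pose near2 (qq : Q * Q) : {set X * X} :=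
  [set cd | (x qq.1 < xi cd.1) && (gap xi (x qq.1) (xi cd.1) <= G)%N &&
            ((x qq.2 < xi cd.2) && (gap xi (x qq.2) (xi cd.2) <= G)%N)].
set C := (W * _)%N.
have order ef : {in S ef &, forall s t, xi s.1 < xi t.1 -> xi s.2 < xi t.2}.
  case: ef => e f s t /mem_cols[[q r] m [-> ->]] /mem_cols[[q' r'] m' [-> ->]] /=.
  move=> lt; have [e0 f0] := double_hits_steps m.
  have l := double_hits_lines m m'.
  rewrite -subr_gt0 -(pmulr_rgt0 _ f0) -l; apply: mulr_gt0 => //.
  by rewrite subr_gt0.
have keyI ef : {in S ef &, injective (fun w : X * X => xi w.1)}.
  case: ef => e f s t /mem_cols[[q r] m [s1 s2]] /mem_cols[[q' r'] m' [t1 t2]] /=.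
  move=> st; have [e0 f0] := double_hits_steps m.
  have l := double_hits_lines m m'.
  have : xi s.2 = xi t.2.
    move: l; rewrite /= in s1 s2 t1 t2; rewrite -s1 -s2 -t1 -t2 st subrr mulr0.
    move=> /esym/eqP; rewrite mulf_eq0 gt_eqF //= subr_eq0 => /eqP ->.
    by [].
  by case: s t st {s1 s2 t1 t2} => [? ?] [? ?] /= /xiI -> /xiI ->.
apply: (@leq_trans (\sum_ef (\sum_(st in good ef) weight ef st.1 +
    (if (ef.1 \in steps) && (ef.2 \in steps) then C else 0)))%N).
  apply: leq_sum => ef _; case: ifP => [_|st].
    rewrite card_double_hits_weight.
    apply: (@squeeze R _ _ _ (S ef) (fun w => xi w.1) (fun w => xi w.1)
      (fun w => xi w.2) xi xi (weight ef) W G G (@keyI ef) _ (@order ef)) => //.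
    by move=> w _; apply: weight_le.
  rewrite [#|_|]eq_card0 // => -[q r]; apply/negP; case: ef st => e f st.
  by case/double_hitsP => -[eS fS]; rewrite /= eS fS in st.
rewrite big_split /= leq_add //; last first.
  rewrite -big_mkcond /= sum_nat_const leq_mul2r; apply/orP; right.
  rewrite (eq_card (B := setX steps steps)); last by case=> e f; rewrite !inE.
  by rewrite cardsX expnS expn1 leq_mul // card_steps.
have near2_le qq : (#|near2 qq| <= G ^ 2)%N.
  rewrite expnS expn1.
  rewrite (_ : near2 qq = setX [set c | (x qq.1 < xi c) && (gap xi (x qq.1) (xi c) <= G)%N]
     [set c | (x qq.2 < xi c) && (gap xi (x qq.2) (xi c) <= G)%N]); last first.
    by apply/setP => -[c d]; rewrite !inE.
  by rewrite cardsX leq_mul // card_near_right.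
apply: (@leq_trans #|[set p : (Q * Q) * (X * X) | p.2 \in near2 p.1]|); last first.
  rewrite card_dep_pairs; apply: (@leq_trans (\sum_(qq : Q * Q) G ^ 2)%N).
    by apply: leq_sum => qq _; apply: near2_le.
  by rewrite sum_nat_const card_prod expnS expn1.
pose T ef : {set ((X * X) * (X * X)) * (Q * Q)} :=
  [set p | (p.1 \in good ef) && (p.2 \in [set qq in double_hits ef | cols qq == p.1.1])].
have -> : (\sum_ef \sum_(st in good ef) weight ef st.1 = \sum_ef #|T ef|)%N.
  apply: eq_bigr => ef _; rewrite -sum1dep_card.
  rewrite -(pair_big_dep (mem (good ef))
    (fun st qq => qq \in [set qq in double_hits ef | cols qq == st.1]) (fun _ _ => 1%N)) /=.
  by apply: eq_bigr => st _; rewrite sum1_card.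
rewrite -card_dep_pairs.
apply: (@leq_card_in_to _ _ _ _
  (fun p : ((A * A) * (A * A)) * (((X * X) * (X * X)) * (Q * Q)) =>
     (p.2.2, p.2.1.2))); last first.
  move=> [[e f] [[s t] [q r]]].
  rewrite inE /= /T inE /= inE /= => /andP[/setIdP[stC +] /setIdP[m /eqP ms]].
  case/consecutiveP: stC => sS tS st _ /= /andP[g1 g2].
  rewrite inE /= -ms /= in st g1 g2 *; rewrite !xiE in st g1 g2.
  rewrite st g1 g2 /= andbT.
  have := order (e, f) s t sS tS; rewrite -ms /= !xiE.
  by apply.
move=> [[e f] [[s t] [q r]]] [[e' f'] [[s' t'] [q' r']]].
rewrite inE /= /T inE /=.
move=> /andP[/setIdP[/consecutiveP[sS tS st _] _] /setIdP[m /eqP ms]].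
rewrite inE /= inE /=.
move=> /andP[/setIdP[/consecutiveP[sS' tS' st' _] _] /setIdP[m' /eqP ms']].
case=> eq er et; subst q' r' t'.
have ss : s = s' by rewrite -ms -ms'.
subst s'; congr (_, _); last by rewrite -ss.
case: t tS tS' st st' => c d tS tS' st _.
apply: (double_hits_unique m m' tS tS').
by move: st; rewrite -ms /= xiE.
Qed.
End Upper.

(** * Arcs and tangencies on long rows *)

Section LongRows.
Variables (R : realFieldType) (A P Q : finType).
Variables (al : A -> R) (xP : P -> R) (xQ c : Q -> R).
Hypothesis alI : injective al.
Hypothesis xPI : injective xP.
Hypothesis xQI : forall q q', xQ q = xQ q' -> c q = c q' -> q = q'.
Hypothesis c0 : forall q, c q != 0.

(** The points of the grid on the arc of the hyperbola with centre
    [(xP v.1, xQ v.2)] and constant [c v.2]. *)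
Definition hits (v : P * Q) : {set A * A} :=
  [set z | [&& xP v.1 < al z.1, xQ v.2 < al z.2 &
            (al z.1 - xP v.1) ^+ 2 - (al z.2 - xQ v.2) ^+ 2 == c v.2]].

Lemma hitsP v z : reflect [/\ xP v.1 < al z.1, xQ v.2 < al z.2 &
    (al z.1 - xP v.1) ^+ 2 - (al z.2 - xQ v.2) ^+ 2 = c v.2] (z \in hits v).
Proof.
by rewrite inE; apply: (iffP and3P) => -[-> ->] => [/eqP|/eqP ->].
Qed.

Let key1 (z : A * A) : R := al z.1.

Lemma hits_incr v z w : z \in hits v -> w \in hits v ->
  al z.1 < al w.1 -> al z.2 < al w.2.
Proof. by move=> /hitsP[? ? ?] /hitsP[? ? ?] ?; nra. Qed.

Lemma hits_keyI v : {in hits v &, injective key1}.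
Proof.
move=> z w zv wv zw; case: (ltgtP (al z.2) (al w.2)) => h; last first.
- by case: z w zw h {zv wv} => [? ?] [? ?] /= /alI /= -> /alI /= ->.
- by move: zv wv zw => /hitsP[? ? ?] /hitsP[? ? ?]; rewrite /key1 => zw; exfalso; nra.
- by move: zv wv zw => /hitsP[? ? ?] /hitsP[? ? ?]; rewrite /key1 => zw; exfalso; nra.
Qed.

Variable G : nat.

(** Such a pair stands for the piece of the hyperbola between its points. *)
Definition arcs (v : P * Q) : {set (A * A) * (A * A)} :=
  [set zz in consecutive (hits v) (fun z : A * A => al z.1) |
     (gap al (al zz.1.1) (al zz.2.1) <= G)%N &&
     (gap al (al zz.1.2) (al zz.2.2) <= G)%N].

Lemma sum_hits_arcs : (\sum_v #|hits v| <= \sum_v #|arcs v| +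
   #|P| * #|Q| * (1 + #|A| %/ G.+1 + #|A| %/ G.+1))%N.
Proof.
rewrite -card_prod -sum_nat_const -big_split /=; apply: leq_sum => v _.
have := @squeeze R _ A A (hits v) (fun z : A * A => al z.1) (fun z => al z.1)
  (fun z => al z.2) al al (fun=> 1%N) 1 G G (@hits_keyI v).
rewrite !sum1_card mul1n; apply => // z w zv wv; exact: hits_incr zv wv.
Qed.

Definition near_arcs : {set (A * A) * (A * A)} :=
  [set zz | ((zz.1.1, zz.2.1) \in near_pairs al G) &&
            ((zz.1.2, zz.2.2) \in near_pairs al G)].

Lemma card_near_arcs : (#|near_arcs| <= (#|A| * G) ^ 2)%N.
Proof.
rewrite expnS expn1.
apply: (@leq_trans #|setX (near_pairs al G) (near_pairs al G)|); last first.
  by rewrite cardsX leq_mul // card_near_pairs.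
apply: (@leq_card_in_to _ _ _ _ (fun zz : (A * A) * (A * A) =>
  ((zz.1.1, zz.2.1), (zz.1.2, zz.2.2)))).
  by move=> [[? ?] [? ?]] [[? ?] [? ?]] _ _ [-> -> -> ->].
by move=> zz; rewrite inE in_setX.
Qed.

Lemma arcsP v z w : (z, w) \in arcs v ->
  [/\ z \in hits v, w \in hits v, al z.1 < al w.1, al z.2 < al w.2 &
      forall u, u \in hits v -> (al u.1 <= al z.1) || (al w.1 <= al u.1)].
Proof.
case/setIdP => /consecutiveP[zv wv zw H] _; split=> //.
  exact: hits_incr zv wv zw.
by move=> u uv; case: lerP => //= zu; apply: H.
Qed.

Lemma arcs_near v : arcs v \subset near_arcs.
Proof.
apply/subsetP => -[z w] zw; have [_ _ lt1 lt2 _] := arcsP zw.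
by move: zw => /setIdP[_ /andP[/= g1 g2]]; rewrite !inE /= g1 g2 lt1 lt2.
Qed.

Definition pencil (zz : (A * A) * (A * A)) : {set P * Q} :=
  [set v | zz \in arcs v].

Lemma pencilE zz v : (v \in pencil zz) = (zz \in arcs v).
Proof. by rewrite in_set. Qed.

(** In a pencil all constants have the same sign and decrease in absolute
    value, so that [- `|c|] serves as the increasing function for a second
    squeezing. *)
Lemma pencil_lt zz v w : v \in pencil zz -> w \in pencil zz ->
  xP v.1 < xP w.1 ->
  [/\ xQ v.2 < xQ w.2, `|c w.2| < `|c v.2| & 0 < c v.2 * c w.2].
Proof.
case: zz => z z'; rewrite !pencilE => vz wz lt.
have [/hitsP[a1 a2 a3] /hitsP[b1 b2 b3] z1 z2 _] := arcsP vz.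
have [/hitsP[d1 d2 d3] /hitsP[e1 e2 e3] _ _ _] := arcsP wz.
have := @pencil_mono R (al z.1 - xP v.1) (al z.2 - xQ v.2)
  (al z.1 - xP w.1) (al z.2 - xQ w.2) (al z'.1 - al z.1) (al z'.2 - al z.2)
  (c v.2) (c w.2).
have r x y t : t - y + (x - t) = x - y :> R by ring.
rewrite !r !subr_gt0 => /(_ z1 z2 a1 a2 d1 d2 (c0 _) a3 b3 d3 e3) [|h1 h2 h3].
  by lra.
by split=> //; lra.
Qed.

Lemma pencil_keyI zz : {in pencil zz &, injective (fun v : P * Q => xP v.1)}.
Proof.
case: zz => z z' v w; rewrite !pencilE => vz wz ex.
have [/hitsP[a1 a2 a3] /hitsP[b1 b2 b3] z1 z2 _] := arcsP vz.
have [/hitsP[d1 d2 d3] /hitsP[e1 e2 e3] _ _ _] := arcsP wz.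
rewrite -ex in d3 e3.
have xq : xQ v.2 = xQ w.2.
  apply: (mulfI (_ : 2 * (al z'.2 - al z.2) != 0)); first by rewrite gt_eqF; lra.
  lra.
have cq : c v.2 = c w.2 by rewrite -a3 -d3 xq.
case: v w ex xq cq {vz wz a1 a2 a3 b1 b2 b3 d1 d2 d3 e1 e2 e3} => [p q] [p' q'] /=.
by move=> /xPI -> /xQI h /h ->.
Qed.

Variables (G2 Bd : nat).

Let nc (q : Q) : R := - `|c q|.

(** Two consecutive arcs of a pencil bound a lens between their common points;
    these lenses play the role that points of tangency have in bounds for
    families of curves. *)
Definition tangencies (zz : (A * A) * (A * A)) : {set (P * Q) * (P * Q)} :=
  [set vw in consecutive (pencil zz) (fun v : P * Q => xP v.1) |
     (gap xP (xP vw.1.1) (xP vw.2.1) <= G2)%N &&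
     (gap nc (nc vw.1.2) (nc vw.2.2) <= Bd)%N].

(** Only a pair of neighbours near in both coordinates has a pencil, hence at
    most [(#|A| * G) ^ 2] pencils are squeezed. *)
Lemma sum_arcs_tangencies : (\sum_v #|arcs v| <= \sum_zz #|tangencies zz| +
   (#|A| * G) ^ 2 * (1 + #|P| %/ G2.+1 + #|Q| %/ Bd.+1))%N.
Proof.
have -> : (\sum_v #|arcs v| = \sum_zz #|pencil zz|)%N.
  under eq_bigr do rewrite -sum1_card.
  rewrite (exchange_big_dep predT) //=; apply: eq_bigr => zz _.
  by rewrite sum1dep_card.
apply: (@leq_trans (\sum_zz (#|tangencies zz| + (if zz \in near_arcs then
   1 + #|P| %/ G2.+1 + #|Q| %/ Bd.+1 else 0)))%N).
  apply: leq_sum => zz _; case: ifPn => [_|far].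
    have := @squeeze R _ P Q (pencil zz) (fun v : P * Q => xP v.1)
      (fun v => xP v.1) (fun v => nc v.2) xP nc (fun=> 1%N) 1 G2 Bd
      (@pencil_keyI zz).
    rewrite !sum1_card mul1n; apply => //.
    move=> v w vz wz lt; rewrite ltrN2.
    by have [] := pencil_lt vz wz lt.
  rewrite [#|_|]eq_card0 // => v; apply/negP; rewrite pencilE => zv.
  by case/negP: far; apply: (subsetP (arcs_near v)).
rewrite big_split /= leq_add2l -big_mkcond /= sum_nat_const leq_mul2r.
by rewrite card_near_arcs orbT.
Qed.

Lemma tangenciesP zz v w : (v, w) \in tangencies zz ->
  [/\ zz \in arcs v, zz \in arcs w, xP v.1 < xP w.1 &
    (gap xP (xP v.1) (xP w.1) <= G2)%N /\ (gap nc (nc v.2) (nc w.2) <= Bd)%N].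
Proof.
case/setIdP => /consecutiveP[]; rewrite !pencilE => zv zw lt _ /andP[g1 g2].
by split.
Qed.

(** Subtracting the equations of the two arcs shows that their common points
    lie on a line, which meets an arc at two points at most; and two
    neighbours on an arc are not separated by a third common point. *)
Lemma tangencies_inj zz zz' v w :
  (v, w) \in tangencies zz -> (v, w) \in tangencies zz' -> zz = zz'.
Proof.
case: zz zz' => [z1 z2] [z3 z4] m m'.
have [vz wz lt _] := tangenciesP m; have [vz' wz' _ _] := tangenciesP m'.
have [lt2 _ _] : [/\ xQ v.2 < xQ w.2, `|c w.2| < `|c v.2| & 0 < c v.2 * c w.2].
  by apply: (@pencil_lt (z1, z2)) => //; rewrite pencilE.
have [a1 a2 a12 _ _] := arcsP vz; have [a3 a4 a34 _ _] := arcsP vz'.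
have [b1 b2 _ _ _] := arcsP wz; have [b3 b4 _ _ _] := arcsP wz'.
have lin z : z \in hits v -> z \in hits w ->
    (xP w.1 - xP v.1) * (al z.1 - xP v.1) - (xQ w.2 - xQ v.2) * (al z.2 - xQ v.2)
    = (c v.2 - c w.2 + (xP w.1 - xP v.1) ^+ 2 - (xQ w.2 - xQ v.2) ^+ 2) / 2.
  by move=> /hitsP[_ _ e1] /hitsP[_ _ e2]; rewrite -e1 -e2; field.
have two x y z : x \in hits v -> x \in hits w -> y \in hits v -> y \in hits w ->
    z \in hits v -> z \in hits w -> al x.1 != al y.1 -> al x.1 != al z.1 ->
    al y.1 = al z.1.
  move=> xv xw yv yw zv zw n1 n2.
  have := @arc_line_le2 R (al x.1 - xP v.1) (al x.2 - xQ v.2) (al y.1 - xP v.1)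
    (al y.2 - xQ v.2) (al z.1 - xP v.1) (al z.2 - xQ v.2) (c v.2)
    (xP w.1 - xP v.1) (xQ w.2 - xQ v.2) _ (c0 _).
  rewrite !subr_gt0 => /(_ _ lt lt2).
  move: (xv) (yv) (zv) => /hitsP[_ _ e1] /hitsP[_ _ e2] /hitsP[_ _ e3].
  move=> /(_ _ e1 e2 e3 (lin _ xv xw) (lin _ yv yw) (lin _ zv zw)).
  rewrite !(inj_eq (addIr _)) => /(_ n1 n2) h; lra.
have e13 : al z1.1 = al z3.1.
  apply/eqP/negPn/negP => n13.
  have e23 : al z2.1 = al z3.1 by apply: (two z1) => //; rewrite lt_eqF.
  have e14 : al z1.1 = al z4.1.
    by apply: (two z3) => //; [rewrite eq_sym | rewrite lt_eqF].
  lra.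
have e24 : al z2.1 = al z4.1.
  apply: (two z1) => //; first by rewrite lt_eqF.
  by rewrite e13 lt_eqF.
by rewrite (hits_keyI a1 a3 e13) (hits_keyI a2 a4 e24).
Qed.

(** The arcs with constants of negative sign become arcs with positive ones
    when the two coordinates are exchanged. *)
Lemma tangencies_no_square (v w : bool -> P * Q)
    (zz : bool -> bool -> (A * A) * (A * A)) :
  (forall i j, (v i, w j) \in tangencies (zz i j)) ->
  c (v false).2 = c (v true).2 -> c (w false).2 = c (w true).2 ->
  v false != v true -> w false != w true -> False.
Proof.
move=> vw cv cw nv nw.
pose z i j (e : bool) := if e then (zz i j).2 else (zz i j).1.
have cvi i : c (v i).2 = c (v false).2 by case: i.
have cwi i : c (w i).2 = c (w false).2 by case: i.
have mem i j : [/\ zz i j \in arcs (v i), zz i j \in arcs (w j) &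
    xP (v i).1 < xP (w j).1].
  by have [] := tangenciesP (vw i j).
have lt i j : [/\ xQ (v i).2 < xQ (w j).2,
   `|c (w j).2| < `|c (v i).2| & 0 < c (v i).2 * c (w j).2].
  have [vz wz lt] := mem i j.
  by apply: (@pencil_lt (zz i j)) => //; rewrite pencilE.
have arcs_v i j : (z i j false, z i j true) \in arcs (v i).
  by have [] := mem i j; rewrite /z; case: (zz i j).
have arcs_w i j : (z i j false, z i j true) \in arcs (w j).
  by have [] := mem i j; rewrite /z; case: (zz i j).
have onv i j e : z i j e \in hits (v i).
  by have [] := arcsP (arcs_v i j); case: e.
have onw i j e : z i j e \in hits (w j).
  by have [] := arcsP (arcs_w i j); case: e.
have outv i j j' e : (al (z i j e).1 <= al (z i j' false).1) ||
    (al (z i j' true).1 <= al (z i j e).1).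
  by have [_ _ _ _] := arcsP (arcs_v i j'); apply.
have outw i j i' e : (al (z i j e).1 <= al (z i' j false).1) ||
    (al (z i' j true).1 <= al (z i j e).1).
  by have [_ _ _ _] := arcsP (arcs_w i' j); apply.
have neq (p q : P * Q) : c p.2 = c q.2 -> p != q -> (xP p.1, xQ p.2) != (xP q.1, xQ q.2).
  move=> cpq; apply: contra_neq => -[/xPI h1 h2].
  by case: p q cpq h1 h2 => [? ?] [? ?] /= cpq -> /xQI/(_ cpq) ->.
have le2 u p q : p \in hits u -> q \in hits u -> al p.1 <= al q.1 -> al p.2 <= al q.2.
  move=> pu qu; rewrite le_eqVlt => /orP[/eqP pq|/(hits_incr pu qu)/ltW //].
  by rewrite (hits_keyI pu qu pq).
have [cp|cn|c00] := ltgtP 0 (c (v false).2); last first.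
- by have := c0 (v false).2; rewrite -c00 eqxx.
- have cwn : c (w false).2 < 0.
    by have [_ _] := lt false false; rewrite nmulr_rgt0.
  apply: (@no_lens_square R (- c (v false).2) (- c (w false).2)
    (fun i => xQ (v i).2) (fun i => xP (v i).1)
    (fun j => xQ (w j).2) (fun j => xP (w j).1)
    (fun i j e => al (z i j e).2) (fun i j e => al (z i j e).1)).
  + by rewrite oppr_gt0.
  + by rewrite oppr_gt0.
  + by move=> i j; have [] := lt i j.
  + by move=> i j; have [] := mem i j.
  + by move=> i j e; have /hitsP[] := onw i j e.
  + by move=> i j e; have /hitsP[] := onw i j e.
  + by move=> i j; have [] := arcsP (arcs_v i j).
  + by move=> i j e; have /hitsP[_ _] := onv i j e; rewrite cvi => <-; rewrite opprB.
  + by move=> i j e; have /hitsP[_ _] := onw i j e; rewrite cwi => <-; rewrite opprB.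
  + move=> i j j' e; case/orP: (outv i j j' e) => h; apply/orP; [left|right];
    exact: le2 (onv _ _ _) (onv _ _ _) h.
  + move=> i j i' e; case/orP: (outw i j i' e) => h; apply/orP; [left|right];
    exact: le2 (onw _ _ _) (onw _ _ _) h.
  + by have := neq _ _ cv nv; apply: contra_neq => -[-> ->].
  + by have := neq _ _ cw nw; apply: contra_neq => -[-> ->].
- have cwp : 0 < c (w false).2.
    by have [_ _] := lt false false; rewrite pmulr_rgt0.
  apply: (@no_lens_square R (c (v false).2) (c (w false).2)
    (fun i => xP (v i).1) (fun i => xQ (v i).2)
    (fun j => xP (w j).1) (fun j => xQ (w j).2)
    (fun i j e => al (z i j e).1) (fun i j e => al (z i j e).2)) => //.
  + by move=> i j; have [] := mem i j.
  + by move=> i j; have [] := lt i j.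
  + by move=> i j e; have /hitsP[] := onw i j e.
  + by move=> i j e; have /hitsP[] := onw i j e.
  + by move=> i j; have [] := arcsP (arcs_v i j).
  + by move=> i j e; have /hitsP[_ _] := onv i j e; rewrite cvi.
  + by move=> i j e; have /hitsP[_ _] := onw i j e; rewrite cwi.
  + exact: neq.
  + exact: neq.
Qed.
End LongRows.

Section CountTangencies.
Variables (R : realFieldType) (A P Q : finType).
Variables (al : A -> R) (xP : P -> R) (xQ c : Q -> R).
Hypothesis alI : injective al.
Hypothesis xPI : injective xP.
Hypothesis xQI : forall q q', xQ q = xQ q' -> c q = c q' -> q = q'.
Hypothesis c0 : forall q, c q != 0.
Variables (G G2 Bd rho : nat).

Let row (q : Q) : {set Q} := [set q' | c q' == c q].
Hypothesis rowP : forall q, (rho <= #|row q|)%N.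

Notation nc := (fun q => - `|c q|).
Notation tang := (tangencies al xP xQ c G G2 Bd).

Let row_eq q q' : row q = row q' -> c q = c q'.
Proof.
move=> rr; have : q \in row q' by rewrite -rr inE.
by rewrite inE => /eqP.
Qed.

Let row_nc q q' : q' \in row q -> `|c q'| = `|c q|.
Proof. by rewrite inE => /eqP ->. Qed.

Let rows_right (q : Q) : {set {set Q}} :=
  row @: [set q' | (nc q < nc q') && (gap nc (nc q) (nc q') <= Bd)%N].

Let card_rows_right q : (#|rows_right q| * rho <= Bd)%N.
Proof.
apply: leq_trans (card_near_right nc (nc q) Bd).
apply: (@card_rows _ _ c) => // _ /imsetP[q' q'N ->]; exists q' => //.
apply/subsetP => q'' /row_nc e; move: q'N; rewrite !inE e.
by [].
Qed.

Let rows_left (q : Q) : {set {set Q}} :=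
  row @: [set q' | [&& 0 < c q' * c q, nc q' < nc q &
                    (gap nc (nc q') (nc q) <= Bd)%N]].

(** A gap does not count its left end, so that the row furthest away is not
    counted; the row of [q1], at the right end, takes its place. *)
Let card_rows_left q1 : (#|rows_left q1| * rho <= Bd)%N.
Proof.
pose N := [set q' | [&& 0 < c q' * c q1, nc q' < nc q1 &
                    (gap nc (nc q') (nc q1) <= Bd)%N]].
case: (set_0Vmem N) => [N0|[q qN]].
  by rewrite /rows_left -/N N0 imset0 cards0.
case: (@arg_minP _ _ _ q (mem N) nc qN) => q0 /= q0N q0min.
have {}q0N : q0 \in N by [].
have := q0N; rewrite inE => /and3P[s0 lt0 g0].
apply: (@leq_trans #|[set q' | nc q0 < nc q' <= nc q1]|) => //.
have q1N : row q1 \notin rows_left q1.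
  apply/imsetP => -[q']; rewrite inE => /and3P[_ lt _] /row_eq e.
  by rewrite e ltxx in lt.
have -> : #|rows_left q1| = #|row q1 |: (rows_left q1 :\ row q0)|.
  have nin : row q1 \notin rows_left q1 :\ row q0.
    by apply: contra q1N => /setD1P[].
  by rewrite cardsU1 nin (cardsD1 (row q0) (rows_left q1)) imset_f.
apply: (@card_rows _ _ c) => // r /setU1P[->|].
  exists q1 => //; apply/subsetP => q' /row_nc e.
  by rewrite inE e lt0 lexx.
case/setD1P => neq /imsetP[q' q'N er]; exists q' => //.
have := q'N; rewrite inE => /and3P[s' lt' g'].
have le' : nc q0 <= nc q' by apply: q0min.
apply/subsetP => q'' ; rewrite er => /row_nc e; rewrite inE e (ltW lt') andbT.
rewrite lt_neqAle le' andbT; apply: contra neq => /eqP /oppr_inj eqn.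
rewrite er; apply/eqP/setP => u; rewrite !inE; congr (_ == _).
have := eqn; case: (ltgtP 0 (c q1)) => [h|h|h].
- rewrite !gtr0_norm //; first by rewrite pmulr_lgt0 in s'.
  by rewrite pmulr_lgt0 in s0.
- rewrite !ltr0_norm //; first by move=> /oppr_inj.
  + by rewrite nmulr_lgt0 in s'.
  + by rewrite nmulr_lgt0 in s0.
- by have := c0 q1; rewrite -h eqxx.
Qed.

Let window (p : P) : {set P} := p |:
  ([set p' | (xP p < xP p') && (gap xP (xP p) (xP p') <= G2)%N] :|:
   [set p' | (xP p' < xP p) && (gap xP (xP p') (xP p) <= G2)%N]).

Let card_window p : (#|window p| <= 2 * G2 + 1)%N.
Proof.
rewrite cardsU1 addnC leq_add ?leq_b1 //.
apply: leq_trans (leq_card_setU _ _) _; rewrite mul2n -addnn.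
by rewrite leq_add ?card_near_right ?card_near_left.
Qed.

(** The triples that a second tangency can produce with [w]; the row of [w]
    enters as a factor, and it has at most [Bd] points when [w] is the target
    of any tangency. *)
Let targets (w : P * Q) : {set (P * Q) * {set Q}} :=
  if (#|row w.2| <= Bd)%N
  then setX (setX (window w.1) (row w.2)) (rows_left w.2) else set0.

Let card_targets w : (#|targets w| * rho <= (2 * G2 + 1) * Bd ^ 2)%N.
Proof.
rewrite /targets; case: ifP => [rB|_]; last by rewrite cards0.
rewrite !cardsX -mulnA expnS expn1 [X in (_ <= X)%N]mulnA; apply: leq_mul => //.
by apply: leq_mul.
Qed.

Let gap_sub (E : finType) (e : E -> R) r s t :
  r <= s -> (gap e s t <= gap e r t)%N.
Proof.
move=> rs; apply/subset_leq_card/subsetP => u; rewrite !inE => /andP[su ->].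
by rewrite (le_lt_trans rs).
Qed.

(** A count of cherries.  Map a tangency [(v, w)] to [v] and the row of [w].
    There are few values, since the rows are long and only [Bd] points are
    near.  Of two tangencies with the same value and different targets [w] and
    [w'], the second target and the row of [v] are among the few that are near
    [w], and by the absence of squares these data determine [v]. *)
Lemma sqr_sum_tangencies :
  ((\sum_zz #|tang zz|) ^ 2 * rho ^ 2 <=
   #|P| * #|Q| * Bd * ((\sum_zz #|tang zz|) * rho +
     #|P| * #|Q| * ((2 * G2 + 1) * Bd ^ 2)))%N.
Proof.
rewrite -card_dep_pairs; set F := [set p | _].
pose f (p : ((A * A) * (A * A)) * ((P * Q) * (P * Q))) := (p.2.1, row p.2.2.2).
pose V := [set vr : (P * Q) * {set Q} | vr.2 \in rows_right vr.1.2].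
have fV : {in F, forall p, f p \in V}.
  move=> [zz [v w]]; rewrite inE /= => m; rewrite inE; apply: imset_f.
  have [zv zw lt [_ g]] := tangenciesP m.
  rewrite inE g andbT ltrN2.
  have [_ -> //] : [/\ xQ v.2 < xQ w.2, `|c w.2| < `|c v.2| & 0 < c v.2 * c w.2].
  by apply: (pencil_lt c0 _ _ lt); rewrite pencilE; [exact: zv | exact: zw].
have cardV : (#|V| * rho <= #|P| * #|Q| * Bd)%N.
  rewrite /V (card_dep_pairs (fun v : P * Q => rows_right v.2)) big_distrl /=.
  rewrite -card_prod -sum_nat_const; apply: leq_sum => v _; exact: card_rows_right.
pose T := [set p : (P * Q) * ((P * Q) * {set Q}) | p.2 \in targets p.1].
have cardT : (#|T| * rho <= #|P| * #|Q| * ((2 * G2 + 1) * Bd ^ 2))%N.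
  rewrite /T card_dep_pairs big_distrl /= -card_prod -sum_nat_const.
  by apply: leq_sum => w _; apply: card_targets.
have memC p p' : (p, p') \in collisions F f ->
    [/\ p.2 \in tang p.1, p'.2 \in tang p'.1 & f p = f p'].
  have memF r : r \in F -> r.2 \in tang r.1 by rewrite in_set.
  by case/setIdP => /= pF /andP[qF /eqP]; split=> //; apply: memF.
have collF : (#|collisions F f| <= #|F| + #|T|)%N.
  pose same := [set pp in collisions F f | pp.1.2.2 == pp.2.2.2].
  rewrite -(cardsID same); apply: leq_add.
    apply: (@leq_trans #|same|); first by apply: subset_leq_card; exact: subsetIr.
    apply: (@leq_card_in_to _ _ _ _ fst); last first.
      by move=> pp /setIdP[ppC _]; move: ppC; rewrite inE => /and3P[].
    move=> [[z1 [v1 w1]] [z2 [v2 w2]]] [[z1' [v1' w1']] [z2' [v2' w2']]].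
    case/setIdP=> c1 /eqP /= e1 /setIdP[c2 /eqP /= e2] [e3 e4 e5].
    have {c1} [/= m1 m2 [ev _]] := memC _ _ c1.
    have {c2} [/= m1' m2' [ev' _]] := memC _ _ c2.
    subst z1' v1' w1' w2 w2' v2 v2'.
    by rewrite -(tangencies_inj alI c0 m1 m2)
               -(tangencies_inj alI c0 m1' m2').
  apply: (@leq_card_in_to _ _ _ _ (fun pp :
      (((A * A) * (A * A)) * ((P * Q) * (P * Q))) *
      (((A * A) * (A * A)) * ((P * Q) * (P * Q))) =>
      (pp.1.2.2, (pp.2.2.2, row pp.1.2.1.2)))).
    move=> [[z1 [v1 w1]] [z2 [v2 w2]]] [[z1' [v1' w1']] [z2' [v2' w2']]].
    case/setDP=> c1 n1 /setDP[c2 _] /= [e1 e2 er].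
    have nw : w1 != w2 by apply: contra n1 => ew; apply/setIdP.
    have {c1} [/= m1 m2 [ev rw]] := memC _ _ c1.
    have {c2} [/= m1' m2' [ev' _]] := memC _ _ c2.
    subst w1' w2' v2 v2'.
    have vv : v1 = v1'.
      apply/eqP/negPn/negP => nv.
      apply: (@tangencies_no_square _ _ _ _ _ _ _ _ alI xPI xQI c0 G G2 Bd
        (fun i => if i then v1' else v1) (fun j => if j then w2 else w1)
        (fun i j => if i then (if j then z2' else z1') else (if j then z2 else z1))
        _ (row_eq er) (row_eq rw) nv nw).
      by case=> -[].
    subst v1'.
    by rewrite -(tangencies_inj alI c0 m1 m1')
               -(tangencies_inj alI c0 m2 m2').
  move=> [[z1 [v1 w1]] [z2 [v2 w2]]] /setDP[/memC[/= m1 m2 [ev rw]] _].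
  subst v2; rewrite /T in_set /=.
  have [a1 b1 lt1 [g1 h1]] := tangenciesP m1.
  have [a2 b2 lt2 [g2 h2]] := tangenciesP m2.
  have [_ k1 s1] : [/\ xQ v1.2 < xQ w1.2, `|c w1.2| < `|c v1.2| & 0 < c v1.2 * c w1.2].
    by apply: (pencil_lt c0 _ _ lt1); rewrite pencilE; [exact: a1 | exact: b1].
  have rB : (#|row w1.2| <= Bd)%N.
    apply: leq_trans h1; apply/subset_leq_card/subsetP => q /row_nc e.
    by rewrite inE e ltrN2 k1 lexx.
  rewrite /targets rB; apply/setXP; split.
  case: w2 {m2 a2 b2 h2} rw lt2 g2 => [p2 q2] /= rw lt2 g2; apply/setXP; split.
  - rewrite !inE; case: (ltgtP (xP w1.1) (xP p2)) => [lt|lt|/xPI ->].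
    + by rewrite (leq_trans (gap_sub _ _ (ltW lt1)) g2) orbT.
    + by rewrite (leq_trans (gap_sub _ _ (ltW lt2)) g1) !orbT.
    + by rewrite eqxx.
  - by rewrite inE (row_eq rw).
  by apply: imset_f; rewrite inE s1 ltrN2 k1 h1.
have sq := sqr_card_le_collisions fV.
apply: (@leq_trans ((#|V| * rho) * (#|collisions F f| * rho))).
  by rewrite [X in (_ <= X)%N]mulnACA mulnn leq_mul2r sq orbT.
apply: leq_mul => //; apply: leq_trans (_ : (#|F| + #|T|) * rho <= _)%N.
  by rewrite leq_mul2r collF orbT.
by rewrite mulnDl leq_add2l.
Qed.
End CountTangencies.

(** * Comparison of the exponents *)

Section Arithmetic.
Variable F : realFieldType.
Implicit Types n m L s B k G e r rho T M : F.

Lemma quot_le m G e n C x : 0 <= m -> 0 <= e -> 0 < n ->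
  C * n <= (G + 1) * m -> e * (G + 1) <= x -> e * C * n <= x * m.
Proof.
move=> m0 e0 n0 h1 h2.
have : e * (C * n) <= e * ((G + 1) * m) by apply: ler_wpM2l.
have : e * (G + 1) * m <= x * m by apply: ler_wpM2r.
lra.
Qed.

(** The arithmetic of [column_bound] for [G] about 1000 n/m: both error terms
    are below m/1000 and leave a positive part of [k >= m / 100]. *)
Lemma column_arith n m B k G e1 e2 : 10 ^+ 5 <= m -> m <= n -> 0 <= B ->
  m <= 100 * k -> 0 <= G -> 0 <= e1 -> 0 <= e2 ->
  G * m <= 1000 * n -> 1000 * n <= (G + 1) * m ->
  e1 * (G + 1) <= n -> e2 * (G + 1) <= n ->
  k * (m * B) <= n * G * (n * G) + m * B * (1 + e1 + e2) ->
  m ^+ 4 * B <= 10 ^+ 9 * n ^+ 4.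
Proof.
move=> m5 mn B0 km G0 e10 e20 Gm Gm' h1 h2 main.
have m0 : 0 < m by lra.
have n0 : 0 < n by lra.
have [m_ge0 n_ge0] : 0 <= m /\ 0 <= n by split; exact: ltW.
have q1 : e1 * 1000 <= m.
  by have := quot_le (ltW m0) e10 n0 Gm' h1; rewrite [n * m]mulrC ler_pM2r.
have q2 : e2 * 1000 <= m.
  by have := quot_le (ltW m0) e20 n0 Gm' h2; rewrite [n * m]mulrC ler_pM2r.
have mB0 : 0 <= m * B by apply: mulr_ge0.
have a1 : m * B * (7 * m) <= 1000 * ((n * G) ^+ 2).
  have : m * B * (7 * m) <= m * B * (1000 * (k - 1 - e1 - e2)).
    by apply: ler_wpM2l => //; lra.
  rewrite expr2; lra.
have a2 : (n * G * m) ^+ 2 <= (1000 * n ^+ 2) ^+ 2.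
  have : 0 <= n * G * m by rewrite !mulr_ge0.
  have le : n * G * m <= 1000 * n ^+ 2.
    have -> : 1000 * n ^+ 2 = n * (1000 * n) by ring.
    by rewrite -mulrA ler_wpM2l.
  by move=> h; rewrite [leLHS]expr2 [leRHS]expr2; apply: ler_pM.
have a3 : m ^+ 2 * (m * B * (7 * m)) <= m ^+ 2 * (1000 * (n * G) ^+ 2).
  by apply: ler_wpM2l => //; apply: sqr_ge0.
have B4 : 0 <= m ^+ 4 * B by apply: mulr_ge0 => //; apply: exprn_ge0.
have e3 : m ^+ 2 * (m * B * (7 * m)) = 7 * (m ^+ 4 * B) by ring.
have e4 : m ^+ 2 * (1000 * (n * G) ^+ 2) = 1000 * (n * G * m) ^+ 2 by ring.
have e5 : (1000 * n ^+ 2) ^+ 2 = 10 ^+ 6 * n ^+ 4 by ring.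
have n4 : 0 <= n ^+ 4 by apply: exprn_ge0.
rewrite e3 e4 in a3; rewrite e5 in a2; lra.
Qed.

(** The arithmetic of [short_steps_collisions] for [G] about 1000 L n/m: few
    steps are wide, and the bound on [rho] makes the coincidences inside the
    rows negligible. *)
Lemma double_hits_lower n m L S M T q d G e rho :
  1 <= L -> 10 ^+ 5 * L <= m -> m <= n -> n * m <= 100 * L * S ->
  0 <= q -> q <= n -> 0 <= d -> d <= n -> 0 <= e -> 0 <= G -> 0 <= M -> 0 <= T ->
  0 <= rho ->
  e * (G + 1) <= n -> G * m <= 1000 * L * n -> 1000 * L * n <= (G + 1) * m ->
  S <= M + q * (1 + e) -> M ^+ 2 <= d * G * (T + M * rho) ->
  rho * (10 ^+ 6 * L ^+ 2 * n) <= m ^+ 2 ->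
  m ^+ 3 <= 10 ^+ 8 * L ^+ 3 * T.
Proof.
move=> L1 mL mn hS q0 qn d0 dn e0 G0 M0 T0 r0 he Gm Gm' hM main hr.
have m0 : 0 < m by lra.
have n0 : 0 < n by lra.
have L0 : 0 < L by lra.
have eL : e * (1000 * L) <= m.
  by have := quot_le (ltW m0) e0 n0 Gm' he; rewrite [n * m]mulrC ler_pM2r.
have nm0 : 0 < n * m by exact: mulr_gt0.
have [m_ge0 n_ge0 L_ge0] : [/\ 0 <= m, 0 <= n & 0 <= L] by split; exact: ltW.
have hM2 : n * m <= 200 * L * M.
  have h1 : q * (1 + e) <= n * (1 + e) by apply: ler_wpM2r => //; lra.
  have h2 : L * S <= L * (M + n * (1 + e)) by apply: ler_wpM2l; [exact: L_ge0 | lra].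
  have h3 : n * (e * (1000 * L)) <= n * m by apply: ler_wpM2l.
  have h4 : n * (10 ^+ 5 * L) <= n * m by apply: ler_wpM2l.
  lra.
have LM0 : 0 < L * M by lra.
have M1 : 0 < M by rewrite pmulr_rgt0 in LM0.
have step : M ^+ 2 * m <= 1000 * L * n ^+ 2 * (T + M * rho).
  have X0 : 0 <= T + M * rho by apply: addr_ge0 => //; apply: mulr_ge0.
  have h1 : d * G <= n * G by apply: ler_wpM2r.
  have h2 : d * G * (T + M * rho) <= n * G * (T + M * rho) by apply: ler_wpM2r.
  have h3 : M ^+ 2 * m <= n * G * (T + M * rho) * m.
    by apply: ler_wpM2r => //; exact: le_trans main h2.
  have h4 : n * (T + M * rho) * (G * m) <= n * (T + M * rho) * (1000 * L * n).
    by apply: ler_wpM2l => //; rewrite !mulr_ge0.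
  have e1 : n * G * (T + M * rho) * m = n * (T + M * rho) * (G * m) by ring.
  have e2 : n * (T + M * rho) * (1000 * L * n) =
    1000 * L * n ^+ 2 * (T + M * rho) by ring.
  lra.
have small : 1000 * (L * (1000 * L * n ^+ 2 * (M * rho))) <= M * n * m ^+ 2.
  have h : M * n * (rho * (10 ^+ 6 * L ^+ 2 * n)) <= M * n * m ^+ 2.
    by apply: ler_wpM2l => //; rewrite !mulr_ge0.
  have e1 : M * n * (rho * (10 ^+ 6 * L ^+ 2 * n)) =
     1000 * (L * (1000 * L * n ^+ 2 * (M * rho))) by ring.
  lra.
have small2 : M * n * m ^+ 2 <= 200 * (L * (M ^+ 2 * m)).
  have h : M * m * (n * m) <= M * m * (200 * L * M).
    by apply: ler_wpM2l => //; rewrite !mulr_ge0.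
  have e1 : M * m * (n * m) = M * n * m ^+ 2 by ring.
  have e2 : M * m * (200 * L * M) = 200 * (L * (M ^+ 2 * m)) by ring.
  lra.
have step2 : L * (M ^+ 2 * m) <= L * (1000 * L * n ^+ 2 * (T + M * rho)).
  by apply: ler_wpM2l.
have e1 : L * (1000 * L * n ^+ 2 * (T + M * rho)) =
  L * (1000 * L * n ^+ 2 * T) + L * (1000 * L * n ^+ 2 * (M * rho)) by ring.
have key : M ^+ 2 * m <= 1250 * L * n ^+ 2 * T.
  by rewrite -(ler_pM2l L0); clear -step2 e1 small small2; lra.
have low : (n * m) ^+ 2 * m <= 4 * 10 ^+ 4 * L ^+ 2 * (M ^+ 2 * m).
  have h : (n * m) ^+ 2 <= (200 * L * M) ^+ 2.
    by rewrite [leLHS]expr2 [leRHS]expr2; apply: ler_pM => //; exact: ltW.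
  have h2 : (n * m) ^+ 2 * m <= (200 * L * M) ^+ 2 * m by apply: ler_wpM2r.
  apply: le_trans h2 _; rewrite le_eqVlt; apply/orP; left; apply/eqP; ring.
have L2 : 0 <= 4 * 10 ^+ 4 * L ^+ 2.
  by apply: mulr_ge0; [apply: mulr_ge0; rewrite ?exprn_ge0 | exact: sqr_ge0].
have := ler_wpM2l L2 key.
have -> : 4 * 10 ^+ 4 * L ^+ 2 * (1250 * L * n ^+ 2 * T) =
  n ^+ 2 * (5 * 10 ^+ 7 * L ^+ 3 * T) by ring.
have e3 : (n * m) ^+ 2 * m = n ^+ 2 * m ^+ 3 by ring.
have n2 : 0 < n ^+ 2 by apply: exprn_gt0.
move=> h; have : n ^+ 2 * m ^+ 3 <= n ^+ 2 * (5 * 10 ^+ 7 * L ^+ 3 * T).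
  by rewrite -e3; exact: le_trans low h.
rewrite ler_pM2l // => h'.
have : 0 <= L ^+ 3 * T by apply: mulr_ge0 => //; apply: exprn_ge0.
clear -h'; lra.
Qed.

(** The arithmetic of [sum_double_hits] for [G] about 16 m^2 n/T: the error
    terms are less than half of [T] as columns are small, whence
    T^3 <= 512 n^4 m^4, to be compared with [double_hits_lower]. *)
Lemma double_hits_upper n m L T q s x G f :
  1 <= L -> 10 ^+ 5 * L <= m -> m <= n -> 0 <= q -> q <= n -> 0 <= f -> 0 <= G ->
  0 <= s -> 0 <= x -> s * x <= n -> s * (10 ^+ 9 * L ^+ 3) <= m ->
  m ^+ 3 <= 10 ^+ 8 * L ^+ 3 * T -> f * (G + 1) <= x ->
  G * T <= 16 * m ^+ 2 * n -> 16 * m ^+ 2 * n <= (G + 1) * T ->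
  T <= q ^+ 2 * G ^+ 2 + m ^+ 2 * (2 * s * (1 + f + f)) ->
  m ^+ 5 <= 10 ^+ 27 * L ^+ 9 * n ^+ 4.
Proof.
move=> L1 mL mn q0 qn f0 G0 s0 x0 sx sm mT hf GT GT' main.
have m0 : 0 < m by lra.
have n0 : 0 < n by lra.
have L0 : 0 < L by lra.
have L3 : 0 < L ^+ 3 by apply: exprn_gt0.
have [m_ge0 n_ge0 L_ge0] : [/\ 0 <= m, 0 <= n & 0 <= L] by split; exact: ltW.
have T0 : 0 < T.
  have : 0 < 10 ^+ 8 * L ^+ 3 * T by apply: lt_le_trans mT; apply: exprn_gt0.
  by rewrite pmulr_rgt0 //; lra.
have w1 : 10 * (s * m ^+ 2) <= T.
  have h : m ^+ 2 * (s * (10 ^+ 9 * L ^+ 3)) <= m ^+ 2 * m.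
    by apply: ler_wpM2l => //; apply: sqr_ge0.
  have e1 : m ^+ 2 * m = m ^+ 3 by ring.
  have e2 : m ^+ 2 * (s * (10 ^+ 9 * L ^+ 3)) = L ^+ 3 * (10 ^+ 9 * (s * m ^+ 2)) by ring.
  have : L ^+ 3 * (10 ^+ 9 * (s * m ^+ 2)) <= L ^+ 3 * (10 ^+ 8 * T) by lra.
  by rewrite ler_pM2l //; lra.
have w2 : 16 * (s * f * m ^+ 2) <= T.
  have h1 : f * (16 * m ^+ 2 * n) <= f * ((G + 1) * T) by apply: ler_wpM2l.
  have h2 : f * (G + 1) * T <= x * T by apply: ler_wpM2r => //; lra.
  have h3 : s * (f * (16 * m ^+ 2 * n)) <= s * (x * T) by apply: ler_wpM2l => //; lra.
  have h4 : s * x * T <= n * T by apply: ler_wpM2r => //; lra.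
  have e1 : s * (f * (16 * m ^+ 2 * n)) = n * (16 * (s * f * m ^+ 2)) by ring.
  have : n * (16 * (s * f * m ^+ 2)) <= n * T by lra.
  by rewrite ler_pM2l.
have e1 : m ^+ 2 * (2 * s * (1 + f + f)) = 2 * (s * m ^+ 2) + 4 * (s * f * m ^+ 2).
  by ring.
have q2 : q ^+ 2 * G ^+ 2 <= n ^+ 2 * G ^+ 2.
  by apply: ler_wpM2r; [exact: sqr_ge0 | rewrite !expr2; apply: ler_pM].
have h1 : T <= 2 * (n ^+ 2 * G ^+ 2) by lra.
have h2 : T * T ^+ 2 <= 2 * (n ^+ 2 * G ^+ 2) * T ^+ 2.
  by apply: ler_wpM2r => //; apply: sqr_ge0.
have h3 : (G * T) ^+ 2 <= (16 * m ^+ 2 * n) ^+ 2.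
  have : 0 <= G * T by apply: mulr_ge0 => //; exact: ltW.
  by move=> ?; rewrite !expr2; apply: ler_pM.
have h4 : n ^+ 2 * (G * T) ^+ 2 <= n ^+ 2 * (16 * m ^+ 2 * n) ^+ 2.
  by apply: ler_wpM2l => //; apply: sqr_ge0.
have T3 : T ^+ 3 <= 512 * n ^+ 4 * m ^+ 4.
  have e2 : T * T ^+ 2 = T ^+ 3 by ring.
  have e3 : 2 * (n ^+ 2 * G ^+ 2) * T ^+ 2 = 2 * (n ^+ 2 * (G * T) ^+ 2) by ring.
  have e4 : n ^+ 2 * (16 * m ^+ 2 * n) ^+ 2 = 256 * n ^+ 4 * m ^+ 4 by ring.
  lra.
have m9 : (m ^+ 3) ^+ 3 <= (10 ^+ 8 * L ^+ 3 * T) ^+ 3.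
  have m3 : 0 <= m ^+ 3 by apply: exprn_ge0.
  by apply: lerXn2r; rewrite ?nnegrE // (le_trans m3).
have L9 : 0 <= 10 ^+ 24 * L ^+ 9.
  by apply: mulr_ge0; apply: exprn_ge0; rewrite ?ler0n.
have h5 := ler_wpM2l L9 T3.
have m4 : 0 < m ^+ 4 by apply: exprn_gt0.
rewrite -(ler_pM2l m4).
have e5 : (m ^+ 3) ^+ 3 = m ^+ 4 * m ^+ 5 by ring.
have e6 : (10 ^+ 8 * L ^+ 3 * T) ^+ 3 = 10 ^+ 24 * L ^+ 9 * T ^+ 3 by ring.
have e7 : 10 ^+ 24 * L ^+ 9 * (512 * n ^+ 4 * m ^+ 4) =
  10 ^+ 24 * 512 * (m ^+ 4 * (L ^+ 9 * n ^+ 4)) by ring.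
have X0 : 0 <= m ^+ 4 * (L ^+ 9 * n ^+ 4).
  by apply: mulr_ge0; [exact: ltW | apply: mulr_ge0; exact: exprn_ge0].
have e8 : m ^+ 4 * (10 ^+ 27 * L ^+ 9 * n ^+ 4) =
  10 ^+ 24 * 1000 * (m ^+ 4 * (L ^+ 9 * n ^+ 4)) by ring.
rewrite e5 e6 in m9; rewrite e7 in h5; rewrite e8.
apply: le_trans m9 (le_trans h5 _); apply: ler_wpM2r => //.
by apply: ler_wpM2l; [rewrite exprn_ge0 | rewrite ler_nat].
Qed.

(** [S] is about 9/40 of n m, and [d] is about 8/40 of n: after subtracting the
    coincidences inside the rows a positive part of [S ^+ 2] remains. *)
Lemma long_hits_lower n m S d Ep : 10 ^+ 5 <= m -> m <= n ->
  9 * (n * (m - 1)) <= 40 * S -> 0 <= d -> 5 * d <= n + 5 ->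
  S ^+ 2 <= d * (m * S + Ep) -> n * m ^+ 2 <= 50 * Ep.
Proof.
move=> m5 mn hS d0 hd main.
have n0 : 0 < n by lra.
have m0 : 0 < m by lra.
have nm0 : 0 < n * m by exact: mulr_gt0.
have nn : n * 10 ^+ 5 <= n * m by apply: ler_wpM2l => //; lra.
have S1 : 2249 * (n * m) <= 10 ^+ 4 * S by lra.
have d1 : 10 ^+ 4 * d <= 2001 * n by lra.
have md : m * d <= m * (2001 / 10 ^+ 4 * n) by apply: ler_wpM2l; lra.
have S2 : 248 * (n * m) <= 10 ^+ 4 * (S - m * d) by lra.
have h : 2249 * (n * m) * (248 * (n * m)) <= 10 ^+ 4 * S * (10 ^+ 4 * (S - m * d)).
  by clear -nm0 S1 S2; apply: ler_pM; lra.
have e1 : S ^+ 2 - d * (m * S) = S * (S - m * d) by ring.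
have h2 : 2249 * 248 * (n * m) ^+ 2 <= 10 ^+ 8 * (d * Ep).
  have -> : 2249 * 248 * (n * m) ^+ 2 = 2249 * (n * m) * (248 * (n * m)) by ring.
  lra.
have Ep0 : 0 <= Ep.
  rewrite leNgt; apply/negP => Ep0.
  have : d * Ep <= 0 by apply: mulr_ge0_le0 => //; exact: ltW.
  have : 0 < (n * m) ^+ 2 by apply: exprn_gt0.
  clear -h2; lra.
have h3 : 10 ^+ 4 * d * Ep <= 2001 * n * Ep by apply: ler_wpM2r.
have e2 : (n * m) ^+ 2 = n * (n * m ^+ 2) by ring.
have : n * (2249 * 248 * (n * m ^+ 2)) <= n * (10 ^+ 4 * 2001 * Ep).
  by clear -h2 h3 e2; lra.
rewrite ler_pM2l // => h4.
have : 0 <= n * m ^+ 2 by apply: mulr_ge0; [exact: ltW | exact: sqr_ge0].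
clear -h4; lra.
Qed.

(** The three window sizes are chosen such that each error term of the two
    squeezings is a small part of m^2 r/50. *)
Lemma long_tangencies n m r q e F1 F2 G G2 B g f1 f2 :
  10 ^+ 5 <= m -> m <= n -> 0 < r -> 0 <= q -> q <= n -> 10 ^+ 4 * n <= m ^+ 2 ->
  10 ^+ 11 * n ^+ 2 <= m ^+ 2 * r ->
  0 <= G -> 0 <= g -> 0 <= f1 -> 0 <= f2 ->
  G * m <= 10 ^+ 4 * n -> 10 ^+ 4 * n <= (G + 1) * m ->
  10 ^+ 11 * n ^+ 2 <= (G2 + 1) * m ^+ 2 ->
  10 ^+ 11 * n ^+ 3 <= (B + 1) * (m ^+ 2 * r) ->
  g * (G + 1) <= m -> f1 * (G2 + 1) <= r -> f2 * (B + 1) <= n ->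
  m ^+ 2 * r <= 50 * e ->
  e <= F1 + r * q * (1 + g + g) ->
  F1 <= F2 + (m * G) ^+ 2 * (1 + f1 + f2) ->
  m ^+ 2 * r <= 100 * F2.
Proof.
move=> m5 mn r0 q0 qn nm2 n2r G0 g0 f10 f20 Gm Gm' hG2 hB hg h1 h2 he eF1 F12.
have n0 : 0 < n by lra.
have m0 : 0 < m by lra.
have m2 : 0 < m ^+ 2 by apply: exprn_gt0.
have n2 : 0 < n ^+ 2 by apply: exprn_gt0.
have mr : 0 < m ^+ 2 * r by exact: mulr_gt0.
have a1 : g * 10 ^+ 4 * n <= m * m by apply: quot_le Gm' hg; lra.
have a2 : f1 * 10 ^+ 11 * n ^+ 2 <= r * m ^+ 2 by apply: quot_le hG2 h1 => //; lra.
have a3 : f2 * 10 ^+ 11 * n ^+ 2 <= m ^+ 2 * r.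
  have n3 : 0 < n ^+ 3 by apply: exprn_gt0.
  have := quot_le (ltW mr) f20 n3 hB h2.
  have -> : f2 * 10 ^+ 11 * n ^+ 3 = n * (f2 * 10 ^+ 11 * n ^+ 2) by ring.
  by rewrite ler_pM2l.
have b1 : r * q * (1 + g + g) <= r * n * (1 + g + g).
  apply: ler_wpM2r; first by lra.
  by apply: ler_wpM2l; lra.
have b2 : r * (g * 10 ^+ 4 * n) <= r * (m * m) by apply: ler_wpM2l; lra.
have b3 : r * (10 ^+ 4 * n) <= r * m ^+ 2 by apply: ler_wpM2l; lra.
have c1 : (m * G) ^+ 2 <= 10 ^+ 8 * n ^+ 2.
  have : (m * G) ^+ 2 <= (10 ^+ 4 * n) ^+ 2.
    have : 0 <= m * G by apply: mulr_ge0; lra.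
    by move=> ?; rewrite !expr2; apply: ler_pM; lra.
  have -> : (10 ^+ 4 * n) ^+ 2 = 10 ^+ 8 * n ^+ 2 by ring.
  by [].
have c2 : (m * G) ^+ 2 * (1 + f1 + f2) <= 10 ^+ 8 * n ^+ 2 * (1 + f1 + f2).
  by apply: ler_wpM2r => //; lra.
lra.
Qed.

(** The two alternatives are the two terms in the bound of
    [sqr_sum_tangencies]; the second one gives the exponent 9/11. *)
Lemma long_final n m L r rho q F2 G2 B :
  1 <= L -> 10 ^+ 5 <= m -> m <= n -> 0 < rho -> rho <= r -> 0 <= q -> q <= n ->
  m ^+ 2 <= rho * (10 ^+ 6 * L ^+ 2 * n) -> 0 <= G2 -> 0 <= B -> 0 <= F2 ->
  G2 * m ^+ 2 <= 10 ^+ 11 * n ^+ 2 ->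
  B * (m ^+ 2 * r) <= 10 ^+ 11 * n ^+ 3 ->
  m ^+ 2 * r <= 100 * F2 ->
  F2 ^+ 2 * rho ^+ 2 <=
    r * q * B * (F2 * rho + r * q * ((2 * G2 + 1) * B ^+ 2)) ->
  m ^+ 8 <= 10 ^+ 26 * n ^+ 6 * L ^+ 4 \/ m ^+ 22 <= 10 ^+ 80 * n ^+ 18 * L ^+ 10.
Proof.
move=> L1 m5 mn rho0 rr q0 qn mrho G0 B0 F0 hG hB hF main.
have n0 : 0 < n by lra.
have m0 : 0 < m by lra.
have r0 : 0 < r by lra.
have m2 : 0 < m ^+ 2 by apply: exprn_gt0.
have [m_ge0 n_ge0 r_ge0 L_ge0] : [/\ 0 <= m, 0 <= n, 0 <= r & 0 <= L].
  by split; lra.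
have rho_ge0 : 0 <= rho by exact: ltW.
have mr : 0 < m ^+ 2 * r by exact: mulr_gt0.
pose X := F2 * rho; pose Y := r * q * ((2 * G2 + 1) * B ^+ 2).
pose k := 10 ^+ 6 * L ^+ 2 * n.
have L2 : 0 <= L ^+ 2 by apply: sqr_ge0.
have k0 : 0 <= k by rewrite /k !mulr_ge0 //; lra.
have mrk : m ^+ 2 <= rho * k by exact: mrho.
have X0 : 0 < X by apply: mulr_gt0 => //; lra.
have hX : m ^+ 2 * r * rho <= 100 * X.
  have : m ^+ 2 * r * rho <= 100 * F2 * rho by apply: ler_wpM2r => //; lra.
  by rewrite /X; lra.
have B20 : 0 <= B ^+ 2 by apply: sqr_ge0.
have G1 : 0 <= 2 * G2 + 1 by lra.
have Y0 : 0 <= Y by rewrite /Y !mulr_ge0.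
have {}main : X ^+ 2 <= r * n * B * (X + Y).
  apply: (@le_trans _ _ (r * q * B * (X + Y))).
    by rewrite /X /Y exprMn.
  apply: ler_wpM2r; first by lra.
  by apply: ler_wpM2r => //; apply: ler_wpM2l; lra.
have rnB : 0 <= r * n * B by rewrite !mulr_ge0.
have [YX|XY] := lerP Y X.
  left.
  have h1 : X * X <= 2 * (r * n * B) * X.
    have : r * n * B * (X + Y) <= r * n * B * (2 * X) by apply: ler_wpM2l => //; lra.
    by rewrite expr2 in main; lra.
  rewrite ler_pM2r // in h1.
  have h2 : m ^+ 2 * r * rho * m ^+ 2 <= 200 * (r * n * B) * m ^+ 2.
    by apply: ler_wpM2r; [exact: ltW | lra].
  have h3 : 200 * n * (B * (m ^+ 2 * r)) <= 200 * n * (10 ^+ 11 * n ^+ 3).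
    by apply: ler_wpM2l => //; lra.
  have h4 : m ^+ 4 * (r * rho) <= 2 * 10 ^+ 13 * n ^+ 4.
    have e1 : m ^+ 2 * r * rho * m ^+ 2 = m ^+ 4 * (r * rho) by ring.
    have e2 : 200 * (r * n * B) * m ^+ 2 = 200 * n * (B * (m ^+ 2 * r)) by ring.
    have e3 : 200 * n * (10 ^+ 11 * n ^+ 3) = 2 * 10 ^+ 13 * n ^+ 4 by ring.
    lra.
  have h5 : m ^+ 4 <= r * rho * k ^+ 2.
    have -> : m ^+ 4 = m ^+ 2 * m ^+ 2 by ring.
    have -> : r * rho * k ^+ 2 = r * k * (rho * k) by ring.
    have hrk : rho * k <= r * k by apply: ler_wpM2r.
    by apply: ler_pM; rewrite ?(ltW m2) //; lra.
  have m4 : 0 <= m ^+ 4 by apply: exprn_ge0.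
  have h6 := ler_wpM2l m4 h5.
  have h7 := ler_wpM2r (sqr_ge0 k) h4.
  have e1 : m ^+ 4 * m ^+ 4 = m ^+ 8 by ring.
  have e2 : m ^+ 4 * (r * rho * k ^+ 2) = m ^+ 4 * (r * rho) * k ^+ 2 by ring.
  have e3 : 2 * 10 ^+ 13 * n ^+ 4 * k ^+ 2 = 2 * 10 ^+ 25 * (n ^+ 6 * L ^+ 4).
    by rewrite /k; ring.
  have : 0 <= n ^+ 6 * L ^+ 4 by apply: mulr_ge0; apply: exprn_ge0.
  lra.
right.
pose H := 2 * G2 + 1.
have H0 : 0 <= H by rewrite /H; lra.
have h1 : X ^+ 2 <= 2 * (r * n * B) * (r * n * (H * B ^+ 2)).
  have a1 : r * n * B * (X + Y) <= r * n * B * (2 * Y) by apply: ler_wpM2l => //; lra.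
  have a2 : Y <= r * n * (H * B ^+ 2).
    apply: ler_wpM2r; first by apply: mulr_ge0.
    by apply: ler_wpM2l; lra.
  have a3 := ler_wpM2l rnB a2.
  lra.
have h2 : (m ^+ 2 * r * rho) ^+ 2 <= 10 ^+ 4 * X ^+ 2.
  have -> : 10 ^+ 4 * X ^+ 2 = (100 * X) ^+ 2 by ring.
  have : 0 <= m ^+ 2 * r * rho by rewrite !mulr_ge0 // ltW.
  by move=> ?; rewrite !expr2; apply: ler_pM.
have h3 : (m ^+ 2 * r * rho) ^+ 2 <= r ^+ 2 * (2 * 10 ^+ 4 * n ^+ 2 * (H * B ^+ 3)).
  have -> : r ^+ 2 * (2 * 10 ^+ 4 * n ^+ 2 * (H * B ^+ 3)) =
    10 ^+ 4 * (2 * (r * n * B) * (r * n * (H * B ^+ 2))) by ring.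
  lra.
have r2 : 0 < r ^+ 2 by apply: exprn_gt0.
have h4 : m ^+ 4 * rho ^+ 2 <= 2 * 10 ^+ 4 * n ^+ 2 * (H * B ^+ 3).
  rewrite -(ler_pM2l r2); have -> : r ^+ 2 * (m ^+ 4 * rho ^+ 2) =
    (m ^+ 2 * r * rho) ^+ 2 by ring.
  by [].
have Hm : H * m ^+ 2 <= 3 * 10 ^+ 11 * n ^+ 2.
  have : m ^+ 2 <= n ^+ 2 by rewrite !expr2; apply: ler_pM.
  by rewrite /H; have := sqr_ge0 n; lra.
have B3 : (B * (m ^+ 2 * r)) ^+ 3 <= (10 ^+ 11 * n ^+ 3) ^+ 3.
  have : 0 <= B * (m ^+ 2 * r) by apply: mulr_ge0 => //; exact: ltW.
  by move=> ?; apply: lerXn2r; rewrite ?nnegrE //; lra.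
have HB : H * m ^+ 2 * (B * (m ^+ 2 * r)) ^+ 3 <=
    3 * 10 ^+ 11 * n ^+ 2 * (10 ^+ 11 * n ^+ 3) ^+ 3.
  apply: ler_pM => //; first by rewrite mulr_ge0 // ltW.
  by apply: exprn_ge0; apply: mulr_ge0 => //; exact: ltW.
have c0 : 0 <= m ^+ 8 * r ^+ 3 by apply: mulr_ge0; apply: exprn_ge0.
have h5 := ler_wpM2l c0 h4.
have n2 : 0 <= 2 * 10 ^+ 4 * n ^+ 2 by have := sqr_ge0 n; lra.
have h6 := ler_wpM2l n2 HB.
have h7 : m ^+ 12 * (r ^+ 3 * rho ^+ 2) <= 6 * 10 ^+ 48 * n ^+ 13.
  have e1 : m ^+ 8 * r ^+ 3 * (m ^+ 4 * rho ^+ 2) = m ^+ 12 * (r ^+ 3 * rho ^+ 2).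
    by ring.
  have e2 : m ^+ 8 * r ^+ 3 * (2 * 10 ^+ 4 * n ^+ 2 * (H * B ^+ 3)) =
    2 * 10 ^+ 4 * n ^+ 2 * (H * m ^+ 2 * (B * (m ^+ 2 * r)) ^+ 3) by ring.
  have e3 : 2 * 10 ^+ 4 * n ^+ 2 *
     (3 * 10 ^+ 11 * n ^+ 2 * (10 ^+ 11 * n ^+ 3) ^+ 3) = 6 * 10 ^+ 48 * n ^+ 13.
    by ring.
  lra.
have h8 : m ^+ 10 <= r ^+ 3 * rho ^+ 2 * k ^+ 5.
  have hrk : rho * k <= r * k by apply: ler_wpM2r.
  have a1 : (m ^+ 2) ^+ 3 <= (r * k) ^+ 3.
    by apply: lerXn2r; rewrite ?nnegrE ?(ltW m2) ?mulr_ge0 // (le_trans mrk).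
  have a2 : (m ^+ 2) ^+ 2 <= (rho * k) ^+ 2.
    by apply: lerXn2r; rewrite ?nnegrE ?(ltW m2) ?mulr_ge0.
  have -> : m ^+ 10 = (m ^+ 2) ^+ 3 * (m ^+ 2) ^+ 2 by ring.
  have -> : r ^+ 3 * rho ^+ 2 * k ^+ 5 = (r * k) ^+ 3 * (rho * k) ^+ 2 by ring.
  by apply: ler_pM => //; apply: exprn_ge0; exact: ltW.
have m12 : 0 <= m ^+ 12 by apply: exprn_ge0.
have k5 : 0 <= k ^+ 5 by apply: exprn_ge0.
have h9 := ler_wpM2l m12 h8.
have h10 := ler_wpM2r k5 h7.
have e1 : m ^+ 12 * m ^+ 10 = m ^+ 22 by ring.
have e2 : m ^+ 12 * (r ^+ 3 * rho ^+ 2 * k ^+ 5) =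
  m ^+ 12 * (r ^+ 3 * rho ^+ 2) * k ^+ 5 by ring.
have e3 : 6 * 10 ^+ 48 * n ^+ 13 * k ^+ 5 = 6 * 10 ^+ 78 * (n ^+ 18 * L ^+ 10).
  by rewrite /k; ring.
have : 0 <= n ^+ 18 * L ^+ 10 by apply: mulr_ge0; apply: exprn_ge0.
lra.
Qed.

(** The homogeneous form of m = O(n^(9/11) L^(20/11)), with one constant large
    enough for all cases. *)
Definition tame (n m L : F) : Prop := m ^+ 11 <= 10 ^+ 60 * n ^+ 9 * L ^+ 20.

Lemma tame_weaken n m L C i j : 1 <= L -> 1 <= n -> 0 <= C -> C <= 10 ^+ 60 ->
  (i <= 9)%N -> (j <= 20)%N -> m ^+ 11 <= C * (n ^+ i * L ^+ j) -> tame n m L.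
Proof.
move=> L1 n1 C0 C60 i9 j20 h; apply: le_trans h _; rewrite -mulrA.
apply: ler_pM => //; first by apply: mulr_ge0; apply: exprn_ge0; lra.
by apply: ler_pM; rewrite ?exprn_ge0 ?ler_weXn2l //; lra.
Qed.

Section Tame.
Variables n m L : F.
Hypotheses (L1 : 1 <= L) (m0 : 0 <= m) (n1 : 1 <= n) (mn : m <= n).

Let n0 : 0 <= n. Proof. exact: le_trans ler01 _. Qed.

Let L0 : 0 <= L. Proof. exact: le_trans ler01 _. Qed.

Let pow (a b : F) (k : nat) : 0 <= a -> a <= b -> a ^+ k <= b ^+ k.
Proof. by move=> a0 ab; apply: lerXn2r; rewrite ?nnegrE // (le_trans a0). Qed.

Let ten_pow (k : nat) : (k <= 60)%N -> 10 ^+ k <= 10 ^+ 60 :> F.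
Proof. by move=> k60; apply: ler_weXn2l => //; rewrite ler1n. Qed.

Let nL (k l : nat) : 0 <= n ^+ k * L ^+ l.
Proof. by apply: mulr_ge0; apply: exprn_ge0. Qed.

Lemma tame_small : m <= 10 ^+ 5 * L -> tame n m L.
Proof.
move=> h; apply: (@tame_weaken _ _ _ (10 ^+ 55) 0 11) => //.
- exact: exprn_ge0.
- exact: ten_pow.
- have := pow 11 m0 h; have -> : (10 ^+ 5 * L) ^+ 11 = 10 ^+ 55 * (n ^+ 0 * L ^+ 11).
    by ring.
  by [].
Qed.

Lemma tame_sqr : m ^+ 2 <= 10 ^+ 4 * n -> tame n m L.
Proof.
move=> h; apply: (@tame_weaken _ _ _ (10 ^+ 20) 6 0) => //.
- exact: exprn_ge0.
- exact: ten_pow.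
- have h5 := pow 5 (sqr_ge0 m) h.
  have -> : m ^+ 11 = (m ^+ 2) ^+ 5 * m by ring.
  have -> : 10 ^+ 20 * (n ^+ 6 * L ^+ 0) = (10 ^+ 4 * n) ^+ 5 * n by ring.
  by apply: ler_pM => //; rewrite -exprM exprn_ge0.
Qed.

Lemma tame_pow5 : m ^+ 5 <= 10 ^+ 27 * L ^+ 9 * n ^+ 4 -> tame n m L.
Proof.
move=> h; apply: (@tame_weaken _ _ _ (10 ^+ 54) 9 18) => //.
- exact: exprn_ge0.
- exact: ten_pow.
- have h2 := pow 2 (exprn_ge0 5 m0) h.
  have -> : m ^+ 11 = (m ^+ 5) ^+ 2 * m by ring.
  have -> : 10 ^+ 54 * (n ^+ 9 * L ^+ 18) = (10 ^+ 27 * L ^+ 9 * n ^+ 4) ^+ 2 * n.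
    by ring.
  by apply: ler_pM => //; rewrite -exprM exprn_ge0.
Qed.

Lemma tame_pow4 : m ^+ 4 <= 10 ^+ 17 * (n ^+ 3 * L ^+ 2) -> tame n m L.
Proof.
move=> h; apply: (@tame_weaken _ _ _ (10 ^+ 34) 9 4) => //.
- exact: exprn_ge0.
- exact: ten_pow.
- have h2 := pow 2 (exprn_ge0 4 m0) h.
  have -> : m ^+ 11 = (m ^+ 4) ^+ 2 * m ^+ 3 by ring.
  have -> : 10 ^+ 34 * (n ^+ 9 * L ^+ 4) =
    (10 ^+ 17 * (n ^+ 3 * L ^+ 2)) ^+ 2 * n ^+ 3 by ring.
  by apply: ler_pM; rewrite ?pow // -?exprM exprn_ge0.
Qed.

Lemma tame_pow8 : m ^+ 8 <= 10 ^+ 26 * n ^+ 6 * L ^+ 4 -> tame n m L.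
Proof.
move=> h; apply: (@tame_weaken _ _ _ (10 ^+ 26) 9 4) => //.
- exact: exprn_ge0.
- exact: ten_pow.
- have -> : m ^+ 11 = m ^+ 8 * m ^+ 3 by ring.
  have -> : 10 ^+ 26 * (n ^+ 9 * L ^+ 4) = 10 ^+ 26 * n ^+ 6 * L ^+ 4 * n ^+ 3.
    by ring.
  by apply: ler_pM; rewrite ?pow // exprn_ge0.
Qed.

Lemma tame_pow22 : m ^+ 22 <= 10 ^+ 80 * n ^+ 18 * L ^+ 10 -> tame n m L.
Proof.
move=> h; apply: (@tame_weaken _ _ _ (10 ^+ 40) 9 5) => //.
- exact: exprn_ge0.
- exact: ten_pow.
- rewrite -(@ler_pXn2r _ 2) //; last first.
  + by rewrite nnegrE mulr_ge0 ?exprn_ge0.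
  + by rewrite nnegrE exprn_ge0.
  have -> : (m ^+ 11) ^+ 2 = m ^+ 22 by ring.
  have -> : (10 ^+ 40 * (n ^+ 9 * L ^+ 5)) ^+ 2 = 10 ^+ 80 * n ^+ 18 * L ^+ 10.
    by ring.
  by [].
Qed.
End Tame.
End Arithmetic.

(** The quotient is hidden behind the quantifier because the numerators contain
    large powers of ten, which conversion would unfold in unary. *)
Lemma natr_floor (R : realFieldType) (c d : nat) : (0 < d)%N -> exists G : nat,
  G%:R * d%:R <= c%:R :> R /\ c%:R <= (G%:R + 1) * d%:R :> R.
Proof.
move=> d0; exists (c %/ d)%N; rewrite -natrM -[_ + 1](natrD R _ 1) -natrM !ler_nat.
by rewrite addn1; split; [exact: leq_divM | exact/ltnW/ltn_ceil].
Qed.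

Lemma natr_pow10 (R : realFieldType) k : 10 ^+ k = (10 ^ k)%:R :> R.
Proof. by rewrite natrX. Qed.

Lemma natr_divn_le (R : realFieldType) (c G n : nat) : (c <= n)%N ->
  (c %/ G.+1)%:R * (G%:R + 1) <= n%:R :> R.
Proof.
move=> cn; rewrite -[_ + 1](natrD R _ 1) addn1 -natrM ler_nat.
exact: leq_trans (leq_divM _ _) cn.
Qed.

(** * From the counts to the exponents *)

Section Column.
Variables (R : realFieldType) (A Q D E : finType).
Variables (al : A -> R) (x h : Q -> R) (de : D -> R) (dd : A -> Q -> D).
Variables (ep : E -> R) (ee : A -> A -> E).
Hypothesis alI : injective al.
Hypothesis xhI : forall q q', x q = x q' -> h q = h q' -> q = q'.
Hypothesis ddE : forall a q, de (dd a q) = sqdist al x h q a.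
Hypothesis eeE : forall a a', ep (ee a a') = al a - al a'.
Variables (n : nat).
Hypotheses (Dn : (#|D| <= n)%N) (En : (#|E| <= n)%N) (An : (#|A| <= n)%N).
Hypothesis A_large : (10 ^ 5 <= #|A|)%N.

Lemma column_small (B : {set Q}) q0 : q0 \in B ->
  {in B, forall q, x q = x q0} ->
  (#|A| <= 100 * #|[set a | (x q0 < al a)%R]|)%N ->
  #|A|%:R ^+ 4 * #|B|%:R <= 10 ^+ 9 * n%:R ^+ 4 :> R.
Proof.
move=> q0B xB kA; pose BT := {q | q \in B}.
have A0 : (0 < #|A|)%N by apply: leq_trans A_large.
have [G []] := natr_floor R (1000 * n) A0; rewrite !natrM => G1 G2.
have hI : injective (fun b : BT => h (val b)).
  move=> b b' hh; apply: val_inj; apply: xhI => //.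
  by rewrite !xB // (valP b, valP b').
have ddB a (b : BT) : de (dd a (val b)) = (al a - x q0) ^+ 2 + h (val b).
  by rewrite ddE /sqdist xB // (valP b).
have cb := column_bound G G alI hI ddB eeE.
have cardB : #|{: BT}| = #|B| by rewrite card_sig.
rewrite cardB in cb.
apply: (@column_arith _ _ _ _ (#|[set a | (x q0 < al a)%R]|%:R) G%:R
  (#|E| %/ G.+1)%:R (#|D| %/ G.+1)%:R) => //.
- by rewrite natr_pow10 ler_nat.
- by rewrite ler_nat.
- by rewrite -natrM ler_nat.
- exact: natr_divn_le.
- exact: natr_divn_le.
move: cb; rewrite -(ler_nat R) !(natrM, natrD) => /le_trans; apply.
rewrite lerD2r; apply: ler_pM; rewrite ?mulr_ge0 // ler_wpM2r //;
by rewrite ler_nat.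
Qed.
End Column.

Section Short.
Variables (R : realFieldType) (A Q D : finType).
Variables (al : A -> R) (x h : Q -> R) (de : D -> R) (dd : A -> Q -> D).
Hypothesis alI : injective al.
Hypothesis xhI : forall q q', x q = x q' -> h q = h q' -> q = q'.
Hypothesis ddE : forall a q, de (dd a q) = sqdist al x h q a.
Variables (n L rho s : nat).
Hypotheses (Qn : (#|Q| <= n)%N) (Dn : (#|D| <= n)%N) (An : (#|A| <= n)%N).
Hypothesis L0 : (0 < L)%N.
Hypothesis A_large : (10 ^ 5 * L <= #|A|)%N.
Hypothesis rows : forall y, (#|[set q | h q == y]| <= rho)%N.
Hypothesis rho_le : (rho * (10 ^ 6 * L ^ 2 * n) <= #|A| ^ 2)%N.
Hypothesis cols : forall q, (s <= #|[set q' | x q' == x q]| <= 2 * s)%N.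
Hypothesis s_le : (s * (10 ^ 9 * L ^ 3) <= #|A|)%N.
Hypothesis many :
  (n * #|A| <= 100 * L * \sum_q #|[set a | (x q < al a)%R]|)%N.

(** The lower and the upper bound for the number of double hits, compared.
    Since the columns are comparable, both the largest of them and their number
    are under control. *)
Lemma short_class_small : #|A|%:R ^+ 5 <= 10 ^+ 27 * L%:R ^+ 9 * n%:R ^+ 4 :> R.
Proof.
have A0 : (0 < #|A|)%N by apply: leq_trans A_large; rewrite muln_gt0 L0.
pose X : finType := seq_sub (codom x).
pose col q : X := SeqSub (codom_f x q).
have xiE q : ssval (col q) = x q by [].
have xiI : injective (fun c : X => ssval c) by exact: val_inj.
have colE q c : (col q == c) = (x q == ssval c) by rewrite -val_eqE.
have colW c : (#|[set q | col q == c]| <= 2 * s)%N.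
  have /codomP[q qc] := ssvalP c.
  apply: leq_trans (_ : (#|[set q' | x q' == x q]| <= _)%N).
    by apply/subset_leq_card/subsetP => q'; rewrite !inE colE qc.
  by case/andP: (cols q).
have sX : (s * #|X| <= n)%N.
  apply: leq_trans Qn; rewrite mulnC -sum_nat_const -[#|Q|]sum1_card.
  rewrite (partition_big col predT) //=; apply: leq_sum => c _.
  have /codomP[q qc] := ssvalP c; have /andP[+ _] := cols q => /leq_trans; apply.
  rewrite sum1dep_card; apply/subset_leq_card/subsetP => q'.
  by rewrite !inE colE qc.
have [G []] := natr_floor R (1000 * L * n) A0; rewrite !natrM => G1 G2.
pose S := (\sum_q #|[set a | (x q < al a)%R]|)%N.
pose M := #|short_steps al x h de G|.
pose T := (\sum_ef #|double_hits al x h ef|)%N.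
have hM : (S <= M + #|Q| * (1 + #|D| %/ G.+1))%N by exact: card_short_steps.
have hT : (M ^ 2 <= #|D| * G * (T + M * rho))%N.
  exact: (short_steps_collisions alI ddE).
have L1 : 1 <= L%:R :> R by rewrite ler1n.
have mL : 10 ^+ 5 * L%:R <= #|A|%:R :> R by rewrite natr_pow10 -natrM ler_nat.
have mn : #|A|%:R <= n%:R :> R by rewrite ler_nat.
have low : #|A|%:R ^+ 3 <= 10 ^+ 8 * L%:R ^+ 3 * T%:R :> R.
  apply: (@double_hits_lower R n%:R #|A|%:R L%:R S%:R M%:R T%:R #|Q|%:R #|D|%:R
    G%:R (#|D| %/ G.+1)%:R rho%:R) => //.
  - by rewrite -!natrM ler_nat.
  - by rewrite ler_nat.
  - by rewrite ler_nat.
  - exact: natr_divn_le.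
  - by move: hM; rewrite -(ler_nat R) !(natrM, natrD).
  - by move: hT; rewrite -(ler_nat R) !(natrM, natrD, natrX).
  - by move: rho_le; rewrite -(ler_nat R) !(natrM, natrD, natrX).
have T0 : (0 < T)%N.
  rewrite lt0n; apply/eqP => T0; move: low; rewrite T0 mulr0 leNgt => /negP; apply.
  by rewrite exprn_gt0 // ltr0n.
have [G' []] := natr_floor R (16 * #|A| ^ 2 * n) T0.
rewrite !(natrM, natrX) => G'1 G'2.
have up := sum_double_hits alI xhI xiE xiI colW G'.
apply: (@double_hits_upper R n%:R #|A|%:R L%:R T%:R #|Q|%:R s%:R #|X|%:R G'%:R
   (#|X| %/ G'.+1)%:R) => //.
- by rewrite ler_nat.
- by rewrite -natrM ler_nat.
- by move: s_le; rewrite -(ler_nat R) !(natrM, natrX).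
- exact: natr_divn_le.
- by move: up; rewrite -(ler_nat R) !(natrM, natrD, natrX).
Qed.
End Short.

Section LongRow.
Variables (R : realFieldType) (A P Q : finType).
Variables (al : A -> R) (xP : P -> R) (xQ c : Q -> R).
Hypothesis alI : injective al.
Hypothesis xPI : injective xP.
Hypothesis xQI : forall q q', xQ q = xQ q' -> c q = c q' -> q = q'.
Hypothesis c0 : forall q, c q != 0.
Variables (n L rho : nat).
Hypothesis rowP : forall q, (rho <= #|[set q' | c q' == c q]|)%N.
Hypotheses (rho0 : (0 < rho)%N) (rhoP : (rho <= #|P|)%N).
Hypotheses (An : (#|A| <= n)%N) (Qn : (#|Q| <= n)%N) (L0 : (0 < L)%N).
Hypothesis A_large : (10 ^ 5 <= #|A|)%N.
Hypothesis A_sqr : (10 ^ 4 * n <= #|A| ^ 2)%N.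
Hypothesis A_rho : (#|A| ^ 2 <= rho * (10 ^ 6 * L ^ 2 * n))%N.
Hypothesis many : (#|A| ^ 2 * #|P| <= 50 * \sum_v #|hits al xP xQ c v|)%N.

(** When m^2 r is at most 10^11 n^2, where r is the size of the row, the lower
    bound on [rho] alone suffices; otherwise the windows of [long_tangencies]
    are available. *)
Lemma long_row_tame : tame (n%:R : R) #|A|%:R L%:R.
Proof.
have A0 : (0 < #|A|)%N by apply: leq_trans A_large.
have P0 : (0 < #|P|)%N by apply: leq_trans rhoP.
have n0 : (0 < n)%N by apply: leq_trans An.
have L1 : 1 <= L%:R :> R by rewrite ler1n.
have n1 : 1 <= n%:R :> R by rewrite ler1n.
have mn : #|A|%:R <= n%:R :> R by rewrite ler_nat.
have m0 : 0 <= #|A|%:R :> R by [].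
have rhoR : #|A|%:R ^+ 2 <= rho%:R * (10 ^+ 6 * L%:R ^+ 2 * n%:R) :> R.
  by move: A_rho; rewrite -(ler_nat R) !(natrM, natrX).
have [few|lots] := leqP (#|A| ^ 2 * #|P|) (10 ^ 11 * n ^ 2).
  apply: tame_pow4 => //.
  have : (#|A| ^ 2 * #|P| * (10 ^ 6 * L ^ 2 * n) <=
      10 ^ 11 * n ^ 2 * (10 ^ 6 * L ^ 2 * n))%N by rewrite leq_mul2r few orbT.
  have : (#|A| ^ 2 * #|A| ^ 2 <= #|A| ^ 2 * (#|P| * (10 ^ 6 * L ^ 2 * n)))%N.
    rewrite leq_mul2l; apply/orP; right; apply: leq_trans A_rho _.
    by rewrite leq_mul2r rhoP orbT.
  rewrite mulnA => h1 h2; have := leq_trans h1 h2.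
  rewrite -(ler_nat R) !(natrM, natrX); congr (_ <= _); ring.
have A20 : (0 < #|A| ^ 2)%N by rewrite expn_gt0 A0.
have AP0 : (0 < #|A| ^ 2 * #|P|)%N by rewrite muln_gt0 A20.
have [G []] := natr_floor R (10 ^ 4 * n) A0.
rewrite !(natrM, natrX) => Ga Gb.
have [G2 []] := natr_floor R (10 ^ 11 * n ^ 2) A20.
rewrite !(natrM, natrX) => G2a G2b.
have [Bd []] := natr_floor R (10 ^ 11 * n ^ 3) AP0.
rewrite !(natrM, natrX) => Ba Bb.
pose F1 := (\sum_v #|arcs al xP xQ c G v|)%N.
pose F2 := (\sum_zz #|tangencies al xP xQ c G G2 Bd zz|)%N.
have eF1 := sum_hits_arcs xP xQ c alI G.
have F12 := sum_arcs_tangencies al xPI xQI c0 G G2 Bd.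
have sF2 : (F2 ^ 2 * rho ^ 2 <= #|P| * #|Q| * Bd *
    (F2 * rho + #|P| * #|Q| * ((2 * G2 + 1) * Bd ^ 2)))%N.
  exact: (sqr_sum_tangencies alI xPI xQI c0 G G2 Bd rowP).
rewrite -/F1 -/F2 in eF1 F12.
have m5 : 10 ^+ 5 <= #|A|%:R :> R by rewrite natr_pow10 ler_nat.
have big : #|A|%:R ^+ 2 * #|P|%:R <= 100 * F2%:R :> R.
  apply: (@long_tangencies R n%:R #|A|%:R #|P|%:R #|Q|%:R
    (\sum_v #|hits al xP xQ c v|)%:R F1%:R F2%:R G%:R G2%:R Bd%:R
    (#|A| %/ G.+1)%:R (#|P| %/ G2.+1)%:R (#|Q| %/ Bd.+1)%:R) => //.
  - by rewrite ltr0n.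
  - by rewrite ler_nat.
  - by move: A_sqr; rewrite -(ler_nat R) !(natrM, natrX).
  - by move: lots => /ltnW; rewrite -(ler_nat R) !(natrM, natrX).
  - exact: natr_divn_le.
  - exact: natr_divn_le.
  - exact: natr_divn_le.
  - by move: many; rewrite -(ler_nat R) !(natrM, natrX).
  - by move: eF1; rewrite -(ler_nat R) !(natrM, natrX, natrD).
  - by move: F12; rewrite -(ler_nat R) !(natrM, natrX, natrD).
have [] := @long_final R n%:R #|A|%:R L%:R #|P|%:R rho%:R #|Q|%:R F2%:R G2%:R Bd%:R
  L1 m5 mn _ _ _ _ rhoR _ _ _ G2a Ba big _ => //.
- by rewrite ltr0n.
- by rewrite ler_nat.
- by rewrite ler_nat.
- by move: sF2; rewrite -(ler_nat R) !(natrM, natrX, natrD).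
- exact: tame_pow8.
- exact: tame_pow22.
Qed.
End LongRow.

Section Long.
Variables (R : realFieldType) (A Q D : finType).
Variables (al : A -> R) (x h : Q -> R) (de : D -> R) (dd : A -> Q -> D).
Hypothesis alI : injective al.
Hypothesis xhI : forall q q', x q = x q' -> h q = h q' -> q = q'.
Hypothesis ddE : forall a q, de (dd a q) = sqdist al x h q a.
Variable long : {set Q}.

Definition right_of (q : Q) : {set A} := [set a | x q < al a].

Definition long_pairs (p : Q) : {set A * (A * Q)} :=
  [set z | [&& x p < al z.1, z.2.2 \in long, x z.2.2 < al z.2.1, h z.2.2 != h p
             & sqdist al x h p z.1 == sqdist al x h z.2.2 z.2.1]].

Let S := (\sum_(q in long) #|right_of q|)%N.

(** Two incidences in one row at equal distances differ by a translation, so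
    that one of them and the point on the line determine the other. *)
Lemma long_collisions :
  (S ^ 2 <= #|D| * (#|A| * S + \sum_(p in long) #|long_pairs p|))%N.
Proof.
pose I := [set z : Q * A | (z.1 \in long) && (z.2 \in right_of z.1)].
have cI : #|I| = S.
  rewrite -sum1dep_card -(pair_big_dep (mem long) (fun q a => a \in right_of q)
    (fun _ _ => 1%N)) /=.
  by apply: eq_bigr => q _; rewrite sum1_card.
pose F (z : Q * A) := dd z.2 z.1.
have := @sqr_card_le_collisions _ _ I F setT (fun _ _ => in_setT _).
rewrite cardsT cI => /leq_trans; apply; rewrite leq_mul2l; apply/orP; right.
pose same := [set zz in collisions I F | h zz.1.1 == h zz.2.1].
rewrite -(cardsID same); apply: leq_add.
  rewrite mulnC -cI -cardsT -cardsX.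
  apply: leq_trans (_ : (#|same| <= _)%N); first exact/subset_leq_card/subsetIr.
  apply: (@leq_card_in_to _ _ _ _ (fun zz : (Q * A) * (Q * A) => (zz.1, zz.2.2))).
  - move=> [[q a] [q' b]] [[r d] [r' e]] /setIdP[+ /= /eqP h1] /setIdP[+ /= /eqP h2].
    rewrite inE => /and3P[/=]; rewrite !inE /= => /andP[_ l1] /andP[_ l2] /eqP c1.
    move=> /and3P[/andP[_ l3] /andP[_ l4] /eqP c2].
    case=> *; subst r d e; congr (_, (_, _)).
    move: c1 c2 => /(congr1 de) + /(congr1 de); rewrite !ddE /sqdist h1 -h2 h1.
    by move=> /addIr c1 /addIr c2; apply: xhI; [nra | rewrite -h1].
  - move=> [[q a] [q' b]] /setIdP[+ _]; rewrite inE => /and3P[/= zI _ _].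
    by rewrite in_setX zI in_setT.
(* the coincidences between different rows *)
pose S' p := if p \in long then long_pairs p else set0.
apply: (@leq_trans #|[set z | z.2 \in S' z.1]|); last first.
  rewrite card_dep_pairs [X in (_ <= X)%N]big_mkcond; apply: leq_sum => p _.
  by rewrite /S'; case: ifP => // _; rewrite cards0.
apply: (@leq_card_in_to _ _ _ _
  (fun zz : (Q * A) * (Q * A) => (zz.1.1, (zz.1.2, (zz.2.2, zz.2.1))))).
  by move=> [[? ?] [? ?]] [[? ?] [? ?]] _ _ [-> -> -> ->].
move=> [[q a] [q' b]] /setDP[pC pN].
have hq : h q' != h q.
  by apply: contra pN => /eqP hh; apply/setIdP; rewrite /= hh.
move: pC; rewrite inE => /and3P[/=]; rewrite !inE /=.
move=> /andP[ql l1] /andP[ql' l2] /eqP /(congr1 de); rewrite !ddE => e.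
by rewrite /S' ql inE /= l1 ql' l2 hq e eqxx.
Qed.

Variables (n L rho : nat).
Hypothesis longE : forall q, (q \in long) = (rho <= #|[set q' | h q' == h q]|)%N.
Hypotheses (Dn : (5 * #|D| <= n + 5)%N) (rho0 : (0 < rho)%N).
Hypotheses (An : (#|A| <= n)%N) (Qn : (#|Q| <= n)%N) (L0 : (0 < L)%N).
Hypothesis A_large : (10 ^ 5 <= #|A|)%N.
Hypothesis A_sqr : (10 ^ 4 * n <= #|A| ^ 2)%N.
Hypothesis A_rho : (#|A| ^ 2 <= rho * (10 ^ 6 * L ^ 2 * n))%N.
Hypothesis many :
  (9 * (n * (#|A| - 1)) <= 40 * S)%N.

(** The coincidences are shared among the rows in proportion to their sizes, so
    that one long row has at least its share. *)
Lemma long_tame : tame (n%:R : R) #|A|%:R L%:R.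
Proof.
have A0 : (0 < #|A|)%N by apply: leq_trans A_large.
have n0 : (0 < n)%N by apply: leq_trans An.
set E := (\sum_(p in long) #|long_pairs p|)%N.
have E_big : (#|A| ^ 2 * n <= 50 * E)%N.
  rewrite mulnC -(ler_nat R) !(natrM, natrX).
  apply: (@long_hits_lower R n%:R #|A|%:R S%:R #|D|%:R E%:R) => //.
  - by rewrite natr_pow10 ler_nat.
  - by rewrite ler_nat.
  - by move: many; rewrite -(ler_nat R) !(natrM, natrX) natrB.
  - by move: Dn; rewrite -(ler_nat R) !(natrM, natrX, natrD).
  - by have := long_collisions; rewrite -(ler_nat R) !(natrM, natrX, natrD).
have long_n : (#|long| <= n)%N by apply: leq_trans Qn; apply: max_card.
have long0 : (0 < #|long|)%N.
  rewrite card_gt0; apply/eqP => l0; move: E_big; rewrite /E l0 big_set0 muln0.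
  by rewrite leqNgt muln_gt0 expn_gt0 A0 n0.
have {}E_big : (#|A| ^ 2 * #|long| <= 50 * E)%N.
  by apply: leq_trans E_big; rewrite leq_mul2l long_n orbT.
have [p0 p0l] := heavy_fiber h long0 E_big.
set row0 := [set t in long | _] => row0_big.
pose PT := {t | t \in row0}; pose QT := {q | (q \in long) && (h q != h p0)}.
pose c (q : QT) := h (val q) - h p0.
have rowE t : h t = h p0 -> t \in row0.
  by move=> ht; rewrite inE ht eqxx andbT longE ht -longE.
have Prow (p : PT) : h (val p) = h p0.
  by have := valP p; rewrite inE => /andP[_ /eqP].
have cardP : #|{: PT}| = #|row0| by rewrite card_sig.
apply: (@long_row_tame R A PT QT al (fun p => x (val p)) (fun q => x (val q)) c
  _ _ _ _ n L rho) => //.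
- by move=> p p' e; apply: val_inj; apply: xhI => //; rewrite !Prow.
- by move=> q q' e /addIr e'; apply: val_inj; apply: xhI.
- by move=> q; rewrite subr_eq0; case/andP: (valP q).
- move=> q; have /andP[+ hq] := valP q; rewrite longE => /leq_trans; apply.
  apply: leq_trans (_ : (#|val @: [set q' | c q' == c q]| <= _)%N).
    apply/subset_leq_card/subsetP => q'; rewrite inE => /eqP hq'.
    have q'P : (q' \in long) && (h q' != h p0).
      by rewrite hq' hq andbT longE hq' -longE; case/andP: (valP q).
    by apply/imsetP; exists (Sub q' q'P); rewrite // inE /c /= hq'.
  exact: leq_imset_card.
- rewrite cardP; have := p0l; rewrite longE => /leq_trans; apply.
  by apply/subset_leq_card/subsetP => q; rewrite inE => /eqP /rowE.
- by rewrite card_sig; apply: leq_trans Qn; apply: max_card.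
rewrite cardP; apply: leq_trans row0_big _; rewrite leq_mul2l /=.
rewrite (eq_bigl (mem row0)); last by move=> t; rewrite !inE.
rewrite (big_sub (mem row0)) -(pair_bigA _ (fun p q => #|hits al _ _ c (p, q)|)) /=.
apply: leq_sum => p _.
rewrite -(card_dep_pairs (fun q : QT => hits al (fun p : PT => x (val p)) (fun q : QT => x (val q)) c (p, q))).
apply: leq_trans (leq_imset_card (fun z : QT * (A * A) => (z.2.1, (z.2.2, val z.1))) _).
apply/subset_leq_card/subsetP => -[a [b q]].
rewrite inE /= => /and5P[l1 ql l2 hq /eqP e].
have qP : (q \in long) && (h q != h p0) by rewrite ql -(Prow p).
apply/imsetP; exists (Sub q qP, (a, b)) => //=; rewrite inE /=; apply/hitsP.
split=> //=; rewrite /c /= -(Prow p); move: e; rewrite /sqdist; lra.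
Qed.
End Long.

Section Assembly.
Variables (R : realFieldType) (A Q D E : finType).
Variables (al : A -> R) (x h : Q -> R) (de : D -> R) (dd : A -> Q -> D).
Variables (ep : E -> R) (ee : A -> A -> E).
Hypothesis alI : injective al.
Hypothesis xhI : forall q q', x q = x q' -> h q = h q' -> q = q'.
Hypothesis ddE : forall a q, de (dd a q) = sqdist al x h q a.
Hypothesis eeE : forall a a', ep (ee a a') = al a - al a'.
Variables (n L : nat).
Hypotheses (Dn : (5 * #|D| <= n + 5)%N) (En : (#|E| <= n)%N).
Hypotheses (An : (#|A| <= n)%N) (Qn : (#|Q| <= n)%N) (nL : (n < 2 ^ L)%N).
Hypothesis L0 : (0 < L)%N.
Hypothesis A_large : (10 ^ 5 * L <= #|A|)%N.

Let A5 : (10 ^ 5 <= #|A|)%N.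
Proof. by apply: leq_trans A_large; rewrite leq_pmulr. Qed.

Let A0 : (0 < #|A|)%N. Proof. exact: leq_trans A5. Qed.

Let n0 : (0 < n)%N. Proof. exact: leq_trans An. Qed.

Let Dn' : (#|D| <= n)%N.
Proof. by move: Dn (leq_trans A5 An); lia. Qed.

Local Notation k q := #|[set a | (x q < al a)%R]|.

Section ShortRows.
Variables (S : {set Q}) (rho : nat).
Hypothesis rows : {in S, forall q, (#|[set q' | h q' == h q]| <= rho)%N}.
Hypothesis rho_le : (rho * (10 ^ 6 * L ^ 2 * n) <= #|A| ^ 2)%N.
Hypothesis kS : {in S, forall q, (#|A| <= 100 * k q)%N}.
Hypothesis many : (n * #|A| <= 100 * \sum_(q in S) k q)%N.

(** Among the [L] dyadic classes of column sizes one carries at least the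
    average share of the incidences.  A column in it is either large, and
    [column_small] applies, or small enough for [short_class_small]. *)
Lemma short_tame : tame (n%:R : R) #|A|%:R L%:R.
Proof.
have L1 : 1 <= L%:R :> R by rewrite ler1n.
have n1 : 1 <= n%:R :> R by rewrite ler1n.
have mn : #|A|%:R <= n%:R :> R by rewrite ler_nat.
have m0 : 0 <= #|A|%:R :> R by [].
pose col q := [set q' in S | x q' == x q].
(* the dyadic class of the column of [q] within [S] *)
pose f q : 'I_L := insubd (Ordinal L0) (trunc_log 2 #|col q|).
have col_gt0 q : q \in S -> (0 < #|col q|)%N.
  by move=> qS; rewrite card_gt0; apply/set0Pn; exists q; rewrite inE qS eqxx.
have col_bounds q : q \in S -> (2 ^ f q <= #|col q| < 2 * 2 ^ f q)%N.
  move=> qS; have := @trunc_log_bounds 2 _ isT (col_gt0 q qS).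
  rewrite -expnS val_insubd; case: ifP => // /negbT; rewrite -leqNgt => Ll.
  case/andP=> le _; exfalso; move: nL; rewrite ltnNge => /negP; apply.
  apply: leq_trans (_ : (2 ^ trunc_log 2 #|col q| <= _)%N).
    by rewrite leq_exp2l.
  by apply: leq_trans le (leq_trans (max_card _) Qn).
have fx q q' : x q = x q' -> f q = f q' by rewrite /f /col => ->.
have sum0 : (0 < \sum_(q in S) k q)%N.
  rewrite lt0n; apply/eqP => s0; move: many; rewrite s0 muln0 leqNgt.
  by rewrite muln_gt0 n0 A0.
have [q1 q1S heavy] := heavy_class f sum0.
have [small|large] := leqP (2 ^ f q1 * (10 ^ 9 * L ^ 3)) #|A|.
  apply: tame_pow5 => //.
  pose S1 := [set q in S | f q == f q1]; pose QT := {q | q \in S1}.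
  apply: (@short_class_small R A QT D al (fun q => x (val q)) (fun q => h (val q))
     de (fun a q => dd a (val q)) alI _ _ n L rho (2 ^ f q1)) => //.
  - by move=> q q' xx hh; apply: val_inj; apply: xhI.
  - by rewrite card_sig; apply: leq_trans Qn; apply: max_card.
  - move=> y; rewrite (card_sig_set S1 (fun q => h q == y)).
    have [->|[q]] := set_0Vmem [set q in S1 | h q == y]; first by rewrite cards0.
    rewrite inE => /andP[]; rewrite inE => /andP[qS _] /eqP <-.
    apply: leq_trans (rows qS); apply/subset_leq_card/subsetP => q'.
    by rewrite !inE => /andP[].
  - move=> q; rewrite (card_sig_set S1 (fun q' => x q' == x (val q))).
    have := valP q; rewrite inE => /andP[qS /eqP fq].
    have := col_bounds _ qS; rewrite fq => /andP[lo hi].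
    rewrite (_ : [set _ in _ | _] = col (val q)) ?lo ?(ltnW hi) //.
    apply/setP => q'; rewrite !inE; case: (x q' =P _) => [e|_]; rewrite ?andbF //.
    by rewrite (fx _ _ e) fq eqxx andbT.
  - apply: leq_trans many _; rewrite -mulnA leq_mul2l; apply: leq_trans heavy _.
    rewrite (eq_bigl (mem S1)) => [|q]; last by rewrite !inE.
    by rewrite (big_sub (mem S1)).
have H : #|A|%:R ^+ 4 * #|col q1|%:R <= 10 ^+ 9 * n%:R ^+ 4 :> R.
  apply: (@column_small R A Q D E al x h de dd ep ee alI xhI ddE eeE n _ _ _ _
    _ q1) => //.
  - by rewrite inE q1S eqxx.
  - by move=> q; rewrite inE => /andP[_ /eqP].
  - exact: kS.
apply: tame_pow5 => //.
have lo : (2 ^ f q1)%:R <= #|col q1|%:R :> R.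
  by rewrite ler_nat; case/andP: (col_bounds _ q1S).
have up : #|A|%:R <= (2 ^ f q1)%:R * (10 ^+ 9 * L%:R ^+ 3) :> R.
  by move: large => /ltnW; rewrite -(ler_nat R) !(natrM, natrX).
have m4 : 0 <= #|A|%:R ^+ 4 :> R by rewrite exprn_ge0.
have c0 : 0 <= 10 ^+ 9 * L%:R ^+ 3 :> R by rewrite mulr_ge0 // exprn_ge0.
rewrite [leLHS]exprSr; apply: le_trans (ler_wpM2l m4 up) _; rewrite [leLHS]mulrA.
apply: le_trans (ler_wpM2r c0 (le_trans (ler_wpM2l m4 lo) H)) _.
have -> : 10 ^+ 27 * L%:R ^+ 9 * n%:R ^+ 4 =
  10 ^+ 9 * n%:R ^+ 4 * (10 ^+ 18 * L%:R ^+ 9) :> R by ring.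
apply: ler_wpM2l; first by rewrite mulr_ge0 // exprn_ge0.
by apply: ler_pM; rewrite ?exprn_ge0 // ler_weXn2l // ler1n.
Qed.
End ShortRows.

Hypothesis A_sqr : (10 ^ 4 * n <= #|A| ^ 2)%N.
Hypothesis many : (n * (#|A| - 1) <= 4 * \sum_q k q)%N.

(** In the short rows, points with less than a hundredth of the line to their
    right are discarded; they carry too few incidences to matter. *)
Lemma oriented_tame : tame (n%:R : R) #|A|%:R L%:R.
Proof.
pose c := (10 ^ 6 * L ^ 2 * n)%N; pose rho := (#|A| ^ 2 %/ c)%N.
have c0 : (0 < c)%N by rewrite muln_gt0 n0 andbT muln_gt0 !expn_gt0 L0.
pose long := [set q | (rho < #|[set q' | h q' == h q]|)%N].
pose S1 := [set q | (q \notin long) && (#|A| <= 100 * k q)%N].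
have [few|lots] := leqP (n * #|A|) (100 * \sum_(q in S1) k q).
  apply: (@short_tame S1 rho) => //.
  - by move=> q; rewrite !inE -leqNgt => /andP[].
  - exact: leq_divM.
  - by move=> q; rewrite inE => /andP[].
apply: (@long_tame R A Q D al x h de dd alI xhI ddE long n L rho.+1) => //.
- by move=> q; rewrite inE.
- exact/ltnW/ltn_ceil.
have split : (\sum_q k q = \sum_(q in long) k q +
    (\sum_(q in S1) k q + \sum_(q | (q \notin long) && (q \notin S1)) k q))%N.
  rewrite (bigID (mem long)) /=; congr (_ + _)%N.
  rewrite (bigID (mem S1)) /=; congr (_ + _)%N; apply: eq_bigl => q //.
  by rewrite [q \in S1]inE andbA andbb.
have tail : (100 * \sum_(q | (q \notin long) && (q \notin S1)) k q <= n * #|A|)%N.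
  rewrite big_distrr /=; apply: leq_trans (_ : (\sum_(q : Q) #|A| <= _)%N).
    rewrite big_mkcond; apply: leq_sum => q _; case: ifP => // /andP[ql].
    by rewrite inE ql /= -ltnNge => /ltnW.
  by rewrite sum_nat_const leq_mul2r Qn orbT.
move: many split tail lots; rewrite /right_of.
set s1 := (\sum_(q in S1) _)%N; set s2 := (\sum_(q in long) _)%N.
set s4 := (\sum_(q : Q) _)%N; set s3 := (\sum_(q | _ && _) _)%N => h1 h2 h3 h4.
have hm : (10 ^ 5 * n <= n * #|A|)%N by rewrite mulnC leq_mul2l A5 orbT.
rewrite mulnBr muln1 in h1 *; lia.
Qed.
End Assembly.

Section Unoriented.
Variables (R : realFieldType) (A Q D E : finType).
Variables (al : A -> R) (x h : Q -> R) (de : D -> R) (dd : A -> Q -> D).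
Variables (ep : E -> R) (ee : A -> A -> E).
Hypothesis alI : injective al.
Hypothesis xhI : forall q q', x q = x q' -> h q = h q' -> q = q'.
Hypothesis ddE : forall a q, de (dd a q) = sqdist al x h q a.
Hypothesis eeE : forall a a', ep (ee a a') = al a - al a'.
Variables (n L : nat).
Hypotheses (Dn : (5 * #|D| <= n + 5)%N) (En : (#|E| <= n)%N).
Hypotheses (An : (#|A| <= n)%N) (Qn : (#|Q| <= n)%N) (nQ : (n <= 2 * #|Q|)%N).
Hypotheses (nL : (n < 2 ^ L)%N) (L0 : (0 < L)%N) (n0 : (0 < n)%N).

(** One of the two orientations of the line has half of the incidences. *)
Theorem collinear_tame : tame (n%:R : R) #|A|%:R L%:R.
Proof.
have L1 : 1 <= L%:R :> R by rewrite ler1n.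
have n1 : 1 <= n%:R :> R by rewrite ler1n.
have mn : #|A|%:R <= n%:R :> R by rewrite ler_nat.
have m0 : 0 <= #|A|%:R :> R by [].
have [small|A_large] := leqP #|A| (10 ^ 5 * L).
  by apply: tame_small => //; rewrite natr_pow10 -natrM ler_nat.
have [small|A_sqr] := leqP (#|A| ^ 2) (10 ^ 4 * n).
  by apply: tame_sqr => //; rewrite natr_pow10 -natrM -natrX ler_nat.
pose kr q := #|[set a | (x q < al a)%R]|; pose kl q := #|[set a | (- x q < - al a)%R]|.
have both : (n * (#|A| - 1) <= 2 * (\sum_q kr q + \sum_q kl q))%N.
  apply: leq_trans (_ : (2 * (#|Q| * (#|A| - 1)) <= _)%N).
    by rewrite mulnA leq_mul2r nQ orbT.
  rewrite leq_mul2l /= -big_split -sum_nat_const /=; apply: leq_sum => q _.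
  rewrite leq_subLR -cardsT.
  apply: leq_trans (_ : (#|[set a | al a == x q]| + (kr q + kl q) <= _)%N).
    have -> : [set: A] = [set a | al a == x q] :|:
        ([set a | x q < al a] :|: [set a | - x q < - al a]).
      by apply/setP => a; rewrite !inE ltrN2; case: ltgtP.
    by apply: leq_trans (leq_card_setU _ _) _; rewrite leq_add2l leq_card_setU.
  rewrite leq_add2r; apply/card_le1_eqP => a b.
  by rewrite !inE => /eqP ea /eqP eb; apply: alI; rewrite ea.
have [right|left] := leqP (n * (#|A| - 1)) (4 * \sum_q kr q).
  exact: (@oriented_tame R A Q D E al x h de dd ep ee alI xhI ddE eeE n L Dn En An Qn
     nL L0 (ltnW A_large) (ltnW A_sqr) right).
apply: (@oriented_tame R A Q D E (fun a => - al a) (fun q => - x q) h de dd ep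
  (fun a b => ee b a) _ _ _ _ n L Dn En An Qn nL L0 (ltnW A_large) (ltnW A_sqr)).
- by move=> a b /oppr_inj /alI.
- by move=> q q' /oppr_inj; apply: xhI.
- by move=> a q; rewrite ddE /sqdist; ring.
- by move=> a b; rewrite eeE opprK addrC.
rewrite -/(kl _); move: both left.
set s1 := (\sum_q kr q)%N; set s2 := (\sum_q _)%N; lia.
Qed.
End Unoriented.

(** * Points in the plane *)

Section Line.
Variables (R : rcfType) (T D : finType) (t : T -> R).
Variables (de : D -> R) (dd : T -> T -> D) (L : nat).
Hypotheses (Dn : (5 * #|D| <= #|T| + 5)%N) (TL : (#|T| < 2 ^ L)%N).
Hypotheses (T0 : (0 < #|T|)%N) (L0 : (0 < L)%N).

(** A difference of abscissae is encoded by its sign and a squared distance,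
    which gives at most 2 (n + 5)/5 differences, and this is at most n for n at
    least 4. *)
Lemma half_plane_tame (s : T -> R) :
  (forall p q, t p = t q -> s p = s q -> p = q) ->
  (forall p q, de (dd p q) = (t p - t q) ^+ 2 + (s p - s q) ^+ 2) ->
  (#|T| <= 2 * #|[set p | (0 <= s p)%R]|)%N ->
  tame (#|T|%:R : R) #|[set p | s p == 0]|%:R L%:R.
Proof.
move=> tsI ddE half; set l := [set p | s p == 0].
have L1 : 1 <= L%:R :> R by rewrite ler1n.
have n1 : 1 <= #|T|%:R :> R by rewrite ler1n.
have [T4|T4] := ltnP #|T| 4.
  apply: tame_small => //.
  have : (#|l| <= 10 ^ 5 * L)%N.
    apply: leq_trans (max_card _) _; apply: leq_trans (ltnW T4) _.
    by apply: leq_trans (_ : (10 ^ 5 <= _)%N) => //; rewrite leq_pmulr.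
  by rewrite natr_pow10 -natrM ler_nat.
pose A := {p | p \in l}; pose Q := {p | p \in [set p | (0 <= s p)%R]}.
have cA : #|{: A}| = #|l| by rewrite card_sig.
have cQ : #|{: Q}| = #|[set p | (0 <= s p)%R]| by rewrite card_sig.
have sA (p : A) : s (val p) = 0 by have := valP p; rewrite inE => /eqP.
have sQ (q : Q) : 0 <= s (val q) by have := valP q; rewrite inE.
rewrite -cA.
pose ep (bd : bool * D) : R := if bd.1 then Num.sqrt (de bd.2) else - Num.sqrt (de bd.2).
pose ee (p q : A) := (t (val q) <= t (val p), dd (val p) (val q)).
apply: (@collinear_tame R A Q D _ (fun p => t (val p)) (fun q => t (val q))
  (fun q => s (val q) ^+ 2) de (fun p q => dd (val p) (val q)) ep ee _ _ _ _
  #|T| L) => //.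
- by move=> p q e; apply: val_inj; apply: tsI; rewrite ?sA.
- move=> p q e /eqP; rewrite eqrXn2 // => /eqP e'.
  by apply: val_inj; apply: tsI.
- by move=> p q; rewrite ddE /sqdist sA sub0r sqrrN.
- move=> p q; rewrite /ep /ee /= ddE !sA subrr expr0n addr0 sqrtr_sqr.
  by case: lerP; rewrite ?opprB.
- by rewrite card_prod card_bool; move: Dn T4; lia.
- by rewrite cA; apply: max_card.
- by rewrite cQ; apply: max_card.
- by rewrite cQ.
Qed.

Lemma line_tame (s : T -> R) :
  (forall p q, t p = t q -> s p = s q -> p = q) ->
  (forall p q, de (dd p q) = (t p - t q) ^+ 2 + (s p - s q) ^+ 2) ->
  tame (#|T|%:R : R) #|[set p | s p == 0]|%:R L%:R.
Proof.
move=> tsI ddE.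
have [|half] := leqP #|T| (2 * #|[set p | (0 <= s p)%R]|).
  exact: half_plane_tame.
rewrite (_ : [set p | s p == 0] = [set p | - s p == 0]); last first.
  by apply/setP => p; rewrite !inE oppr_eq0.
apply: half_plane_tame.
- by move=> p q e /oppr_inj; apply: tsI.
- by move=> p q; rewrite ddE; ring.
have : (#|T| <= #|[set p | (0 <= s p)%R]| + #|[set p | (0 <= - s p)%R]|)%N.
  apply: leq_trans (leq_card_setU _ _); rewrite -cardsT.
  apply/subset_leq_card/subsetP => p _; rewrite !inE oppr_ge0.
  by case: ltgtP.
move: half; lia.
Qed.
End Line.

From mathcomp Require Import finmap.
From mathcomp Require Import all_classical all_reals all_analysis.

Local Open Scope fset_scope.
Local Open Scope classical_set_scope.
Local Open Scope ring_scope.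

(** The coordinates are scaled by [Num.sqrt (a ^+ 2 + b ^+ 2)] to avoid a
    division; [None] stands for the distance 0, which is not counted. *)
Lemma line_points_tame (R : realType) (n L : nat) (P : {fset R * R})
    (l : set (R * R)) :
  (0 < n)%N -> #|` P| = n -> (num_distances P)%:R <= n%:R / 5 :> R ->
  is_line l -> (n < 2 ^ L)%N -> (0 < L)%N ->
  tame (n%:R : R) (#|` [fset p in P | p \in l] |)%:R L%:R.
Proof.
move=> n0 Pn few [a [b [c [ab0 lE]]]] nL L0.
set DS := [fset eucl_dist p q | p in P, q in P & p != q].
have cDS : #|` DS| = num_distances P by [].
pose k := a ^+ 2 + b ^+ 2.
have k0 : 0 < k.
  rewrite lt_neqAle addr_ge0 ?sqr_ge0 // andbT eq_sym paddr_eq0 ?sqr_ge0 //.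
  by rewrite !sqrf_eq0; apply: contra ab0 => /andP[/eqP -> /eqP ->].
pose t (p : P) := - b * (val p).1 + a * (val p).2.
pose s (p : P) := a * (val p).1 + b * (val p).2 - c.
pose de (d : option DS) : R := if d is Some d then k * val d ^+ 2 else 0.
pose dd (p q : P) : option DS := insub (eucl_dist (val p) (val q)).
have cP : #|{: P}| = n by rewrite -cardfE.
have dist2 p q : k * eucl_dist (val p) (val q) ^+ 2 =
    (t p - t q) ^+ 2 + (s p - s q) ^+ 2 :> R.
  by rewrite /eucl_dist sqr_sqrtr ?addr_ge0 ?sqr_ge0 // /k /t /s; ring.
have main : tame (#|{: P}|%:R : R) #|finset.finset (fun p => s p == 0)|%:R L%:R.
  apply: (@line_tame R P (option DS) t de dd L) => //.
  - rewrite card_option -cardfE cDS cP; move: few.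
    by rewrite ler_pdivlMr // -natrM ler_nat; lia.
  - by rewrite cP.
  - by rewrite cP.
  - move=> p q tt ss; have := dist2 p q; rewrite tt ss !subrr !expr0n addr0 => /eqP.
    rewrite mulf_eq0 gt_eqF //= /eucl_dist sqr_sqrtr ?addr_ge0 ?sqr_ge0 //.
    rewrite paddr_eq0 ?sqr_ge0 // !sqrf_eq0 !subr_eq0 => /andP[/eqP e1 /eqP e2].
    by apply: val_inj; apply: injective_projections.
  - move=> p q; rewrite -dist2 /dd /de; case: insubP => [d _ -> //|].
    have [-> _|pq] := eqVneq p q.
      by rewrite /eucl_dist !subrr expr0n addr0 sqrtr0 expr0n mulr0.
    case/negP; apply/imfset2P; exists (val p); rewrite ?(valP p) //.
    exists (val q) => //; rewrite !inE (valP q) /=; apply: contra pq => /eqP e.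
    exact/eqP/val_inj.
rewrite -cP; apply: le_trans main; apply: lerXn2r; rewrite ?nnegrE // ler_nat.
set F : {fset R * R} := [fset p in P | p \in l].
have FP : (F `<=` P)%fset by apply/fsubsetP => p; rewrite !inE => /andP[].
rewrite cardfE -cardsT.
pose g (p : F) : P := fincl FP p.
have gI : injective g.
  by move=> p q /(congr1 val) e; apply: val_inj.
rewrite -(card_imset _ gI); apply/subset_leq_card/fintype.subsetP => _ /finset.imsetP[p _ ->].
have := valP p; rewrite !inE lE => /andP[_]; rewrite inE /= => e.
by rewrite /s /= e subrr.
Qed.

(** The exponent 43/52 is not tight here: 11 * 43/52 exceeds 9. *)
Lemma tame_powR (R : realType) (n m L : nat) (K : R) :
  (2 <= n)%N -> 1 <= K -> L%:R <= K * ln n%:R -> tame (n%:R : R) m%:R L%:R ->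
  m%:R <= 10 ^+ 60 * K ^+ 20 * n%:R `^ (43 / 52) * ln n%:R `^ (20 / 11) :> R.
Proof.
move=> n2 K1 LK; rewrite /tame.
have : 1 <= 10 ^+ 60 :> R by rewrite exprn_ege1 // ler1n.
move: (10 ^+ 60 : R) => T T1 mL.
have T0 : 0 < T by apply: lt_le_trans T1.
have K0 : 0 <= K by apply: le_trans K1.
have n1 : 1 <= n%:R :> R by rewrite ler1n (leq_trans _ n2).
have ln0 : 0 <= ln n%:R :> R by rewrite ln_ge0.
have Kp : 1 <= K ^+ 20 by exact: exprn_ege1.
have LL : L%:R ^+ 20 <= K ^+ 20 * ln n%:R ^+ 20.
  by rewrite -exprMn; apply: lerXn2r; rewrite ?nnegrE // mulr_ge0.
move: (K ^+ 20) Kp LL => {K K1 K0 LK} K K1 LL.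
have C1 : 1 <= T * K by apply: mulr_ege1.
have C0 : 0 <= T * K by apply: le_trans C1.
have rhs0 : 0 <= T * K * n%:R `^ (43 / 52) * ln n%:R `^ (20 / 11).
  by apply: mulr_ge0; [apply: mulr_ge0 |]; rewrite ?powR_ge0.
rewrite -(@ler_pXn2r _ 11) // ?nnegrE //; apply: le_trans mL _.
have pow11 (a r : R) : 0 <= a -> (a `^ r) ^+ 11 = a `^ (r * 11).
  by move=> a0; rewrite -powR_mulrn ?powR_ge0 // -powRrM.
have -> : (T * K * n%:R `^ (43 / 52) * ln n%:R `^ (20 / 11)) ^+ 11 =
    (T * K) ^+ 11 * n%:R `^ (43 / 52 * 11) * ln n%:R ^+ 20.
  rewrite [LHS]exprMn [X in X * _ = _]exprMn !pow11 //.
  by rewrite (divfK _ 20) ?pnatr_eq0 // powR_mulrn.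
have nn : n%:R ^+ 9 <= n%:R `^ (43 / 52 * 11) :> R.
  by rewrite -powR_mulrn //; apply: ler_powR => //; lra.
have CC : T * K <= (T * K) ^+ 11 by rewrite ler_eXnr.
apply: (@le_trans _ _ (T * n%:R `^ (43 / 52 * 11) * (K * ln n%:R ^+ 20))).
  have a0 : 0 <= T * n%:R ^+ 9 by apply: mulr_ge0; [exact: ltW | exact: exprn_ge0].
  have b0 : 0 <= L%:R ^+ 20 :> R by exact: exprn_ge0.
  by apply: ler_pM => //; apply: ler_wpM2l => //; exact: ltW.
have -> : T * n%:R `^ (43 / 52 * 11) * (K * ln n%:R ^+ 20) =
  T * K * n%:R `^ (43 / 52 * 11) * ln n%:R ^+ 20 by ring.
apply: ler_wpM2r; first exact: exprn_ge0.
by apply: ler_wpM2r => //; exact: powR_ge0.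
Qed.

Lemma trunc_log_ln (R : realType) (n : nat) : (2 <= n)%N ->
  (trunc_log 2 n).+1%:R <= 2 / ln 2 * ln n%:R :> R.
Proof.
move=> n2; have n0 : (0 < n)%N by exact: leq_trans n2.
have ln2 : 0 < ln 2 :> R by rewrite ln_gt0 // ltr1n.
have t1 : (0 < trunc_log 2 n)%N by rewrite trunc_log_gt0.
rewrite mulrAC ler_pdivlMr //.
apply: (@le_trans _ _ (2 * ((trunc_log 2 n)%:R * ln 2))).
  rewrite [leRHS]mulrA; apply: ler_wpM2r; first exact: ltW.
  by rewrite -natrM ler_nat; lia.
rewrite ler_pM2l // mulr_natl -lnXn // ler_ln ?posrE ?exprn_gt0 ?ltr0n //.
by rewrite -natrX ler_nat trunc_logP.
Qed.

Theorem theorem1 (R : realType) :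
  exists C c : R, [/\ 0 < C, 0 < c &
    forall (n : nat) (P : {fset R * R}) (l : set (R * R)),
      (2 <= n)%N ->
      #|` P| = n ->
      (num_distances P)%:R <= n%:R / 5 :> R ->
      is_line l ->
      (#|` [fset p in P | p \in l] |)%:R <=
        C * (n%:R `^ (43 / 52)) * (ln n%:R `^ c)].
Proof.
have ln2 : 0 < ln 2 :> R by rewrite ln_gt0 // ltr1n.
pose K : R := 1 + 2 / ln 2.
have K1 : 1 <= K by rewrite lerDl divr_ge0 // ltW.
exists (10 ^+ 60 * K ^+ 20), (20 / 11); split.
- by rewrite mulr_gt0 ?exprn_gt0 // (lt_le_trans _ K1).
- by rewrite divr_gt0.
move=> n P l n2 Pn few line; have n0 : (0 < n)%N by exact: leq_trans n2.
apply: (@tame_powR _ _ _ (trunc_log 2 n).+1) => //.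
  apply: le_trans (trunc_log_ln R n2) _.
  by rewrite ler_wpM2r ?ln_ge0 ?ler1n // lerDr.
by apply: line_points_tame => //; rewrite trunc_log_ltn.
Qed.
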